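(* (1) The multipole space $\mathcal M^{\mathbb R}(d)=[\mathbb R^{3\,\circ}]^d/\Sigma_d^{\mathbb R}$ is diffeomorphic to the space $(\mathbb R^{2d+1})^\circ\approx S^{2d}\times\mathbb R$. (2) The multipole space $\overline{\mathcal M}^{\mathbb R}(d)$ is homeomorphic to the space $\mathbb R^{2d+1}$. (3) The real varieties $Sym^d(\mathbb{RP}^2)$ and $\mathbb{RP}^{2d}$ are diffeomorphic.
   Context: For a vector space $V$, $V^\circ=V\setminus\{0\}$. $H_d^{\mathbb R}=\{(\lambda_i)\in(\mathbb R^\ast)^d:\prod\lambda_i=1\}$, and $\Sigma_d^{\mathbb R}$ is the group of transformations of $[\mathbb R^{3\,\circ}]^d$ generated by $H_d^{\mathbb R}$ (rescaling the vectors) and the symmetric group $S_d$ (permuting them). $Sym^d(X)=X^d/S_d$. $\mathbb R^\ast$ acts on $\mathcal M^{\mathbb R}(d)$ by multiplying one of the vectors by a scalar, making $\mathcal M^{\mathbb R}(d)$ a principal $\mathbb R^\ast$-fibration over $Sym^d(\mathbb{RP}^2)$. $\overline{\mathcal M}^{\mathbb R}(d)$ is the total space $\mathcal M^{\mathbb R}(d)\times_{\mathbb R^\ast}\mathbb R$ of the associated line bundle with its zero section collapsed to a point. $Sym^d(\mathbb{RP}^2)$, and hence $\mathcal M^{\mathbb R}(d)$, is regarded as a nonsingular manifold, because locally $\mathbb{RP}^2$ and $\mathbb{CP}^1$ are diffeomorphic and $Sym^d(\mathbb{CP}^1)\approx\mathbb{CP}^d$ is nonsingular. *)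

(* Defs.v *)
From HB Require Import structures.
From mathcomp Require Import all_boot all_order perm all_algebra.
From mathcomp Require Import all_classical all_reals all_analysis.
From mathcomp Require Import complex.

Set Implicit Arguments.
Unset Strict Implicit.
Unset Printing Implicit Defensive.

Import Order.TTheory GRing.Theory Num.Theory.
Import numFieldNormedType.Exports.

Local Open Scope classical_set_scope.
Local Open Scope ring_scope.
Local Open Scope quotient_scope.

Section Homeomorphic.
Context {X Y : topologicalType}.

Definition homeomorphic : Prop :=
  exists (f : X -> Y) (g : Y -> X),
    [/\ cancel f g, cancel g f, continuous f & continuous g].

End Homeomorphic.
Arguments homeomorphic : clear implicits.

Definition bijections {T : Type} : set (T -> T) := [set g : T -> T | bijective g].

Section OrbitSpace.
Context {T : topologicalType}.
Implicit Type S : set (T -> T).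

Inductive generated S : (T -> T) -> Prop :=
| gen_id : generated S id
| gen_mem g : S g -> generated S g
| gen_comp g h : generated S g -> generated S h -> generated S (g \o h)
| gen_inv g h : generated S g -> cancel g h -> cancel h g -> generated S h.

Definition orbit_rel S (x y : T) : bool := `[< exists2 g, generated S g & g x = y >].

Variables (S : set (T -> T)) (bijS : S `<=` bijections).

Lemma generated_bij g : generated S g -> bijective g.
Proof.
elim=> {g} [|g /bijS //|g h _ bg _ bh|g h _ _ gK hK].
- by exists id.
- exact: bij_comp.
- by exists g.
Qed.

Lemma orbit_rel_refl : reflexive (orbit_rel S).
Proof. by move=> x; apply/asboolP; exists id => //; exact: gen_id. Qed.

Lemma orbit_rel_sym : symmetric (orbit_rel S).
Proof.
suff sub x y : orbit_rel S x y -> orbit_rel S y x.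
  by move=> x y; apply/idP/idP; exact: sub.
move=> /asboolP[g Sg <-]; apply/asboolP.
by have [h gK hK] := generated_bij Sg; exists h; [exact: gen_inv hK|].
Qed.

Lemma orbit_rel_trans : transitive (orbit_rel S).
Proof.
move=> y x z /asboolP[g Sg <-] /asboolP[h Sh <-]; apply/asboolP.
by exists (h \o g) => //; exact: gen_comp.
Qed.

Definition orbit_equiv : equiv_rel T :=
  EquivRel (orbit_rel S) orbit_rel_refl orbit_rel_sym orbit_rel_trans.

(* The quotient of T by the group of transformations generated by S, with the
   quotient topology. *)
Definition orbit_space := quotient_topology {eq_quot orbit_equiv}.

HB.instance Definition _ := Quotient.on orbit_space.
HB.instance Definition _ := Topological.on orbit_space.

Lemma orbit_spaceP (x y : T) :
  (\pi_orbit_space x = \pi_orbit_space y) <-> exists2 g, generated S g & g x = y.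
Proof.
split; first by move=> /eqmodP/asboolP.
by move=> h; apply/eqmodP/asboolP.
Qed.

End OrbitSpace.

Section Collapse.
Context {T : topologicalType} (A : set T).

Definition collapse_rel (x y : T) : bool := `[< x = y \/ A x /\ A y >].

Lemma collapse_rel_refl : reflexive collapse_rel.
Proof. by move=> x; apply/asboolP; left. Qed.

Lemma collapse_rel_sym : symmetric collapse_rel.
Proof.
by move=> x y; apply: asbool_equiv_eq; split=> -[->|[]]; by [left|right].
Qed.

Lemma collapse_rel_trans : transitive collapse_rel.
Proof.
move=> y x z /asboolP[->//|[Ax Ay]] /asboolP[<-|[_ Az]]; apply/asboolP; by right.
Qed.

Definition collapse_equiv : equiv_rel T :=
  EquivRel collapse_rel collapse_rel_refl collapse_rel_sym collapse_rel_trans.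

(* The topological quotient T / A. *)
Definition collapse := quotient_topology {eq_quot collapse_equiv}.

HB.instance Definition _ := Quotient.on collapse.
HB.instance Definition _ := Topological.on collapse.

End Collapse.

Section Smooth.
Context {R : realType}.

(* C^k on an open set U, through iterated partial derivatives. *)
Fixpoint Ck_on (k : nat) (n m : nat) (U : set 'rV[R]_n) (f : 'rV[R]_n -> 'rV[R]_m)
    : Prop :=
  (forall x, U x -> {for x, continuous f}) /\
  (if k is k'.+1 then
     forall i : 'I_n,
       (forall x, U x -> derivable f x (delta_mx 0 i)) /\
       Ck_on k' U (fun x => 'D_(delta_mx 0 i) f x)
   else True).

Definition smooth_on n m (U : set 'rV[R]_n) (f : 'rV[R]_n -> 'rV[R]_m) : Prop :=
  forall k, Ck_on k U f.

Record chart (M : Type) (n : nat) := Chart {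
  dom : set M;
  coord : M -> 'rV[R]_n  (* junk outside of dom *)
}.

Definition is_chart (M : topologicalType) n (c : chart M n) : Prop :=
  [/\ open (dom c),
      {in dom c &, injective (coord c)},
      forall x, dom c x -> {for x, continuous (coord c)} &
      forall V, open V -> V `<=` dom c -> open (coord c @` V)].

(* The local expression e o f o c^-1 of f is smooth on its (open) domain. *)
Definition smooth_in_charts (M N : Type) n m (c : chart M n) (e : chart N m)
    (f : M -> N) : Prop :=
  let W := dom c `&` f @^-1` dom e in
  exists2 g : 'rV[R]_n -> 'rV[R]_m,
    smooth_on (coord c @` W) g & forall x, W x -> g (coord c x) = coord e (f x).

Definition smooth_atlas (M : topologicalType) n (A : set (chart M n)) : Prop :=
  [/\ forall c, A c -> is_chart c,
      forall x, exists2 c, A c & dom c x &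
      forall c c', A c -> A c' -> smooth_in_charts c c' id].

Definition smooth_map (M N : topologicalType) n m
    (A : set (chart M n)) (B : set (chart N m)) (f : M -> N) : Prop :=
  continuous f /\ forall c e, A c -> B e -> smooth_in_charts c e f.

(* For the spaces M and N with the structures given by the atlases A and B; it
   includes that A and B do define smooth structures. *)
Definition diffeomorphic (M N : topologicalType) n m
    (A : set (chart M n)) (B : set (chart N m)) : Prop :=
  [/\ smooth_atlas A, smooth_atlas B &
      exists (f : M -> N) (g : N -> M),
        [/\ cancel f g, cancel g f, smooth_map A B f & smooth_map B A g]].

Definition prod_atlas (M N : Type) n m (A : set (chart M n)) (B : set (chart N m))
    : set (chart (M * N) (n + m)) :=
  [set c | exists a b, [/\ A a, B b &
     c = Chart (dom a `*` dom b) (fun x => row_mx (coord a x.1) (coord b x.2))]].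

Definition line_atlas : set (chart R 1) := [set Chart setT (fun t => const_mx t)].

End Smooth.

Section Multipole_spaces.
Variable R : realType.

Definition Rstar := {l : R | l != 0}.

Definition rstar1 : Rstar := Sub 1 (oner_neq0 R).

Lemma rstarV_subproof (l : Rstar) : (val l)^-1 != 0.
Proof. by rewrite invr_eq0 (valP l). Qed.
Definition rstarV (l : Rstar) : Rstar := Sub (val l)^-1 (rstarV_subproof l).

Definition punctured n := set_type [set v : 'rV[R]_n | v != 0].
HB.instance Definition _ n := Topological.on (punctured n).

Definition punctured_atlas n : set (chart (punctured n) n) :=
  [set Chart setT (fun v => val v)].

Lemma scale_subproof n (l : Rstar) (v : punctured n) :
  val l *: val v \in [set v : 'rV[R]_n | v != 0].
Proof.
have := valP v; rewrite !in_setE /= scaler_eq0 negb_or => ->.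
by rewrite (valP l).
Qed.
Definition scale n (l : Rstar) (v : punctured n) : punctured n :=
  Sub (val l *: val v) (scale_subproof l v).

Lemma scale_val n l (v : punctured n) : val (scale l v) = val l *: val v.
Proof. by []. Qed.

Lemma scaleK n l : cancel (@scale n l) (scale (rstarV l)).
Proof.
by move=> v; apply: val_inj; rewrite !scale_val scalerA mulVf ?scale1r // (valP l).
Qed.

Lemma scaleVK n l : cancel (@scale n (rstarV l)) (scale l).
Proof.
by move=> v; apply: val_inj; rewrite !scale_val scalerA mulfV ?scale1r // (valP l).
Qed.

Definition sphere n := set_type [set x : 'rV[R]_n.+1 | \sum_i x 0 i ^+ 2 = 1].
HB.instance Definition _ n := Topological.on (sphere n).

(* Orthogonal projections of the open hemispheres {x_i > 0} and {x_i < 0}. *)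
Definition sphere_atlas n : set (chart (sphere n) n) :=
  [set c | exists (i : 'I_n.+1) (b : bool),
     c = Chart [set x : sphere n | 0 < (-1) ^+ b * val x 0 i]
               (fun x => \row_(j < n) val x 0 (lift i j))].

Definition dilations n : set (punctured n -> punctured n) := range (@scale n).

Lemma dilations_bij n : @dilations n `<=` bijections.
Proof. by move=> _ [l _ <-]; exact: Bijective (@scaleK n l) (@scaleVK n l). Qed.

Definition RP n := orbit_space (@dilations_bij n.+1).
HB.instance Definition _ n := Quotient.on (RP n).
HB.instance Definition _ n := Topological.on (RP n).

(* [x_0 : ... : x_n] |-> (x_j / x_i)_(j != i) on {x_i != 0}. *)
Definition RP_atlas n : set (chart (RP n) n) :=
  [set c | exists i : 'I_n.+1,
     c = Chart [set x : RP n | val (repr x) 0 i != 0]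
               (fun x => \row_(j < n) (val (repr x) 0 (lift i j) / val (repr x) 0 i))].

Section Sym.
Variables (X : topologicalType) (d : nat).

Definition power := prod_topology (fun _ : 'I_d => X).
HB.instance Definition _ := Topological.on power.

Definition permute (s : 'S_d) (v : power) : power := fun i => v (s i).

Lemma permute_bij : range permute `<=` bijections.
Proof.
move=> _ [s _ <-]; exists (permute s^-1%g) => v; apply: funext => i.
  by rewrite /permute permKV.
by rewrite /permute permK.
Qed.

Definition Sym := orbit_space permute_bij.
HB.instance Definition _ := Quotient.on Sym.
HB.instance Definition _ := Topological.on Sym.

End Sym.

Section Multipoles.
Variable d : nat.

Definition rescale (l : 'I_d -> Rstar) (v : power (punctured 3) d)
  : power (punctured 3) d := fun i => scale (l i) (v i).

Definition Hd : set (power (punctured 3) d -> power (punctured 3) d) :=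
  [set rescale l | l in [set l | \prod_i val (l i) = 1]].

Lemma rescaleK l : cancel (rescale l) (rescale (fun i => rstarV (l i))).
Proof. by move=> v; apply: funext => i; exact: scaleK. Qed.

Lemma rescaleVK l : cancel (rescale (fun i => rstarV (l i))) (rescale l).
Proof. by move=> v; apply: funext => i; exact: scaleVK. Qed.

Lemma Sigma_bij :
  Hd `|` range (@permute (punctured 3) d) `<=` bijections.
Proof.
move=> g [[l _ <-]|/permute_bij//].
exact: Bijective (rescaleK l) (rescaleVK l).
Qed.

Definition multipole := orbit_space Sigma_bij.
HB.instance Definition _ := Quotient.on multipole.
HB.instance Definition _ := Topological.on multipole.

Definition scale_at (j : nat) (l : Rstar) :=
  rescale (fun i => if i == j :> nat then l else rstar1).

(* By act_pi, any of the d vectors may be scaled instead of the first one. *)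
Definition act (l : Rstar) (m : multipole) : multipole :=
  \pi_multipole (scale_at 0 l (repr m)).

Let Sg := generated (Hd `|` range (@permute (punctured 3) d)).

Lemma scale_at_swap (i j : 'I_d) l v :
  exists2 g, Sg g & g (scale_at i l v) = scale_at j l v.
Proof.
have [<-|nij] := eqVneq i j; first by exists id => //; exact: gen_id.
pose k (x : 'I_d) := if x == i then rstarV l else if x == j then l else rstar1.
exists (rescale k).
  apply/gen_mem; left; exists k => //=.
  rewrite (bigD1 i) //= (bigD1 j) 1?eq_sym //= big1 => [|x /andP[xi xj]].
    by rewrite mulr1 /k eqxx eq_sym (negPf nij) eqxx mulVf // (valP l).
  by rewrite /k (negPf xi) (negPf xj).
apply: funext => x; apply: val_inj; rewrite /scale_at /rescale /k !scale_val.
rewrite !val_eqE; have [->|xi] := eqVneq x i.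
  by rewrite (negPf nij) /= scalerA mulVf ?(valP l).
by case: eqVneq => /= _; rewrite !scale1r.
Qed.

Lemma act_pi (j : 'I_d) l v :
  act l (\pi_multipole v) = \pi_multipole (scale_at j l v).
Proof.
have d0 : (0 < d)%N by apply: leq_ltn_trans (ltn_ord j).
pose o := Ordinal d0.
have swap i k w : \pi_multipole (scale_at (i : 'I_d) l w)
               = \pi_multipole (scale_at (k : 'I_d) l w).
  by apply/orbit_spaceP; exact: scale_at_swap.
have piS g w : Sg g -> \pi_multipole (g w) = \pi_multipole w.
  by move=> Sg_g; symmetry; apply/orbit_spaceP; exists g.
have inv g : Sg g -> forall w,
    \pi_multipole (scale_at o l (g w)) = \pi_multipole (scale_at o l w).
  elim=> {g} // [g [[k k1 <-]|[s _ <-]] w|g h _ IHg _ IHh w|g h Sgg IHg gK hK w].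
  - rewrite -[RHS](piS (rescale k)); last by apply: gen_mem; left; exists k.
    congr (\pi _); apply: funext => i; apply: val_inj.
    by rewrite /scale_at /rescale !scale_val !scalerA mulrC.
  - have -> : scale_at o l (permute s w) = permute s (scale_at (s o) l w).
      apply: funext => i; rewrite /scale_at /rescale /permute; congr (scale _ _).
      by rewrite !val_eqE (inj_eq perm_inj).
    rewrite piS; last by apply: gen_mem; right; exists s.
    exact: swap.
  - by rewrite /= IHg IHh.
  - by rewrite -[RHS](congr1 (fun x => \pi_multipole (scale_at o l x)) (hK w)) IHg.
rewrite -(swap o j) /act.
have /esym/orbit_spaceP[g Sgg <-] := reprK (\pi_multipole v).
exact: (inv g Sgg v).
Qed.

Lemma actK l : cancel (act l) (act (rstarV l)).
Proof.
move=> m; case: (posnP d) => [d0|d0].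
  have eqv (v w : power (punctured 3) d) : v = w.
    by apply: funext => i; have := ltn_ord i; rewrite [X in (_ < X)%N]d0.
  by rewrite -[RHS]reprK /act (eqv (scale_at _ _ _) (repr m)).
rewrite [act l m]/act (act_pi (Ordinal d0)) -[RHS]reprK; congr (\pi _).
apply: funext => i; apply: val_inj; rewrite /scale_at /rescale !scale_val scalerA.
by case: ifP => _; rewrite /= ?mulr1 ?scale1r // mulVf ?scale1r // (valP l).
Qed.

Lemma actVK l : cancel (act (rstarV l)) (act l).
Proof.
have eV : rstarV (rstarV l) = l by apply: val_inj; rewrite /= invrK.
by rewrite -[X in cancel _ (act X)]eV; exact: actK.
Qed.

(* M x_{R^*} R is the quotient of M x R by (m, t) ~ (l m, l^-1 t). *)
Definition twist (l : Rstar) (x : multipole * R) : multipole * R :=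
  (act l x.1, (val l)^-1 * x.2).

Lemma twist_bij : range twist `<=` bijections.
Proof.
move=> _ [l _ <-]; exists (twist (rstarV l)) => -[m t]; rewrite /twist /=.
  by rewrite actK invrK mulrA mulfV ?mul1r // (valP l).
by rewrite actVK invrK mulrA mulVf ?mul1r // (valP l).
Qed.

Definition line_bundle := orbit_space twist_bij.
HB.instance Definition _ := Quotient.on line_bundle.
HB.instance Definition _ := Topological.on line_bundle.

Definition zero_section : set line_bundle :=
  range (fun m : multipole => \pi_line_bundle (m, 0)).

Definition multipole_bar := collapse zero_section.
HB.instance Definition _ := Quotient.on multipole_bar.
HB.instance Definition _ := Topological.on multipole_bar.

(* Smooth structure of Sym^d(RP^2). The rows of an orthogonal matrix F are an
   orthonormal frame (a, b, u) of R^3. Through its unit representative in the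
   hemisphere x.u > 0, the line R v (with v.u != 0) is sent by stereographic
   projection from -u to the complex number
     (x.a + i x.b) / (1 + x.u),   x = sgn(v.u) v / |v|,
   which identifies {v.u != 0} in RP^2 with the open unit disc of the affine
   line C of CP^1. A finite set of lines avoids some plane u^perp, so every
   divisor lies in such a domain, and there its coordinates are those of
   Sym^d(C) = C^d: the coefficients of the monic polynomial with roots z_i.
   These charts of RP^2 must be conformal: changes of frame are then locally
   holomorphic or antiholomorphic, which makes the charts of Sym^d(RP^2)
   smoothly compatible, whereas a general diffeomorphism of C does not induce
   a smooth map of Sym^d(C) = C^d. *)
Definition frames : set 'M[R]_3 := [set F | F *m F^T = 1%:M].

Definition height (F : 'M[R]_3) (v : 'rV[R]_3) : R := (v *m F^T) 0 2.

Definition enorm (v : 'rV[R]_3) : R := Num.sqrt (\sum_i v 0 i ^+ 2).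

Definition stereo (F : 'M[R]_3) (v : 'rV[R]_3) : R[i] :=
  let y := v *m F^T in
  let r := Num.sg (height F v) / (enorm v + `|height F v|) in
  Complex (r * y 0 0) (r * y 0 1).

(* Real parts of the d lower coefficients, followed by their imaginary parts. *)
Definition sym_coord (z : 'I_d -> R[i]) : 'rV[R]_(2 * d) :=
  let p := \prod_i ('X - (z i)%:P) in
  \row_(k < 2 * d) if (k < d)%N then complex.Re p`_k else complex.Im p`_(k - d).

Definition SymRP := Sym (RP 2) d.
HB.instance Definition _ := Quotient.on SymRP.
HB.instance Definition _ := Topological.on SymRP.

Definition SymRP_chart (F : 'M[R]_3) : chart SymRP (2 * d) :=
  Chart [set D : SymRP | forall i, height F (val (repr (repr D i))) != 0]
        (fun D => sym_coord (fun i => stereo F (val (repr (repr D i))))).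

Definition SymRP_atlas : set (chart SymRP (2 * d)) :=
  [set SymRP_chart F | F in frames].

Definition multipole_proj (m : multipole) : SymRP :=
  \pi_SymRP (fun i => \pi_(RP 2) (repr m i)).

(* Fibre coordinate of the principal R^*-bundle multipole_proj in the local
   trivialisation given by the section that sends each line to its unit vector
   in the hemisphere of F. It is equivariant: act l multiplies it by l. *)
Definition multipole_fibre (F : 'M[R]_3) (m : multipole) : R :=
  \prod_i (Num.sg (height F (val (repr m i))) * enorm (val (repr m i))).

Definition multipole_chart (F : 'M[R]_3) : chart multipole (2 * d + 1) :=
  Chart (multipole_proj @^-1` dom (SymRP_chart F))
        (fun m => row_mx (coord (SymRP_chart F) (multipole_proj m))
                         (const_mx (multipole_fibre F m))).

Definition multipole_atlas : set (chart multipole (2 * d + 1)) :=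
  [set multipole_chart F | F in frames].

End Multipoles.
End Multipole_spaces.

(* Main.v *)
From HB Require Import structures.
Require Import Defs.
From mathcomp Require Import all_boot all_order perm all_algebra.
From mathcomp Require Import all_classical all_reals all_analysis.
From mathcomp Require Import complex zify ring lra.

Set Implicit Arguments.
Unset Strict Implicit.
Unset Printing Implicit Defensive.

Import Order.TTheory GRing.Theory Num.Theory.
Import numFieldNormedType.Exports.
Import Defs.

Local Open Scope classical_set_scope.
Local Open Scope ring_scope.
Local Open Scope quotient_scope.
(** A vector y = (u, v, c) of R^3 is encoded by the quadratic conj(zeta) X^2 + 2 c X - zeta,
    where zeta = u + i v ([quad]). Its roots on the Riemann sphere are the antipodal points in
    which the line R y meets the sphere. The product of the quadratics of d vectors is a
    polynomial of degree at most 2d that is real for the antipodal conjugation ([selfdual]);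
    such polynomials make a real vector space of dimension 2d+1. By Sylvester's theorem,
    every nonzero one is a product of quadratics of vectors ([sylvester]), and the factors are
    unique up to their order and to scalars of product 1 ([quad_prod_lines]). Hence the product
    is a bijection from the multipole space onto the nonzero vectors of R^(2d+1). It commutes
    with the multiplication by scalars, so it extends to the line bundle with collapsed zero
    section, and it descends to a bijection from the symmetric power of the projective plane
    onto projective space. It remains to see that these bijections, with the product
    normalised as in [form], are homeomorphisms and, for the given atlases, diffeomorphisms.

    Continuity of the inverse. The forms near a given one are products of vectors taken from
    one compact set ([form_lift], [unit_surj]), and this is enough to make the inverse
    continuous on the quotient ([continuous_of_compact_lifts]).

    Smoothness. In the chart of a frame F the lines are given by the monic polynomial A
    whose roots are their stereographic coordinates, points of the open unit disk, and the
    form is a real multiple of A A', where A' has the antipodal roots ([quad_stereo]). A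
    change of frame acts on forms by a linear substitution ([frame_subst_prod]). Hence the
    form is a smooth function of the coordinates ([smooth_chart_form]). Conversely, the
    increments of (A, s) |-> s A A' are linear in the increments of A and s, through a map that
    is injective on the diagonal because A and A' are coprime ([tangent_map_inj]). A continuous
    inverse of such a map is smooth ([smooth_inverse]), so the coordinates are smooth functions
    of the form ([smooth_form_coord]). The transitions between the charts of two frames are
    compositions of these two maps, so the same two facts also show that the atlases are
    smooth. The symmetric power is handled by the section of multipoles whose fibre coordinate
    is 1, and the product of a sphere and a line by polar coordinates, in which the radius r is
    replaced by r - 1/r. *)


(** * Smooth functions of several variables *)

Section Smoothness.
Variable R : realType.

(** Scalar-valued analogue of [Ck_on] with differentiability in place of partial
    derivatives: the chain rule then gives stability by composition at each
    order. *)
Fixpoint diff_upto (k n : nat) (U : set 'rV[R]_n) (f : 'rV[R]_n -> R) : Prop :=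
  (forall x, U x -> differentiable f x) /\
  (if k is k'.+1 then
     forall i : 'I_n, diff_upto k' U (fun x => 'D_(delta_mx 0 i) f x)
   else True).

Definition smooth n (U : set 'rV[R]_n) (f : 'rV[R]_n -> R) : Prop :=
  forall k, diff_upto k U f.

Lemma differentiable_littleo (V W : normedModType R) (f : V -> W) (x : V)
    (D : {linear V -> W}) :
  continuous D ->
  (forall e : R, 0 < e ->
     \forall h \near 0, `|f (h + x) - f x - D h| <= e * `|h|) ->
  differentiable f x /\ 'd f x = D :> (V -> W).
Proof.
move=> cD fD.
have fE : f \o shift x = cst (f x) + D +o_ 0 id.
  apply/eqaddoP => e e0; apply: filterS (fD e e0) => h.
  by rewrite !fctE /= opprD addrA.
have dE := diff_unique cD fE.
by split=> //; apply/diff_locallyP; rewrite dE.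
Qed.

Lemma near_eq_differentiable (V W : normedModType R) (f g : V -> W) x :
  {near x, f =1 g} -> differentiable f x -> differentiable g x.
Proof.
move=> fg df; apply/diff_locallyP.
have gE : g \o shift x = cst (g x) + 'd f x +o_ 0 id.
  apply/eqaddoP => e e0.
  have /diff_locally/eqaddoP/(_ _ e0) := df.
  move=> H; near=> h.
  have -> : (g \o shift x - (cst (g x) + 'd f x)) h =
            (f \o shift x - (cst (f x) + 'd f x)) h.
    rewrite !fctE /= (nbhs_singleton fg); congr (_ - _).
    apply/esym; near: h.
    have : \forall y \near x, f y = g y by [].
    by rewrite (near_shift 0) /=; apply: filterS => y /=; rewrite subr0.
  by near: h.
have cf := diff_continuous df.
by rewrite (diff_unique cf gE).
Unshelve. all: by end_near. Qed.

Section Closure.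
Variables (n : nat) (U : set 'rV[R]_n).
Hypothesis openU : open U.
Implicit Types f g : 'rV[R]_n -> R.

Lemma diff_uptoD k f x : diff_upto k U f -> U x -> differentiable f x.
Proof. by case: k => [|k] [] /(_ x). Qed.

Lemma diff_uptoW k f : diff_upto k.+1 U f -> diff_upto k U f.
Proof. by elim: k f => [|k IH] f [df dDf]; split=> // i; exact: IH. Qed.

Lemma continuous_sum (T : topologicalType) (I : Type) (r : seq I) (P : pred I)
    (F : I -> T -> R) (x : T) :
  (forall i, P i -> {for x, continuous (F i)}) ->
  {for x, continuous (fun t => \sum_(i <- r | P i) F i t)}.
Proof. by move=> cF; apply: cvg_big cF; exact: add_continuous. Qed.

Lemma continuous_prod (T : topologicalType) (I : Type) (r : seq I) (P : pred I)
    (F : I -> T -> R) (x : T) :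
  (forall i, P i -> {for x, continuous (F i)}) ->
  {for x, continuous (fun t => \prod_(i <- r | P i) F i t)}.
Proof. by move=> cF; apply: cvg_big cF; exact: mul_continuous. Qed.

Lemma normr_coord (h : 'rV[R]_n) i : `|h 0 i| <= `|h|.
Proof.
rewrite [leRHS]/Num.Def.normr/= mx_normrE.
exact: (le_bigmax _ (fun i => `|h i.1 i.2|) (0, i)).
Qed.

(** Caratheodory's criterion: an increment that is linear in y - x with
    coefficients continuous at x already exhibits the differential. It turns
    algebraic factorisations of increments into derivatives without any
    estimate. *)
Lemma caratheodory f x (phi : 'I_n -> 'rV[R]_n -> R) :
  (\forall y \near x, f y - f x = \sum_i (y - x) 0 i * phi i y) ->
  (forall i, {for x, continuous (phi i)}) ->
  differentiable f x /\ forall i, 'D_(delta_mx 0 i) f x = phi i x.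
Proof.
move=> fE cphi.
pose d (h : 'rV[R]_n) : R := \sum_i h 0 i * phi i x.
have dlin : linear (d : _ -> R).
  move=> a u v; rewrite /d scaler_sumr -big_split /=; apply: eq_bigr => i _.
  by rewrite !mxE mulrDl -mulrA.
pose dlM := GRing.isLinear.Build _ _ _ _ _ dlin.
pose D : {linear 'rV[R]_n -> R} := HB.pack d dlM.
have cD : continuous D.
  move=> h; have : {for h, continuous d}.
    apply: continuous_sum => i _; apply: continuousM; last exact: cst_continuous.
    exact: coord_continuous.
  exact.
have [|df dE] := @differentiable_littleo _ _ f x D cD.
  (* n + 1 instead of n, which may be 0 *)
  move=> e e0; pose e' := e / n.+1%:R.
  have e'0 : 0 < e' by rewrite divr_gt0.
  near=> h.
  have -> : f (h + x) - f x = \sum_i h 0 i * phi i (h + x).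
    have -> : f (h + x) - f x = \sum_i (h + x - x) 0 i * phi i (h + x).
      near: h; have := fE.
      by rewrite (near_shift 0) /=; apply: filterS => y /=; rewrite subr0.
    by rewrite addrK.
  rewrite /= /d -sumrB (le_trans (ler_norm_sum _ _ _)) //.
  have le_i i : `|h 0 i * phi i (h + x) - h 0 i * phi i x| <= e' * `|h|.
    rewrite -mulrBr normrM mulrC ler_pM ?normr_coord // distrC.
    move: i; near: h; apply: filter_forall => i.
    have : \forall y \near x, `|phi i x - phi i y| <= e'.
      by have /cvgrPdist_le/(_ _ e'0) := cphi i.
    by rewrite (near_shift 0) /=; apply: filterS => y /=; rewrite subr0.
  rewrite (le_trans (ler_sum _ (fun i _ => le_i i))) //.
  rewrite sumr_const card_ord -[_ *+ _]mulr_natl mulrA ler_wpM2r //.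
  by rewrite /e' mulrCA ler_piMr ?(ltW e0) // ler_pdivrMr // mul1r ler_nat.
split=> // i; rewrite deriveE // dE /= /d (bigD1 i) //= big1 => [|j ji].
  by rewrite mxE !eqxx mul1r addr0.
by rewrite mxE (negPf ji) andbF mul0r.
Unshelve. all: by end_near. Qed.

Lemma eq_diff_upto k f g :
  {in U, f =1 g} -> diff_upto k U f -> diff_upto k U g.
Proof.
have near_eq (f1 g1 : 'rV[R]_n -> R) x : {in U, f1 =1 g1} -> U x -> {near x, f1 =1 g1}.
  move=> e Ux; have : nbhs x U by exact: open_nbhs_nbhs.
  by apply: filterS => y Uy; apply: e; rewrite inE.
elim: k f g => [|k IH] f g fg [df Df]; (split; [move=> x Ux|]) => //.
- exact: near_eq_differentiable (near_eq _ _ _ fg Ux) (df x Ux).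
- exact: near_eq_differentiable (near_eq _ _ _ fg Ux) (df x Ux).
- move=> i; apply: IH (Df i) => x; rewrite inE => Ux.
  exact: near_eq_derive (near_eq _ _ _ fg Ux).
Qed.

Lemma eq_smooth f g : {in U, f =1 g} -> smooth U f -> smooth U g.
Proof. by move=> fg sf k; exact: eq_diff_upto (sf k). Qed.

Lemma diff_upto_cst k (c : R) : diff_upto k U (fun=> c).
Proof.
elim: k c => [|k IH] c; split=> //= i.
have -> : (fun x : 'rV[R]_n => 'D_(delta_mx 0 i) (fun=> c) x) = (fun=> 0).
  by apply: funext => x; exact: derive_cst.
exact: IH.
Qed.

Lemma smooth_cst (c : R) : smooth U (fun=> c).
Proof. by move=> k; exact: diff_upto_cst. Qed.

Lemma smooth_coord (j : 'I_n) : smooth U (fun x => x 0 j).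
Proof.
case=> [|k]; (split; [by move=> x _; exact: differentiable_coord|]) => // i.
apply: (@eq_diff_upto _ (fun=> (delta_mx 0 i : 'rV[R]_n) 0 j)); last exact: smooth_cst.
move=> x _; rewrite deriveE; last exact: differentiable_coord.
have @l : {linear 'rV[R]_n -> R}.
  by exists (fun N : 'rV[R]_n => N 0 j); do 2![eexists]; do ?[constructor];
     rewrite ?mxE// => ? *; rewrite ?mxE//; move=> ?; rewrite !mxE.
have -> : (fun x : 'rV[R]_n => x 0 j) = l by [].
by rewrite diff_lin // => y; exact: coord_continuous.
Qed.

Lemma diff_uptoDD k f g :
  diff_upto k U f -> diff_upto k U g -> diff_upto k U (fun x => f x + g x).
Proof.
elim: k f g => [|k IH] f g [df Df] [dg Dg]; (split; [by move=> x Ux; exact: differentiableD (df x Ux) (dg x Ux)|]) => // i.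
apply: eq_diff_upto (IH _ _ (Df i) (Dg i)) => x; rewrite inE => Ux.
by rewrite [RHS]deriveD //; apply: diff_derivable; [exact: df|exact: dg].
Qed.

Lemma diff_uptoM k f g :
  diff_upto k U f -> diff_upto k U g -> diff_upto k U (fun x => f x * g x).
Proof.
elim: k f g => [|k IH] f g sf sg; have [df Df] := sf; have [dg Dg] := sg;
  (split; [by move=> x Ux; exact: differentiableM (df x Ux) (dg x Ux)|]) => // i.
have := diff_uptoDD (IH _ _ (diff_uptoW sf) (Dg i)) (IH _ _ (diff_uptoW sg) (Df i)).
apply: eq_diff_upto => x; rewrite inE => Ux.
by rewrite [RHS]deriveM //; apply: diff_derivable; [exact: df|exact: dg].
Qed.

Lemma diff_uptoV k f : (forall x, U x -> f x != 0) ->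
  diff_upto k U f -> diff_upto k U (fun x => (f x)^-1).
Proof.
move=> f0; elim: k => [|k IH] sf; have [df Df] := sf;
  (split; [by move=> x Ux; exact: differentiableV (df x Ux) (f0 x Ux)|]) => // i.
have sV := IH (diff_uptoW sf).
have := diff_uptoM (diff_uptoM (diff_upto_cst k (-1)) (diff_uptoM sV sV)) (Df i).
apply: eq_diff_upto => x; rewrite inE => Ux.
rewrite [RHS]deriveV ?f0 //; last exact: diff_derivable (df x Ux).
by rewrite mulN1r -invfM -expr2.
Qed.

Lemma smoothD f g : smooth U f -> smooth U g -> smooth U (fun x => f x + g x).
Proof. by move=> sf sg k; exact: diff_uptoDD. Qed.

Lemma smoothM f g : smooth U f -> smooth U g -> smooth U (fun x => f x * g x).
Proof. by move=> sf sg k; exact: diff_uptoM. Qed.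

Lemma smoothV f : (forall x, U x -> f x != 0) ->
  smooth U f -> smooth U (fun x => (f x)^-1).
Proof. by move=> f0 sf k; exact: diff_uptoV. Qed.

Lemma smoothN f : smooth U f -> smooth U (fun x => - f x).
Proof.
move=> sf; apply: eq_smooth (smoothM (smooth_cst (-1)) sf) => x _.
by rewrite mulN1r.
Qed.

Lemma smoothB f g : smooth U f -> smooth U g -> smooth U (fun x => f x - g x).
Proof. by move=> sf sg; apply: smoothD => //; exact: smoothN. Qed.

Lemma smooth_sum (I : Type) (r : seq I) (P : pred I) (F : I -> 'rV[R]_n -> R) :
  (forall i, P i -> smooth U (F i)) -> smooth U (fun x => \sum_(i <- r | P i) F i x).
Proof.
move=> sF; elim: r => [|i r IH].
  by apply: eq_smooth (smooth_cst 0) => x _; rewrite big_nil.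
case Pi: (P i).
  by apply: eq_smooth (smoothD (sF i Pi) IH) => x _; rewrite big_cons Pi.
by apply: eq_smooth IH => x _; rewrite big_cons Pi.
Qed.

Lemma smooth_prod (I : Type) (r : seq I) (P : pred I) (F : I -> 'rV[R]_n -> R) :
  (forall i, P i -> smooth U (F i)) -> smooth U (fun x => \prod_(i <- r | P i) F i x).
Proof.
move=> sF; elim: r => [|i r IH].
  by apply: eq_smooth (smooth_cst 1) => x _; rewrite big_nil.
case Pi: (P i).
  by apply: eq_smooth (smoothM (sF i Pi) IH) => x _; rewrite big_cons Pi.
by apply: eq_smooth IH => x _; rewrite big_cons Pi.
Qed.

Lemma smooth_sqrt f : (forall x, U x -> 0 < f x) ->
  smooth U f -> smooth U (fun x => Num.sqrt (f x)).
Proof.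
move=> f0 sf.
have dsqrt x : U x -> differentiable (@Num.sqrt R) (f x).
  by move=> Ux; apply/derivable1_diffP; case: (is_derive1_sqrt (f0 x Ux)).
have df x : U x -> differentiable f x by exact: diff_uptoD (sf 0%N).
elim=> [|k IH]; (split; [by move=> x Ux; exact: (@differentiable_comp R _ _ _ f _ x (df x Ux) (dsqrt x Ux))|]) => // i.
have n0 x : U x -> 2 * Num.sqrt (f x) != 0.
  by move=> Ux; rewrite mulf_neq0 ?pnatr_eq0 // gt_eqF // sqrtr_gt0 f0.
have [_ /(_ i) Dif] := sf k.+1.
have := diff_uptoM (diff_uptoV n0 (diff_uptoM (diff_upto_cst k 2) IH)) Dif.
apply: eq_diff_upto => x; rewrite inE => Ux.
have dfx := df x Ux; have dsx := dsqrt x Ux.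
have dc : differentiable (Num.sqrt \o f) x.
  exact: (@differentiable_comp R _ _ _ f _ x dfx dsx).
have dcE := @diff_comp R _ _ _ f (@Num.sqrt R) x dfx dsx.
rewrite -[fun y => Num.sqrt (f y)]/(Num.sqrt \o f) (deriveE _ dc).
have -> := congr1 (fun h : 'rV[R]_n -> R => h (delta_mx 0 i)) dcE.
rewrite /=.
rewrite (deriveE _ dfx) (diff1E dsx) derive1E.
have [_ ->] := is_derive1_sqrt (f0 x Ux).
by rewrite mulrC.
Qed.

Lemma smooth_det m (A : 'rV[R]_n -> 'M[R]_m) :
  (forall i j, smooth U (fun x => A x i j)) -> smooth U (fun x => \det (A x)).
Proof.
move=> sA; apply: smooth_sum => s _; apply: smoothM; first exact: smooth_cst.
by apply: smooth_prod => i _; exact: sA.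
Qed.

Lemma smooth_adj m (A : 'rV[R]_n -> 'M[R]_m) i j :
  (forall i j, smooth U (fun x => A x i j)) -> smooth U (fun x => \adj (A x) i j).
Proof.
move=> sA; have sC : smooth U (fun x => cofactor (A x) j i).
  apply: smoothM; first exact: smooth_cst.
  apply: smooth_det => k l; apply: eq_smooth (sA (lift j k) (lift i l)) => x _.
  by rewrite !mxE.
by apply: eq_smooth sC => x _; rewrite mxE.
Qed.

End Closure.

Lemma continuous_det (T : topologicalType) m (A : T -> 'M[R]_m) (x : T) :
  (forall i j, {for x, continuous (fun t => A t i j)}) ->
  {for x, continuous (fun t => \det (A t))}.
Proof.
move=> cA; apply: continuous_sum => s _; apply: continuousM.
  exact: cst_continuous.
by apply: continuous_prod => i _; exact: cA.
Qed.

Lemma continuous_adj (T : topologicalType) m (A : T -> 'M[R]_m) (x : T) i j :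
  (forall i j, {for x, continuous (fun t => A t i j)}) ->
  {for x, continuous (fun t => \adj (A t) i j)}.
Proof.
move=> cA.
have -> : (fun t => \adj (A t) i j) = (fun t => cofactor (A t) j i).
  by apply: funext => t; rewrite mxE.
apply: continuousM; first exact: cst_continuous.
apply: continuous_det => k l.
have -> : (fun t => row' j (col' i (A t)) k l) = (fun t => A t (lift j k) (lift i l)).
  by apply: funext => t; rewrite !mxE.
exact: cA.
Qed.

Lemma continuous_mx (T : topologicalType) m n (A : T -> 'M[R]_(m, n)) (x : T) :
  (forall i j, {for x, continuous (fun t => A t i j)}) -> {for x, continuous A}.
Proof.
move=> cA; apply/cvgrPdist_le => e e0; near=> t.
rewrite [leLHS]/Num.Def.normr/= mx_normrE (bigmax_le _ (ltW e0)) //= => i _.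
rewrite !mxE; move: i; near: t; apply: filter_forall => /= i.
by have /cvgrPdist_le/(_ _ e0) := cA i.1 i.2.
Unshelve. all: by end_near. Qed.

Lemma smooth_continuous n (U : set 'rV[R]_n) f x :
  smooth U f -> U x -> {for x, continuous f}.
Proof.
by move=> /(_ 0%N)[df _] Ux; exact: differentiable_continuous (df x Ux).
Qed.

Lemma smooth_row_continuous n m (U : set 'rV[R]_n) (f : 'rV[R]_n -> 'rV[R]_m) x :
  (forall j, smooth U (fun x => f x 0 j)) -> U x -> {for x, continuous f}.
Proof.
by move=> sf Ux; apply: continuous_mx => i j; rewrite ord1; exact: smooth_continuous (sf j) Ux.
Qed.

Lemma smoothS n (U V : set 'rV[R]_n) f : U `<=` V -> smooth V f -> smooth U f.
Proof.
move=> UV sf k; elim: k f {sf}(sf k) => [|k IH] f [df Df];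
  (split; [by move=> x /UV /df|]) => // i; exact: IH (Df i).
Qed.

Section Composition.
Variables (n m : nat) (U : set 'rV[R]_n) (V : set 'rV[R]_m).
Variables (F : 'rV[R]_n -> 'rV[R]_m).
Hypotheses (openU : open U) (FUV : forall x, U x -> V (F x)).

Lemma differentiable_row x :
  (forall j, differentiable (fun x => F x 0 j) x) -> differentiable F x.
Proof.
move=> dF; have -> : F = \sum_j (fun x => F x 0 j *: delta_mx 0 j).
  by apply: funext => y; rewrite [LHS]row_sum_delta fct_sumE.
by apply: differentiable_sum => j; apply: differentiableZl; exact: dF.
Qed.

Lemma derive_row x v j : differentiable F x ->
  ('d F x v) 0 j = 'D_v (fun x => F x 0 j) x.
Proof.
move=> dF; rewrite -deriveE // derive_mx ?mxE //.
exact: diff_derivable.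
Qed.

Lemma chain_rule (g : 'rV[R]_m -> R) x v :
  differentiable F x -> differentiable g (F x) ->
  'D_v (g \o F) x =
    \sum_j 'D_(delta_mx 0 j) g (F x) * 'D_v (fun x => F x 0 j) x.
Proof.
move=> dF dg; rewrite deriveE; last exact: differentiable_comp.
have -> := congr1 (fun h : 'rV[R]_n -> R => h v) (@diff_comp R _ _ _ F g x dF dg).
rewrite /= [X in 'd g _ X]row_sum_delta linear_sum; apply: eq_bigr => j _.
by rewrite linearZ derive_row // (deriveE _ dg) [RHS]mulrC.
Qed.

Lemma diff_upto_comp k (g : 'rV[R]_m -> R) :
  (forall j, diff_upto k U (fun x => F x 0 j)) -> diff_upto k V g ->
  diff_upto k U (g \o F).
Proof.
elim: k g => [|k IH] g sF sg;
  have dF x : U x -> differentiable F x by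
    move=> Ux; apply: differentiable_row => j; exact: diff_uptoD (sF j) Ux.
  split=> // x Ux; apply: differentiable_comp; first exact: dF.
  exact: diff_uptoD sg (FUV Ux).
split=> [x Ux|i].
  by apply: differentiable_comp; [exact: dF|exact: diff_uptoD sg (FUV Ux)].
apply: (@eq_diff_upto _ _ _ _ (fun x => \sum_j 'D_(delta_mx 0 j) g (F x) *
    'D_(delta_mx 0 i) (fun x => F x 0 j) x)) => //.
  move=> x; rewrite inE => Ux; rewrite -chain_rule //; first exact: dF.
  exact: diff_uptoD sg (FUV Ux).
have sF' j : diff_upto k U (fun x => F x 0 j) by exact: diff_uptoW.
have sumS (I : Type) (r : seq I) (G : I -> 'rV[R]_n -> R) :
    (forall j, diff_upto k U (G j)) -> diff_upto k U (fun x => \sum_(j <- r) G j x).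
  move=> sG; elim: r => [|j r IHr].
    by apply: eq_diff_upto (diff_upto_cst _ _ _) => // x _; rewrite big_nil.
  by apply: eq_diff_upto (diff_uptoDD _ (sG j) IHr) => // x _; rewrite big_cons.
apply: sumS => j; apply: diff_uptoM => //; last by have [_ H] := sF j; exact: H.
by apply: (IH (fun y => 'D_(delta_mx 0 j) g y)) => //; have [_ H] := sg; exact: H.
Qed.

Lemma smooth_comp (g : 'rV[R]_m -> R) :
  (forall j, smooth U (fun x => F x 0 j)) -> smooth V g -> smooth U (g \o F).
Proof. by move=> sF sg k; apply: diff_upto_comp => // j; exact: sF. Qed.

End Composition.

(** A substitute for the inverse function theorem. When the increments of the
    map to invert are given by matrices M u v with M u u invertible, the
    relation h x - h y = (x - y) M(h x, h y)^-1 and the continuity of h make h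
    differentiable, by [caratheodory], with a derivative that is a smooth
    function of h; smoothness then follows by induction on the order. *)
Lemma smooth_inverse n (W : set 'rV[R]_n) (h : 'rV[R]_n -> 'rV[R]_n)
    (M : 'rV[R]_n -> 'rV[R]_n -> 'M[R]_n) :
  open W -> (forall x, W x -> {for x, continuous h}) ->
  (forall x y, W x -> W y -> x - y = (h x - h y) *m M (h x) (h y)) ->
  (forall i j v, continuous (fun u => M u v i j)) ->
  (forall i j, smooth setT (fun u => M u u i j)) ->
  (forall x, W x -> \det (M (h x) (h x)) != 0) ->
  forall j, smooth W (fun x => h x 0 j).
Proof.
move=> oW ch hM cM sM dM.
pose V := [set u : 'rV[R]_n | \det (M u u) != 0].
pose phi i j (y x : 'rV[R]_n) : R :=
  (\det (M (h x) (h y)))^-1 * \adj (M (h x) (h y)) i j.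
have cMh y i j : W y -> {for y, continuous (fun x => M (h x) (h y) i j)}.
  move=> Wy; apply: (@continuous_comp _ _ _ h (fun u => M u (h y) i j)).
    exact: ch.
  exact: cM.
have cdet y : W y -> {for y, continuous (fun x => \det (M (h x) (h y)))}.
  by move=> Wy; apply: continuous_det => i j; exact: cMh.
have hE y : W y ->
    \forall x \near y, h x - h y = (x - y) *m \matrix_(i, j) phi i j y x.
  move=> Wy; near=> x.
  have Wx : W x by near: x; exact: open_nbhs_nbhs (conj oW Wy).
  have d0 : \det (M (h x) (h y)) != 0.
    by near: x; apply: (cvgr_neq0 _ (cdet y Wy)); exact: dM.
  have -> : \matrix_(i, j) phi i j y x =
            (\det (M (h x) (h y)))^-1 *: \adj (M (h x) (h y)).
    by apply/matrixP => i j; rewrite [LHS]mxE [RHS]mxE.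
  rewrite (hM x y) // -mulmxA -scalemxAr mul_mx_adj scale_scalar_mx mulVf //.
  by rewrite mulmx1.
have dh j y : W y -> differentiable (fun x => h x 0 j) y /\
    forall i, 'D_(delta_mx 0 i) (fun x => h x 0 j) y = phi i j y y.
  move=> Wy; apply: (@caratheodory _ _ y (fun i x => phi i j y x)).
    apply: filterS (hE y Wy) => x hxy.
    have := congr1 (fun A : 'rV[R]_n => A 0 j) hxy; rewrite !mxE => ->.
    by apply: eq_bigr => i _; rewrite !mxE.
  move=> i; apply: continuousM; last by apply: continuous_adj => *; exact: cMh.
  by apply: continuousV; [exact: dM|exact: cdet].
have cMM i j : continuous (fun u => M u u i j).
  by move=> u; exact: smooth_continuous (sM i j) _.
have oV : open V.
  rewrite (_ : V = (fun u => \det (M u u)) @^-1` [set x | x != 0]) //.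
  apply: open_comp; last exact: open_neq.
  by move=> u _; apply: continuous_det => i j; exact: cMM.
have sphi i j : smooth V (fun u => (\det (M u u))^-1 * \adj (M u u) i j).
  have sMV k l : smooth V (fun u => M u u k l) by exact: smoothS (sM k l).
  apply: smoothM => //; first by apply: smoothV => //; exact: smooth_det.
  exact: smooth_adj.
move=> j k; elim: k j => [|k IH] j; (split; [by move=> x /(dh j)[]|]) => // i.
apply: (@eq_diff_upto _ _ oW _
  ((fun u => (\det (M u u))^-1 * \adj (M u u) i j) \o h)).
  by move=> x; rewrite inE => Wx; have [_ ->] := dh j x Wx.
by apply: (@diff_upto_comp _ _ _ V) => //; exact: sphi.
Unshelve. all: by end_near. Qed.

(** From coordinatewise smoothness to [smooth_on]. U is meant to be the image of
    a chart domain, and U' an open set around it that is easier to describe. *)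
Lemma smooth_onP n m (U U' : set 'rV[R]_n) (f : 'rV[R]_n -> 'rV[R]_m) :
  open U' -> U `<=` U' -> (forall j, smooth U' (fun x => f x 0 j)) -> smooth_on U f.
Proof.
move=> oU UU' sf.
pose row (F : 'I_m -> 'rV[R]_n -> R) x := \row_j F j x.
suff main k : forall (F : 'I_m -> 'rV[R]_n -> R) (G : 'rV[R]_n -> 'rV[R]_m),
    {in U', G =1 row F} -> (forall j, diff_upto k U' (F j)) -> Ck_on k U G.
  move=> k; apply: (main k (fun j x => f x 0 j)) => [x _|j]; last exact: sf.
  by apply/rowP => j; rewrite mxE.
have nGF (F : 'I_m -> 'rV[R]_n -> R) G x :
    {in U', G =1 row F} -> U' x -> {near x, row F =1 G}.
  move=> GF Ux; apply: filterS (open_nbhs_nbhs (conj oU Ux)) => y Uy.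
  by rewrite GF // inE.
have dG l (F : 'I_m -> 'rV[R]_n -> R) G x :
    {in U', G =1 row F} -> (forall j, diff_upto l U' (F j)) -> U' x ->
    differentiable G x.
  move=> GF sF Ux; apply: near_eq_differentiable (nGF _ _ _ GF Ux) _.
  apply: differentiable_row => j.
  rewrite (_ : (fun y => row F y 0 j) = F j); first exact: diff_uptoD (sF j) Ux.
  by apply: funext => y; rewrite mxE.
elim: k => [|k IH] F G GF sF; (split; [move=> x /UU' Ux|]) => //.
- exact: differentiable_continuous (dG _ _ _ _ GF sF Ux).
- exact: differentiable_continuous (dG _ _ _ _ GF sF Ux).
- move=> i; split=> [x /UU' Ux|].
    exact: diff_derivable (dG _ _ _ _ GF sF Ux).
  apply: (IH (fun j x => 'D_(delta_mx 0 i) (F j) x)) => [x|j]; last first.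
    by have [_ H] := sF j; exact: H.
  rewrite inE => Ux; apply/rowP => j; have dGx := dG _ _ _ _ GF sF Ux.
  rewrite derive_mx; last exact: diff_derivable.
  rewrite !mxE; apply: near_eq_derive.
  by apply: filterS (nGF _ _ _ GF Ux) => y <-; rewrite mxE.
Qed.

End Smoothness.

(** * Quotients, powers and charts *)

(** When points near y are images under f of points of one compact set K, the
    map f behaves near y as a proper map, and g, which becomes continuous when
    composed with f, is itself continuous: each point of K has a neighbourhood
    whose image avoids y or is sent by q into a given neighbourhood of g y, and
    finitely many of them cover K. *)
Lemma continuous_of_compact_lifts (X Y M : topologicalType)
    (f : X -> Y) (q : X -> M) (g : Y -> M) :
  hausdorff_space Y -> continuous f -> continuous q -> (forall x, g (f x) = q x) ->
  (forall y : Y, exists2 K : set X, compact K &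
     \forall y' \near y, exists2 x, K x & f x = y') ->
  continuous g.
Proof.
move=> hY cf cq gf lift y U; rewrite nbhsE; case=> O [oO Ogy] OU.
have [K cK Klift] := lift y.
have cover (x : X) : K x ->
    \forall x' \near x & y' \near y, f x' = y' -> O (g y').
  move=> _; have [fxy|/eqP nfxy] := pselect (f x = y).
    have Oq : \forall x' \near x, O (q x').
      apply: (cq x); apply: open_nbhs_nbhs; split=> //.
      by rewrite -gf fxy.
    near=> x' y' => /= <-; rewrite gf; near: x'; exact: Oq.
  move: (hY); rewrite open_hausdorff => /(_ _ _ nfxy)[[A B] /= [Af By]].
  case=> oA oB /eqP AB0.
  have Ax : \forall x' \near x, A (f x').
    by apply: (cf x); apply: open_nbhs_nbhs; split=> //; rewrite inE in Af.
  have {}By : nbhs y B by apply: open_nbhs_nbhs; split=> //; rewrite inE in By.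
  near=> x' y' => /= fxy'; have : (A `&` B) y'; last by rewrite AB0.
  by split; [rewrite -fxy'; near: x'|near: y'].
have /compact_near_coveringP := cK.
move=> /(_ _ (nbhs y) (fun y' x' => f x' = y' -> O (g y')) _ cover) KO.
suff : \forall y' \near y, O (g y') by apply: filterS => y'; exact: OU.
near=> y'.
have [x Kx fx] : exists2 x, K x & f x = y' by near: y'.
by apply: (near KO y' _ x Kx fx).
Unshelve. all: by end_near. Qed.

Section Orbits.
Context {T : topologicalType} {S : set (T -> T)} (bijS : S `<=` bijections).

Lemma generated_invariant (Z : Type) (f : T -> Z) :
  (forall g, S g -> forall x, f (g x) = f x) ->
  forall g, generated S g -> forall x, f (g x) = f x.
Proof.
move=> fS g; elim=> {g} [|g Sg|g h _ IHg _ IHh|g h _ IHg gK hK] x //.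
- exact: fS.
- by rewrite /= IHg IHh.
- by rewrite -IHg hK.
Qed.

Lemma orbit_pi_continuous : continuous (\pi_(orbit_space bijS) : T -> orbit_space bijS).
Proof. exact: pi_continuous. Qed.

Lemma orbit_pi_gen g (x : T) : S g -> \pi_(orbit_space bijS) (g x) = \pi_(orbit_space bijS) x.
Proof.
move=> Sg; apply/esym/orbit_spaceP; exists g => //; exact: gen_mem.
Qed.

Lemma orbit_continuous (Z : topologicalType) (f : orbit_space bijS -> Z) :
  continuous (f \o \pi_(orbit_space bijS)) -> continuous f.
Proof. by move=> cf; apply/quotient_continuous. Qed.

(** Functions of a quotient defined through [repr] are computed on any
    representative as soon as they are invariant under the generators. *)
Lemma invariant_repr (Z : Type) (f : T -> Z) :
  (forall g, S g -> forall x, f (g x) = f x) ->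
  forall x, f (repr (\pi_(orbit_space bijS) x)) = f x.
Proof.
move=> fS x; have /esym/orbit_spaceP[g Sg <-] := reprK (\pi_(orbit_space bijS) x).
exact: (generated_invariant fS).
Qed.

Lemma orbit_open (A : set (orbit_space bijS)) :
  open (\pi_(orbit_space bijS) @^-1` A) -> open A.
Proof. by move=> oA; rewrite /open/= /quotient_open; exact: oA. Qed.
End Orbits.

Section Power.
Variables (X : topologicalType) (d : nat).

Lemma power_coord_continuous (i : 'I_d) : continuous (fun v : power X d => v i).
Proof. exact: (@proj_continuous _ (fun=> X) i). Qed.

Lemma continuous_power (Z : topologicalType) (f : Z -> power X d) z :
  (forall i, {for z, continuous (fun t => f t i)}) -> {for z, continuous f}.
Proof.
move=> cf; apply/cvg_sup => i U [_ /= [[W oW <-]] /= Wf] /filterS; apply.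
apply: (cf i).
exact: open_nbhs_nbhs.
Qed.

Lemma compact_power (A : set X) :
  compact A -> compact [set v : power X d | forall i, A (v i)].
Proof. by move=> cA; apply: (@tychonoff _ (fun=> X) (fun=> A)). Qed.
End Power.

Section SetType.
Variables (X : topologicalType) (A : set X).

Lemma set_val_continuous : continuous (fun x : set_type A => val x).
Proof. exact: initial_continuous. Qed.

Lemma continuous_set_type (Z : topologicalType) (f : Z -> set_type A) z :
  {for z, continuous (fun t => val (f t))} -> {for z, continuous f}.
Proof.
move=> cf U [_ /= [[W oW <-]] /= Wsfz /filterS]; apply; apply: cf.
exact: open_nbhs_nbhs.
Qed.

Lemma set_type_hausdorff : hausdorff_space X -> hausdorff_space (set_type A).
Proof.
move=> hX x y xy; apply/val_inj/hX => U V Ux Vy.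
have [z [Uz Vz]] := xy _ _ (set_val_continuous Ux) (set_val_continuous Vy).
by exists (val z).
Qed.
End SetType.

Section Charts.
Variables (R : realType).

(** A coordinate map is a chart once an inverse that is continuous on an open
    set of parameters is known; openness of images comes from that inverse. *)
Lemma chart_of_inverse (M : topologicalType) n (c : @chart R M n)
    (E : set 'rV[R]_n) (j : 'rV[R]_n -> M) :
  open (dom c) -> (forall x, dom c x -> {for x, continuous (coord c)}) ->
  open E -> (forall y, E y -> {for y, continuous j}) ->
  (forall y, E y -> dom c (j y) /\ coord c (j y) = y) ->
  (forall x, dom c x -> E (coord c x) /\ j (coord c x) = x) ->
  is_chart c.
Proof.
move=> oc cc oE cj jK Kj; split=> //.
  move=> x y; rewrite !inE => /Kj[_ {2}<-] /Kj[_ {2}<-] -> //.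
move=> V oV Vc.
have -> : coord c @` V = E `&` j @^-1` V.
  apply/seteqP; split=> [_ [x Vx <-]|y [Ey Vjy]].
    by have [Ex jx] := Kj _ (Vc _ Vx); split=> //=; rewrite jx.
  by exists (j y) => //; have [] := jK y Ey.
rewrite openE => y [Ey Vjy]; rewrite /interior; apply: filterI.
  exact: open_nbhs_nbhs.
by apply: (cj y Ey); exact: open_nbhs_nbhs.
Qed.

(** Local expressions only have to be described on some open set E that contains
    the coordinates of the points of interest. *)
Lemma smooth_in_chartsP (M N : Type) n m (c : @chart R M n) (e : @chart R N m)
    (f : M -> N) (E : set 'rV[R]_n) (g : 'rV[R]_n -> 'rV[R]_m) :
  open E ->
  (forall x, dom c x -> dom e (f x) -> E (coord c x) /\ g (coord c x) = coord e (f x)) ->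
  (forall j, smooth E (fun y => g y 0 j)) ->
  smooth_in_charts c e f.
Proof.
move=> oE Eg sg; exists g; last by move=> x [cx ex]; have [] := Eg x cx ex.
apply: smooth_onP oE _ sg => _ [x [cx ex] <-]; by have [] := Eg x cx ex.
Qed.
End Charts.

(** * Vectors as quadratics, and antipodal duality *)

(** Polynomial identities may be checked on nonzero values of the variable, as
    is needed for [star], whose values involve the inverse of the variable. *)
Lemma eq_poly_nonzero (K : numDomainType) (p q : {poly K}) :
  (forall z, z != 0 -> p.[z] = q.[z]) -> p = q.
Proof.
move=> pq; apply/eqP; rewrite -subr_eq0; apply/negPn/negP => r0.
pose s : seq K := [seq i.+1%:R | i <- iota 0 (size (p - q))].
have us : uniq s.
  by rewrite map_inj_uniq ?iota_uniq // => i j /eqP; rewrite eqr_nat => /eqP[].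
have rs : all (root (p - q)) s.
  apply/allP => _ /mapP[i _ ->].
  by rewrite rootE hornerD hornerN pq ?subrr // pnatr_eq0.
by have := max_poly_roots r0 rs us; rewrite size_map size_iota ltnn.
Qed.

Section Quadratics.
Variable R : realType.
Local Notation C := R[i].
Implicit Types (p q : {poly C}) (z : C) (y : 'rV[R]_3).

Lemma cReD (x z : C) : complex.Re (x + z) = complex.Re x + complex.Re z.
Proof. by case: x; case: z. Qed.
Lemma cImD (x z : C) : complex.Im (x + z) = complex.Im x + complex.Im z.
Proof. by case: x; case: z. Qed.
Lemma cReM (x z : C) : complex.Re (x * z) =
  complex.Re x * complex.Re z - complex.Im x * complex.Im z.
Proof. by case: x; case: z. Qed.
Lemma cImM (x z : C) : complex.Im (x * z) =
  complex.Re x * complex.Im z + complex.Im x * complex.Re z.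
Proof. by case: x => a b; case: z => c e. Qed.
Lemma complexP (x z : C) :
  complex.Re x = complex.Re z -> complex.Im x = complex.Im z -> x = z.
Proof. by case: x => a b; case: z => c e /= -> ->. Qed.

(** On forms of degree n, the conjugation that corresponds to the antipodal map
    z |-> -1/conj(z) of the Riemann sphere; see [horner_star]. *)
Definition star n p : {poly C} := \poly_(k < n.+1) ((-1) ^+ k * conjc p`_(n - k)).

Lemma coef_star n p k :
  (star n p)`_k = if (k <= n)%N then (-1) ^+ k * conjc p`_(n - k) else 0.
Proof. by rewrite coef_poly ltnS. Qed.

Lemma size_star n p : (size (star n p) <= n.+1)%N.
Proof. exact: size_poly. Qed.

Lemma horner_star n p z : (size p <= n.+1)%N -> z != 0 ->
  (star n p).[z] = (- z) ^+ n * conjc p.[- (conjc z)^-1].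
Proof.
move=> sp z0; rewrite horner_poly (reindex_inj rev_ord_inj) /=.
rewrite (horner_coef_wide _ sp) rmorph_sum mulr_sumr; apply: eq_bigr => k _.
have kn : (k <= n)%N by rewrite -ltnS.
rewrite subSS subKn // rmorphM rmorphXn rmorphN /= conjc_inv conjcK.
have e : (- z) ^+ n * (- z^-1) ^+ k = (-1) ^+ (n - k) * z ^+ (n - k).
  rewrite -{1}(subnK kn) exprD -mulrA -exprMn mulrNN divff // expr1n mulr1.
  by rewrite [LHS]exprNn.
by rewrite [RHS]mulrCA e [RHS]mulrCA mulrA.
Qed.

Lemma starM m n p q : (size p <= m.+1)%N -> (size q <= n.+1)%N ->
  star (m + n) (p * q) = star m p * star n q.
Proof.
move=> sp sq; apply: eq_poly_nonzero => z z0.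
have spq : (size (p * q)%R <= (m + n).+1)%N.
  by rewrite (leq_trans (size_polyMleq _ _)) // -subn1 leq_subLR add1n -addSn -addnS leq_add.
by rewrite hornerM !horner_star // hornerM rmorphM exprD; ring.
Qed.

Lemma starD n p q : star n (p + q) = star n p + star n q.
Proof.
apply/polyP => k; rewrite coefD !coef_star; case: ifP => _; last by rewrite addr0.
by rewrite coefD rmorphD mulrDr.
Qed.

Lemma starZ n c p : star n (c *: p) = conjc c *: star n p.
Proof.
apply/polyP => k; rewrite coefZ !coef_star; case: ifP => _; last by rewrite mulr0.
by rewrite coefZ rmorphM mulrCA.
Qed.

Lemma starK n p : (size p <= n.+1)%N -> star n (star n p) = (-1) ^+ n *: p.
Proof.
move=> sp; apply/polyP => k; rewrite coefZ !coef_star.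
case: leqP => kn; last by rewrite nth_default ?mulr0 // (leq_trans sp).
rewrite leq_subr subKn // rmorphM rmorphXn rmorphN1 /= conjcK mulrA -exprD.
by rewrite subnKC.
Qed.

(** The forms of degree 2n that are real for the antipodal conjugation. They
    make a real vector space of dimension 2n+1, the target of the product map.
    *)
Definition selfdual n p := (size p <= (2 * n).+1)%N /\ star (2 * n) p = (-1) ^+ n *: p.

Definition zeta y : C := Complex (y 0 0) (y 0 1).

(** The quadratic whose two roots on the Riemann sphere are the antipodal points
    where the line R y meets it. *)
Definition quad y : {poly C} :=
  conjc (zeta y) *: 'X^2 + (2 * y 0 2)%:C%C *: 'X - (zeta y)%:P.

Lemma coef_quad y k : (quad y)`_k =
  if k is 0 then - zeta y else if k is 1 then (2 * y 0 2)%:C%C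
  else if k is 2 then conjc (zeta y) else 0.
Proof.
rewrite coefB coefD !coefZ coefXn coefX coefC.
by case: k => [|[|[|k]]]; rewrite /= !(mulr0, mulr1, add0r, addr0, subr0, sub0r).
Qed.

Lemma size_quad y : (size (quad y) <= 3)%N.
Proof.
by apply/leq_sizeP => -[|[|[|j]]] // _; rewrite coef_quad.
Qed.

Lemma star_quad y : star 2 (quad y) = - quad y.
Proof.
apply/polyP => k; rewrite coefN coef_star !coef_quad.
case: k => [|[|[|k]]] //=; rewrite ?subnn ?subn0 ?subn1 /= ?oppr0 //.
all: by rewrite ?(expr0, expr1, sqrrN, expr1n) ?mul1r ?mulN1r; apply: complexP => /=; ring.
Qed.

Lemma quadZ a y : quad (a *: y) = a%:C%C *: quad y.
Proof.
apply/polyP => k; rewrite coefZ !coef_quad /zeta !mxE.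
by case: k => [|[|[|k]]] /=; rewrite ?mulr0 //; apply: complexP; rewrite /= ?mxE; ring.
Qed.

Lemma quad_eq0 y : (quad y == 0) = (y == 0).
Proof.
apply/eqP/eqP => [q0|->]; last first.
  by rewrite -(scale0r (0 : 'rV[R]_3)) quadZ scale0r.
have := congr1 (fun p : {poly C} => p`_0) q0; have := congr1 (fun p : {poly C} => p`_1) q0.
rewrite !coef_quad !coef0 /zeta => -[y2] /eqP; rewrite oppr_eq0 => /eqP[y0 y1].
apply/rowP => j; rewrite mxE; case: j => [[|[|[|j]]] lj] //.
- by rewrite -[RHS]y0; congr (y _ _); apply: val_inj.
- by rewrite -[RHS]y1; congr (y _ _); apply: val_inj.
- have -> : Ordinal lj = 2 by apply: val_inj.
  by apply/eqP; move/eqP: y2; rewrite mulf_eq0 pnatr_eq0.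
Qed.

Definition sqnorm z : R := complex.Re z ^+ 2 + complex.Im z ^+ 2.

(** Inverse stereographic projection, up to a positive factor. *)
Definition dir z : 'rV[R]_3 :=
  \row_(j < 3) [:: 2 * complex.Re z; 2 * complex.Im z; 1 - sqnorm z]`_j.

Lemma row3P (y w : 'rV[R]_3) :
  y 0 0 = w 0 0 -> y 0 1 = w 0 1 -> y 0 2 = w 0 2 -> y = w.
Proof.
move=> e0 e1 e2; apply/rowP => -[[|[|[|j]]] lj] //.
- by move: e0; congr (y _ _ = w _ _); apply: val_inj.
- by move: e1; congr (y _ _ = w _ _); apply: val_inj.
- by move: e2; congr (y _ _ = w _ _); apply: val_inj.
Qed.

Lemma quad_dir z :
  quad (dir z) = 2%:P * (('X - z%:P) * (1 + conjc z *: 'X)).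
Proof.
have -> : ('X - z%:P) * (1 + conjc z *: 'X) =
  conjc z *: 'X^2 + (1 - z * conjc z) *: 'X - z%:P.
  by rewrite -!mul_polyC rmorphB rmorph1 rmorphM; ring.
apply/polyP => k; rewrite mul_polyC coefZ coef_quad /zeta !mxE /=.
rewrite coefB coefD !coefZ coefXn coefX coefC.
case: k => [|[|[|k]]] /=; rewrite !(mulr0, mulr1, add0r, addr0, subr0, sub0r) //;
  case: z => a b; apply: complexP => //=; rewrite /sqnorm /=; ring.
Qed.

(** A root of the quadratic of y determines the line of y: this is the
    injectivity of the encoding of lines by quadratics, in an explicit form. *)
Lemma quad_root y z : root (quad y) z ->
  y = ((2 * (y 0 0 * complex.Re z + y 0 1 * complex.Im z)
        + y 0 2 * (1 - sqnorm z)) / (1 + sqnorm z) ^+ 2) *: dir z.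
Proof.
move=> /rootP.
rewrite !(hornerD, hornerN, hornerZ, hornerXn, hornerX, hornerC) /zeta => qz.
case: z qz => a b; set u := y 0 0; set v := y 0 1; set c := y 0 2 => qz.
have := congr1 (@complex.Re R) qz; have := congr1 (@complex.Im R) qz.
rewrite /sqnorm expr2 /= => E2 E1 {qz}.
have S0 : 1 + (a ^+ 2 + b ^+ 2) != 0 by rewrite gt_eqF // ltr_pwDl // addr_ge0 // sqr_ge0.
pose e1 := u * (a ^+ 2 - b ^+ 2) + 2 * v * a * b + 2 * c * a - u.
pose e2 := 2 * u * a * b - v * (a ^+ 2 - b ^+ 2) + 2 * c * b - v.
have {}E1 : e1 = 0 by rewrite -[RHS]E1 /e1; ring.
have {}E2 : e2 = 0 by rewrite -[RHS]E2 /e2; ring.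
(* With E = e1 + i e2 the value of the quadratic at z, the differences are, up to
   the denominator, the real and imaginary parts of z^2 conj(E) - E and the real
   part of 2 z conj(E). *)
have vanish x x' : (x * e1 + x' * e2) / (1 + (a ^+ 2 + b ^+ 2)) ^+ 2 = 0.
  by rewrite E1 E2 !mulr0 addr0 mul0r.
apply: row3P; rewrite !mxE /= -/u -/v -/c; apply/eqP; rewrite -subr_eq0; apply/eqP.
- by rewrite -[RHS](vanish (a ^+ 2 - b ^+ 2 - 1) (2 * a * b)) /e1 /e2; field.
- by rewrite -[RHS](vanish (2 * a * b) (b ^+ 2 - a ^+ 2 - 1)) /e1 /e2; field.
- by rewrite -[RHS](vanish (2 * a) (2 * b)) /sqnorm /e1 /e2 /=; field.
Qed.

End Quadratics.

(** * Sylvester's theorem on real forms *)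

Section Sylvester.
Variable R : realType.
Local Notation C := R[i].
Implicit Types (p q : {poly C}) (z : C) (y : 'rV[R]_3).

Lemma dir_neq0 z : dir z != 0.
Proof.
rewrite -quad_eq0 quad_dir !mulf_neq0 ?polyXsubC_eq0 ?polyC_eq0 ?pnatr_eq0 //.
apply/eqP => /(congr1 (fun p : {poly C} => p`_0)).
by rewrite coefD coefZ coefX coef1 mulr0 addr0 coef0 => /eqP; rewrite oner_eq0.
Qed.

Lemma conj_norm_neqN1 z : z * conjc z != -1.
Proof.
apply/eqP => e; have := oner_neq0 C; have := mulcJ_ge0 z.
by rewrite e lerNr oppr0 ler10.
Qed.

Lemma selfdual_div n p y : quad y != 0 -> (size p <= (2 * n).+1)%N ->
  selfdual n.+1 (p * quad y) -> selfdual n p.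
Proof.
move=> q0 sp [_ pq]; split=> //.
apply: (mulIf q0); apply: oppr_inj.
move: pq; rewrite mulnS [(2 + _)%N]addnC starM ?size_quad // star_quad mulrN => ->.
by rewrite exprS mulN1r scaleNr scalerAl.
Qed.

(** The roots of a self-dual polynomial are paired by the antipodal map, which
    has no fixed point on the sphere, so that a quadratic can be split off. A
    vanishing leading coefficient means a root at infinity, whose antipode is
    the root 0. *)
Lemma selfdual_root n p : selfdual n.+1 p -> p != 0 ->
  exists z p', [/\ p = p' * quad (dir z) & (size p' <= (2 * n).+1)%N].
Proof.
move=> [sp pd] p0.
have coef0E : conjc p`_(2 * n.+1) = (-1) ^+ n.+1 * p`_0.
  have := congr1 (fun q : {poly C} => q`_0) pd.
  by rewrite coef_star /= expr0 mul1r subn0 coefZ.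
have two0 : (2 : C) != 0 by rewrite pnatr_eq0.
have [top0|top_neq0] := eqVneq p`_(2 * n.+1) 0.
  have : root p 0.
    rewrite rootE horner_coef0; move/eqP: coef0E.
    by rewrite top0 conjc0 eq_sym mulf_eq0 signr_eq0.
  case/factor_theorem => q pE; exists 0, (2^-1 *: q).
  have sq : (size q <= (2 * n).+1)%N.
    have : (size p <= (2 * n).+2)%N.
      apply/leq_sizeP => j; rewrite leq_eqVlt => /predU1P[<-|jn].
        by rewrite -[RHS]top0 mulnS.
      by rewrite nth_default // (leq_trans sp) // mulnS.
    have q0 : q != 0 by apply: contraNneq p0 => q0; rewrite pE q0 mul0r.
    by rewrite pE size_Mmonic ?monicXsubC // size_XsubC addn2.
  split; last by rewrite (leq_trans (size_scale_leq _ _)).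
  rewrite quad_dir conjc0 scale0r addr0 mulr1 pE mulrCA mul_polyC scalerAl scalerA.
  by rewrite divff // scale1r.
have szp : size p != 1%N.
  apply: contraNneq top_neq0 => s1; rewrite nth_default // s1.
  by rewrite mulnS.
have /closed_rootP[z pz] := szp.
have z0 : z != 0.
  apply: contraNneq top_neq0 => z0; move: pz; rewrite z0 rootE horner_coef0.
  by move=> /eqP e; rewrite -(conjc_eq0) coef0E e mulr0.
have w_root : root p (- (conjc z)^-1).
  rewrite rootE -conjc_eq0.
  have := horner_star sp z0; rewrite pd hornerZ (rootP pz) mulr0 => /eqP.
  by rewrite eq_sym mulf_eq0 expf_eq0 oppr_eq0 (negPf z0) andbF.
have cz0 : conjc z != 0 by rewrite conjc_eq0.
have zw : z != - (conjc z)^-1.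
  apply: contraNneq (conj_norm_neqN1 z) => {1}->; rewrite mulNr mulVf //.
have : all (root p) [:: z; - (conjc z)^-1] by rewrite /= pz w_root.
move=> /(uniq_roots_prod_XsubC)[|q pE].
  by rewrite uniq_rootsE /= inE zw.
rewrite big_cons big_seq1 in pE.
exists z, ((2 * conjc z)^-1 *: q).
have q0 : q != 0 by apply: contraNneq p0 => q0; rewrite pE q0 mul0r.
split; last first.
  rewrite (leq_trans (size_scale_leq _ _)) //.
  move: sp; rewrite pE mulrA !size_mul ?mulf_neq0 ?polyXsubC_eq0 // !size_XsubC.
  by rewrite !addnS !addn0 /= mulnS.
rewrite quad_dir pE -scalerAl; apply: (@scalerI _ _ (2 * conjc z)).
  by rewrite mulf_neq0.
rewrite scalerA mulfV ?mulf_neq0 // scale1r -!mul_polyC !rmorphM.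
have -> : 1 + (conjc z)%:P * 'X = (conjc z)%:P * ('X - (- (conjc z)^-1)%:P) :> {poly C}.
  by rewrite mulrBr -rmorphM mulrN mulfV // rmorphN1 opprK addrC.
by rewrite /=; ring.
Qed.

(** Existence in Sylvester's theorem: by [selfdual_root], a self-dual polynomial
    is a real multiple of a product of quadratics of vectors. The factor at the
    end is real because a self-dual polynomial of degree 0 is real. *)
Lemma sylvester n p : selfdual n p -> p != 0 ->
  exists (s : R) (zs : seq C),
    [/\ s != 0, size zs = n & p = s%:C%C *: \prod_(z <- zs) quad (dir z)].
Proof.
elim: n p => [|n IH] p pd p0.
  case: pd; rewrite muln0 => sp pd.
  exists (complex.Re p`_0), [::]; rewrite big_nil.
  have pE : p = (p`_0)%:P by exact: size1_polyC.
  have c0 : p`_0 = (complex.Re p`_0)%:C%C.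
    have := congr1 (fun q : {poly C} => q`_0) pd.
    rewrite coef_star /= expr0 mul1r subn0 scale1r.
    case: (p`_0) => a b [] /eqP; rewrite eq_sym -subr_eq0 opprK -mulr2n.
    by rewrite mulrn_eq0 /= => /eqP ->.
  split=> //; last by rewrite {1}pE {1}c0 alg_polyC.
  by apply: contraNneq p0 => s0; rewrite pE c0 s0.
have [z [p' [pE sp']]] := selfdual_root pd p0.
have q0 : quad (dir z) != 0 by rewrite quad_eq0 dir_neq0.
have p'0 : p' != 0 by apply: contraNneq p0 => e; rewrite pE e mul0r.
have pd' : selfdual n p' by apply: (@selfdual_div _ _ (dir z)) => //; rewrite -pE.
have [s [zs [s0 szs pE']]] := IH _ pd' p'0.
exists s, (z :: zs); split=> //=; first by rewrite szs.
by rewrite pE pE' big_cons -scalerAl mulrC.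
Qed.

Definition line n (v : punctured R n.+1) : RP R n := \pi_(RP R n) v.
Arguments line {n} v.

Lemma line_eq n (v w : punctured R n.+1) :
  line v = line w <-> exists l : Rstar R, val v = val l *: val w.
Proof.
split.
  move=> /orbit_spaceP[g Sg <-].
  suff : exists l : Rstar R, forall u, val (g u) = val l *: val u.
    case=> l lE; exists (rstarV l); rewrite lE scalerA mulVf ?scale1r //.
    exact: (valP l).
  elim: Sg => {g} [|_ [l _ <-]|g h _ [a aE] _ [b bE]|g h _ [a aE] gK hK].
  - by exists (rstar1 R) => u; rewrite scale1r.
  - by exists l.
  - have ab0 : val a * val b != 0 by rewrite mulf_neq0 ?(valP a) ?(valP b).
    by exists (Sub (val a * val b) ab0) => u; rewrite /= aE bE scalerA.
  - exists (rstarV a) => u; rewrite -[in RHS](hK u) aE scalerA mulVf ?scale1r //.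
    exact: (valP a).
move=> [l vE]; apply/esym/orbit_spaceP; exists (scale l); last exact: val_inj.
by apply: gen_mem; exists l.
Qed.

Lemma line_repr n (x : punctured R n.+1) :
  exists2 a : R, a != 0 & val (repr (line x)) = a *: val x.
Proof.
have /line_eq[a aE] : line (repr (line x)) = line x by rewrite /line reprK.
by exists (val a) => //; exact: (valP a).
Qed.

Lemma quad_common_root (v w : punctured R 3) z :
  root (quad (val v)) z -> root (quad (val w)) z -> line v = line w.
Proof.
move=> /quad_root; set a := _ / _ => vE /quad_root; set b := _ / _ => wE.
have v0 : val v != 0 by exact: set_mem (valP v).
have w0 : val w != 0 by exact: set_mem (valP w).
have a0 : a != 0 by apply: contraNneq v0 => a0; rewrite vE a0 scale0r.
have b0 : b != 0 by apply: contraNneq w0 => b0; rewrite wE b0 scale0r.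
apply/line_eq; have ab0 : a / b != 0 by rewrite mulf_neq0 ?invr_eq0.
by exists (Sub (a / b) ab0); rewrite [in LHS]vE wE /= scalerA divfK.
Qed.

Lemma quad_has_root y : y != 0 -> exists z, root (quad y) z.
Proof.
rewrite -quad_eq0 => q0; apply/closed_rootP; apply: contraNneq q0 => s1.
apply/eqP/polyP => k; rewrite coef0.
case: k => [|k]; last by rewrite nth_default // s1.
have := congr1 (fun p : {poly C} => p`_2) (star_quad y).
rewrite coef_star coefN /= subnn [in RHS]nth_default ?s1 // oppr0.
by rewrite sqrrN expr1n mul1r => /eqP; rewrite conjc_eq0 => /eqP.
Qed.

(** Uniqueness in Sylvester's theorem: a root of one factor on the left is a
    root of a factor on the right, and two quadratics of vectors with a common
    root are proportional, so the factors can be cancelled one by one. *)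
Lemma quad_prod_lines (vs ws : seq (punctured R 3)) (s t : R) :
  s != 0 -> t != 0 ->
  s%:C%C *: \prod_(v <- vs) quad (val v) = t%:C%C *: \prod_(w <- ws) quad (val w) ->
  size vs = size ws -> perm_eq (map line vs) (map line ws).
Proof.
elim: vs ws s t => [|v vs IH] ws s t s0 t0; first by case: ws.
rewrite big_cons => e sz.
have v0 : val v != 0 by exact: set_mem (valP v).
have [z vz] := quad_has_root v0.
have : root (t%:C%C *: \prod_(w <- ws) quad (val w)) z.
  by rewrite -e rootE hornerZ hornerM (rootP vz) mul0r mulr0.
have tC0 : t%:C%C != 0 by rewrite (inj_eq (@complexI _)).
rewrite rootE hornerZ mulf_eq0 (negPf tC0) /= horner_prod prodf_seq_eq0.
move=> /hasP[w wws /= wz].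
have vw := quad_common_root vz wz.
have /line_eq[l wE] := esym vw.
rewrite (perm_trans _ (perm_map line _ : perm_eq (map line (w :: rem w ws)) _)) //.
  rewrite /= vw perm_cons; apply: (IH _ s (t * val l)) => //.
  - by rewrite mulf_neq0 // (valP l).
  - apply: (@mulfI _ (quad (val v))); first by rewrite quad_eq0.
    rewrite -scalerAr e (perm_big _ (perm_to_rem wws)) /= big_cons wE quadZ.
    by rewrite -scalerAl scalerA -rmorphM scalerAr.
  - by rewrite size_rem // -sz.
by rewrite perm_sym perm_to_rem.
Qed.

End Sylvester.

(** * Real coordinates on self-dual polynomials *)

Section RealCoordinates.
Variable R : realType.
Local Notation C := R[i].
Implicit Types (p q : {poly C}) (z : C) (y : 'rV[R]_3).

Lemma selfdualB n p q : selfdual n p -> selfdual n q -> selfdual n (p - q).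
Proof.
move=> [sp pd] [sq qd]; split.
  by rewrite (leq_trans (size_polyD _ _)) // geq_max sp size_polyN.
by rewrite -scaleN1r starD starZ rmorphN1 pd qd !scaleN1r -scalerBr.
Qed.

Lemma selfdualZ n (a : R) p : selfdual n p -> selfdual n (a%:C%C *: p).
Proof.
move=> [sp pd]; split; first by rewrite (leq_trans (size_scale_leq _ _)).
by rewrite starZ conjc_real pd !scalerA mulrC.
Qed.

Lemma star01 : star 0 1 = 1 :> {poly C}.
Proof.
apply/polyP => -[|k]; rewrite coef_star !coef1 //.
by rewrite expr0 mul1r; apply: complexP; rewrite /= ?oppr0.
Qed.

Lemma selfdual_quad_prod (vs : seq 'rV[R]_3) :
  selfdual (size vs) (\prod_(v <- vs) quad v).
Proof.
elim: vs => [|v vs [sp pd]].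
  rewrite big_nil; split; first by rewrite size_poly1.
  by rewrite scale1r muln0 star01.
rewrite big_cons /=; split.
  rewrite (leq_trans (size_polyMleq _ _)) // mulnS -subn1 leq_subLR.
  by rewrite (leq_trans (leq_add (size_quad v) sp)).
by rewrite mulnS starM ?size_quad // star_quad pd mulNr -scalerAr exprS mulN1r scaleNr.
Qed.

(** Self-duality relates the coefficients of index k and 2n-k by conjugation up
    to sign. For either sign, the sums of the real and imaginary parts of one
    coefficient and of its partner determine both of them, and the middle
    coefficient is real. So this real-linear map is an isomorphism on self-dual
    polynomials, with inverse [dec]. *)
Definition enc m p : 'rV[R]_m := \row_(k < m) (complex.Re p`_k + complex.Im p`_k).

Lemma encD m p q : enc m (p + q) = enc m p + enc m q.
Proof. by apply/rowP => k; rewrite !mxE coefD cReD cImD addrACA. Qed.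

Lemma encZ m (a : R) p : enc m (a%:C%C *: p) = a *: enc m p.
Proof.
apply/rowP => k; rewrite !mxE coefZ.
by rewrite cReM cImM /= !mul0r subr0 addr0 mulrDr.
Qed.

Lemma encB m p q : enc m (p - q) = enc m p - enc m q.
Proof.
by rewrite encD -scaleN1r (_ : -1 = (-1)%:C%C) ?encZ ?scaleN1r // rmorphN1.
Qed.

Lemma enc_eq0 n m p : (2 * n < m)%N -> selfdual n p -> enc m p = 0 -> p = 0.
Proof.
move=> nm [sp pd] p0; apply/polyP => k; rewrite coef0.
have [kn|kn] := leqP k (2 * n); last by rewrite nth_default // (leq_trans sp).
have e j : (j <= 2 * n)%N -> complex.Re p`_j + complex.Im p`_j = 0.
  move=> jn; have := congr1 (fun v : 'rV[R]_m => v 0 (Ordinal (leq_ltn_trans jn nm))) p0.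
  by rewrite !mxE.
have := congr1 (fun q : {poly C} => q`_(2 * n - k)) pd.
rewrite coef_star coefZ leq_subr subKn // => ek.
have := e _ kn; have := e _ (leq_subr k (2 * n)%N).
have -> : p`_(2 * n - k) = (-1) ^+ (n + (2 * n - k)) * conjc p`_k.
  apply: (@mulfI _ ((-1) ^+ n)); first by rewrite signr_eq0.
  by rewrite -ek mulrA -exprD addnA addnn exprD -mul2n exprM sqrrN !expr1n mul1r.
move: p`_k => [a b]; rewrite -signr_odd; case: odd => /=; rewrite ?expr1 ?expr0 /= => e1 e2;
  apply: complexP => /=; lra.
Qed.

Lemma enc_inj n m p q : (2 * n < m)%N -> selfdual n p -> selfdual n q ->
  enc m p = enc m q -> p = q.
Proof.
move=> nm pd qd e; apply/eqP; rewrite -subr_eq0; apply/eqP.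
by apply: (enc_eq0 nm (selfdualB pd qd)); rewrite encB e subrr.
Qed.

Definition half1i : C := Complex 2^-1 2^-1.

Definition dec_half n m (c : 'rV[R]_m) : {poly C} :=
  \poly_(k < (2 * n).+1) (half1i * ((rVpoly c)`_k)%:C%C).

Lemma coef_dec_half n m (c : 'rV[R]_m) k : (dec_half n c)`_k =
  if (k <= 2 * n)%N then half1i * ((rVpoly c)`_k)%:C%C else 0.
Proof. by rewrite coef_poly ltnS. Qed.

(** The sum of a polynomial and of its signed conjugate is self-dual; (1 + i) /
    2 is the factor for which [enc] gives back the coordinates. *)
Definition dec n m (c : 'rV[R]_m) : {poly C} :=
  dec_half n c + (-1) ^+ n *: star (2 * n) (dec_half n c).

Lemma selfdual_dec n m (c : 'rV[R]_m) : selfdual n (dec n c).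
Proof.
have sh : (size (dec_half n c) <= (2 * n).+1)%N by exact: size_poly.
split.
  rewrite (leq_trans (size_polyD _ _)) // geq_max sh.
  by rewrite (leq_trans (size_scale_leq _ _)) // size_star.
have sgn2 : (-1) ^+ (2 * n) = 1 :> C by rewrite exprM sqrrN !expr1n.
rewrite starD starZ starK // rmorphXn rmorphN1 sgn2 scale1r.
by rewrite /dec scalerDr scalerA -exprD addnn -mul2n sgn2 scale1r addrC.
Qed.

Lemma encK n m (c : 'rV[R]_m) : m = (2 * n).+1 -> enc m (dec n c) = c.
Proof.
move=> mE; apply/rowP => k; rewrite mxE coefD coefZ coef_star.
have kn : (k <= 2 * n)%N by rewrite -ltnS -mE.
rewrite kn !coef_dec_half kn leq_subr rmorphM coef_rVpoly_ord.
move: (c 0 k) (rVpoly c)`_(2 * n - k) => a b.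
rewrite mulrA -exprD -signr_odd.
by case: odd; rewrite ?expr1 ?expr0 /=; field.
Qed.

Lemma decK n m p : m = (2 * n).+1 -> selfdual n p -> dec n (enc m p) = p.
Proof.
move=> mE pd; apply: (@enc_inj n m) => //; first by rewrite mE.
  exact: selfdual_dec.
by rewrite encK.
Qed.

Lemma dec_eq0 n m (c : 'rV[R]_m) : m = (2 * n).+1 -> (dec n c == 0) = (c == 0).
Proof.
move=> mE; apply/eqP/eqP => [d0|->]; last first.
  apply: (@enc_eq0 n m); [by rewrite mE|exact: selfdual_dec|exact: encK].
by rewrite -(encK c mE) d0; apply/rowP => k; rewrite !mxE coef0 /= addr0.
Qed.

(** The monic polynomial with coordinates x in the sense of [sym_coord]; the
    length of x is left free so that further coordinates may follow. *)
Definition monic_of d m (x : 'rV[R]_m) : {poly C} :=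
  'X^d + \poly_(k < d) Complex (rVpoly x)`_k (rVpoly x)`_(d + k).

Lemma monic_of_row d m (p : {poly C}) (x : 'rV[R]_m) :
  p \is monic -> size p = d.+1 ->
  (forall k, (k < d)%N -> (rVpoly x)`_k = complex.Re p`_k) ->
  (forall k, (k < d)%N -> (rVpoly x)`_(d + k) = complex.Im p`_k) ->
  monic_of d x = p.
Proof.
move=> pm sp xr xi; apply/polyP => k; rewrite coefD coefXn coef_poly.
case: ltngtP => [kd|kd|->].
- by rewrite add0r xr // xi //; case: p`_k.
- by rewrite addr0 nth_default // sp.
- by move/monicP: pm; rewrite lead_coefE sp addr0 => ->.
Qed.

Lemma monic_of_sym_coord d (z : 'I_d -> C) :
  monic_of d (sym_coord z) = \prod_i ('X - (z i)%:P).
Proof.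
have d2 k : (k < d)%N -> (d + k < 2 * d)%N by rewrite mul2n -addnn ltn_add2l.
have coordE k : (k < 2 * d)%N -> (rVpoly (sym_coord z))`_k =
    if (k < d)%N then complex.Re (\prod_i ('X - (z i)%:P))`_k
    else complex.Im (\prod_i ('X - (z i)%:P))`_(k - d).
  by move=> kd; rewrite (_ : k = Ordinal kd) // coef_rVpoly_ord mxE.
apply: monic_of_row => [||k kd|k kd].
- exact: monic_prod_XsubC.
- by rewrite size_prod_XsubC /index_enum -enumT size_enum_ord.
- by rewrite coordE ?kd // (leq_trans kd) // mul2n -addnn leq_addr.
- by rewrite coordE ?d2 // ltnNge leq_addr /= addKn.
Qed.

Lemma star_prod_XsubC (I : Type) (r : seq I) (z : I -> C) :
  star (size r) (\prod_(i <- r) ('X - (z i)%:P)) = \prod_(i <- r) (1 + conjc (z i) *: 'X).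
Proof.
elim: r => [|i r IH].
  by rewrite !big_nil star01.
rewrite !big_cons -IH /= -add1n starM ?size_XsubC //; last by rewrite size_prod_XsubC.
congr (_ * _); apply/polyP => k.
rewrite coef_star [RHS]coefD coefZ coef1 coefB !coefX coefC.
case: k => [|[|k]]; rewrite ?subn0 ?subnn ?(mulr0, mulr1) ?(addr0, add0r) //.
  by rewrite expr0 mul1r subr0 conjc1.
by rewrite expr1 eqxx rmorphN mulN1r opprK.
Qed.

End RealCoordinates.

(** * Rotations as substitutions *)

Section Frames.
Variable R : realType.
Local Notation C := R[i].
Implicit Types (p q : {poly C}) (z : C) (y : 'rV[R]_3) (F : 'M[R]_3).

Lemma sum_ord3 (V : nmodType) (G : 'I_3 -> V) : \sum_i G i = G 0 + G 1 + G 2.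
Proof.
rewrite big_ord_recl big_ord_recl big_ord1 addrA.
by congr (_ + G _ + G _); apply: val_inj.
Qed.

(** Quadratics of the standard basis of R^3. Up to factors, they parametrise the
    isotropic conic, whence [isotropic_sq]. *)
Definition isotropic (k : 'I_3) : {poly C} :=
  [:: 'X^2 - 1; - ('i%C *: ('X^2 + 1)); 2%:R *: 'X]`_k.

Lemma quadE y : quad y = \sum_k (y 0 k)%:C%C *: isotropic k.
Proof.
rewrite sum_ord3 /isotropic /=.
apply/polyP => k; rewrite coef_quad /zeta.
rewrite !(coefD, coefZ, coefN, coefXn, coefX, coef1).
case: k => [|[|[|k]]] /=; apply: complexP => /=; ring.
Qed.

Lemma isotropic_sq : \sum_k isotropic k ^+ 2 = 0.
Proof.
rewrite sum_ord3 /isotropic /=.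
rewrite sqrrN !exprZn sqr_i -!mul_polyC rmorphN1 rmorphXn /=; ring.
Qed.

Definition frame_quad F (j : 'I_3) := quad (row j F^T).

(** Orthogonality of F preserves the equation of the isotropic conic. *)
Lemma frame_quad_sq F : frames F -> \sum_j frame_quad F j ^+ 2 = 0.
Proof.
move=> FF; rewrite -[RHS]isotropic_sq.
have e j : frame_quad F j ^+ 2 =
    \sum_k \sum_l (F k j * F l j)%:C%C *: (isotropic k * isotropic l).
  rewrite /frame_quad quadE expr2 big_distrl; apply: eq_bigr => k _.
  rewrite big_distrr; apply: eq_bigr => l _.
  by rewrite /= !mxE -scalerAl -scalerAr scalerA rmorphM.
rewrite (eq_bigr _ (fun j _ => e j)) exchange_big; apply: eq_bigr => k _.
rewrite exchange_big (bigD1 k) //= [X in _ + X]big1 => [|l lk].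
  rewrite -scaler_suml -rmorph_sum addr0.
  have := congr1 (fun M : 'M[R]_3 => M k k) FF; rewrite !mxE eqxx => kk.
  rewrite (_ : \sum_i _ = 1) ?scale1r //.
  by rewrite -[RHS]kk; apply: eq_bigr => i _; rewrite mxE.
rewrite -scaler_suml -rmorph_sum.
have := congr1 (fun M : 'M[R]_3 => M k l) FF; rewrite !mxE eq_sym (negPf lk) => kl.
rewrite (_ : \sum_i _ = 0) ?scale0r //.
by rewrite -[RHS]kl; apply: eq_bigr => i _; rewrite mxE.
Qed.

(** Images of 1, X and X^2 under a change of frame are [frame_al], [frame_ga]
    and [frame_be]. By [frame_ga_sq] they are, up to a common sign, the squares
    and the product of two linear forms, which define a Moebius transformation.
    *)
Definition frame_al F := 2^-1 *: ('i%C *: frame_quad F 1 - frame_quad F 0).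
Definition frame_be F := 2^-1 *: ('i%C *: frame_quad F 1 + frame_quad F 0).
Definition frame_ga F := 2^-1 *: frame_quad F 2.

Lemma frame_ga_sq F : frames F -> frame_ga F ^+ 2 = frame_al F * frame_be F.
Proof.
move=> /frame_quad_sq; rewrite /frame_al /frame_be /frame_ga.
rewrite sum_ord3.
move: (frame_quad F 0) (frame_quad F 1) (frame_quad F 2) => a b c e.
rewrite exprZn -scalerAl -scalerAr scalerA -expr2 -subr_sqr exprZn sqr_i.
by congr (_ *: _); rewrite scaleN1r -[LHS]subr0 -e; ring.
Qed.

Lemma quad_frame F y : quad (y *m F^T) =
  conjc (zeta y) *: frame_be F + (2 * y 0 2)%:C%C *: frame_ga F - zeta y *: frame_al F.
Proof.
have -> : quad (y *m F^T) = \sum_j (y 0 j)%:C%C *: frame_quad F j.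
  rewrite quadE; under [RHS]eq_bigr => j _ do rewrite /frame_quad quadE scaler_sumr.
  rewrite exchange_big; apply: eq_bigr => k _ /=.
  rewrite mxE rmorph_sum scaler_suml; apply: eq_bigr => j _.
  by rewrite scalerA -rmorphM [row _ _ _ _]mxE.
rewrite sum_ord3 /frame_be /frame_al /frame_ga /zeta.
move: (frame_quad F 0) (frame_quad F 1) (frame_quad F 2) => q0 q1 q2.
apply/polyP => k; rewrite !(coefD, coefN, coefZ).
move: q0`_k q1`_k q2`_k => [a a'] [b b'] [c c'].
have -> : 2^-1 = Complex 2^-1 0 :> C.
  by apply: (@mulfI _ 2); rewrite ?pnatr_eq0 // divff ?pnatr_eq0 //; apply: complexP => /=; field.
by apply: complexP => /=; field.
Qed.

(** Image of X^k, as a form of degree 2d, under the Moebius transformation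
    attached to F. Writing it with [frame_ga] for odd k avoids the choice of
    square roots of [frame_al] and [frame_be]. *)
Definition frame_monomial F d k :=
  if odd k then frame_al F ^+ (d.-1 - k./2) * frame_be F ^+ k./2 * frame_ga F
  else frame_al F ^+ (d - k./2) * frame_be F ^+ k./2.

Definition frame_subst F d p :=
  \sum_(k < (2 * d).+1) p`_k *: frame_monomial F d k.

Lemma frame_monomial_be F d k : (k <= 2 * d)%N ->
  frame_monomial F d.+1 k.+2 = frame_be F * frame_monomial F d k.
Proof.
rewrite /frame_monomial /= negbK => kd; case: ifP => ok.
  have k2 : (k./2 < d)%N by lia.
  by rewrite (_ : (d - k./2.+1)%N = (d.-1 - k./2)%N) ?exprS; [ring|lia].
by rewrite subSS exprS; ring.
Qed.

Lemma frame_monomial_al F d k : (k <= 2 * d)%N ->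
  frame_monomial F d.+1 k = frame_al F * frame_monomial F d k.
Proof.
rewrite /frame_monomial => kd; case: ifP => ok /=.
  by rewrite (_ : (d - k./2)%N = (d.-1 - k./2).+1) ?exprS; [ring|lia].
by rewrite (_ : (d.+1 - k./2)%N = (d - k./2).+1) ?exprS; [ring|lia].
Qed.

Lemma frame_monomial_ga F d k : frames F -> (k <= 2 * d)%N ->
  frame_monomial F d.+1 k.+1 = frame_ga F * frame_monomial F d k.
Proof.
move=> /frame_ga_sq gaE; rewrite /frame_monomial => kd /=.
case: (boolP (odd k)) => ok /=.
  have -> : uphalf k = (k./2).+1 by rewrite uphalf_half ok.
  have -> : (d.+1 - (k./2).+1)%N = (d.-1 - k./2).+1 by clear gaE; lia.
  move: (k./2) (d.-1 - k./2)%N => i j; rewrite !exprS.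
  have -> : frame_ga F * (frame_al F ^+ j * frame_be F ^+ i * frame_ga F) =
    frame_ga F ^+ 2 * (frame_al F ^+ j * frame_be F ^+ i) by rewrite expr2; ring.
  by rewrite gaE; ring.
have -> : uphalf k = k./2 by rewrite uphalf_half (negPf ok).
by rewrite mulrC.
Qed.

Lemma frame_subst_sum F d (I : Type) (r : seq I) (p : I -> {poly C}) (a : I -> C) :
  frame_subst F d (\sum_(i <- r) a i *: p i) = \sum_(i <- r) a i *: frame_subst F d (p i).
Proof.
rewrite /frame_subst; under [RHS]eq_bigr => i _ do rewrite scaler_sumr.
rewrite [RHS]exchange_big; apply: eq_bigr => k _ /=.
rewrite coef_sum scaler_suml; apply: eq_bigr => i _.
by rewrite coefZ scalerA.
Qed.

Lemma frame_substXn F d k : (k <= 2 * d)%N -> frame_subst F d 'X^k = frame_monomial F d k.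
Proof.
move=> kd; rewrite /frame_subst (bigD1 (Ordinal (kd : (k < (2 * d).+1)%N))) //= big1.
  by rewrite coefXn eqxx scale1r addr0.
by move=> i; rewrite -val_eqE /= coefXn => /negPf ->; rewrite scale0r.
Qed.

(** The substitution is multiplicative; one factor is taken to be a quadratic,
    so that the degree grows by 2 and the three-term expansion [quad_frame]
    applies. *)
Lemma frame_subst_mul F d p y : frames F -> (size p <= (2 * d).+1)%N ->
  frame_subst F d.+1 (quad y * p) = quad (y *m F^T) * frame_subst F d p.
Proof.
move=> FF sp.
have pE : p = \sum_(k < (2 * d).+1) p`_k *: 'X^k.
  by rewrite -poly_def; apply/polyP => k; rewrite coef_poly; case: ltnP => // kd;
     rewrite nth_default // (leq_trans sp).
rewrite {1}pE mulr_sumr; under eq_bigr => k _ do rewrite -scalerAr.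
rewrite frame_subst_sum mulr_sumr; apply: eq_bigr => k _; rewrite -scalerAr; congr (_ *: _).
have kd : (k <= 2 * d)%N by rewrite -ltnS.
pose c := [:: - zeta y; (2 * y 0 2)%:C%C; conjc (zeta y)].
have -> : quad y * 'X^k = \sum_(i < 3) c`_i *: 'X^(k + i).
  rewrite sum_ord3 /= addn0 addn1 addn2 /quad !mulrDl -!scalerAl -!exprD -exprS.
  by rewrite mulNr mul_polyC -scaleNr add2n; ring.
rewrite frame_subst_sum sum_ord3 /= addn0 addn1 addn2.
rewrite !frame_substXn; try by lia.
rewrite frame_monomial_be // frame_monomial_ga // frame_monomial_al // quad_frame.
rewrite -[(_ -i* _)%C]/(conjc (zeta y)) !mulrDl mulNr -!scalerAl scaleNr.
by rewrite addrC [- _ + _]addrC addrA.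
Qed.

(** Rotating all vectors of a product amounts to one linear substitution of the
    product. Through it the coordinates of any frame reach the standard form
    linearly. *)
Lemma frame_subst_prod F (vs : seq 'rV[R]_3) : frames F ->
  frame_subst F (size vs) (\prod_(v <- vs) quad v) = \prod_(v <- vs) quad (v *m F^T).
Proof.
move=> FF; elim: vs => [|v vs IH].
  rewrite !big_nil /frame_subst muln0 big_ord1 coef1 scale1r /frame_monomial /=.
  by rewrite expr0 mulr1.
rewrite !big_cons /= frame_subst_mul //; first by rewrite IH.
by have [] := selfdual_quad_prod vs.
Qed.

End Frames.

(** * Stereographic projection and choice of a frame *)

Section Stereographic.
Variable R : realType.
Local Notation C := R[i].
Import Normc.
Implicit Types (p q : {poly C}) (z : C) (v w : 'rV[R]_3) (F : 'M[R]_3).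

Lemma normcE2 z : normc z = Num.sqrt (sqnorm z).
Proof. by case: z. Qed.

Lemma normc_ge0 z : 0 <= normc z.
Proof. by rewrite normcE2 sqrtr_ge0. Qed.

Lemma sqnorm_ge0 z : 0 <= sqnorm z.
Proof. by rewrite addr_ge0 ?sqr_ge0. Qed.

Lemma normc_lt1 z : (normc z < 1) = (sqnorm z < 1).
Proof. by rewrite normcE2 -{1}(@sqrtr1 R) ltr_sqrt. Qed.

Definition eucl n (x : 'rV[R]_n) : R := Num.sqrt (\sum_i x 0 i ^+ 2).

Lemma eucl_ge0 n (x : 'rV[R]_n) : 0 <= eucl x.
Proof. exact: sqrtr_ge0. Qed.

Lemma eucl_sqr_gt0 n (x : 'rV[R]_n) : (0 < \sum_i x 0 i ^+ 2) = (x != 0).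
Proof.
have s0 : 0 <= \sum_i x 0 i ^+ 2 by apply: sumr_ge0 => i _; rewrite sqr_ge0.
rewrite lt_neqAle s0 andbT eq_sym; congr (~~ _); apply/eqP/eqP => [e|->].
  apply/rowP => i; rewrite mxE; apply/eqP; rewrite -sqrf_eq0.
  by move/eqP: e; rewrite psumr_eq0 => [/allP/(_ i)|j _]; rewrite ?sqr_ge0 // mem_index_enum => /(_ isT).
by rewrite big1 // => i _; rewrite mxE expr0n.
Qed.

Lemma eucl_gt0 n (x : 'rV[R]_n) : (0 < eucl x) = (x != 0).
Proof. by rewrite sqrtr_gt0 eucl_sqr_gt0. Qed.

Lemma euclZ n a (x : 'rV[R]_n) : eucl (a *: x) = `|a| * eucl x.
Proof.
rewrite /eucl -sqrtr_sqr -sqrtrM ?sqr_ge0 //; congr Num.sqrt.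
by rewrite mulr_sumr; apply: eq_bigr => i _; rewrite mxE exprMn.
Qed.

Lemma coord_le_eucl n (x : 'rV[R]_n) i : `|x 0 i| <= eucl x.
Proof.
rewrite -sqrtr_sqr ler_wsqrtr // (bigD1 i) //= lerDl.
by apply: sumr_ge0 => j _; rewrite sqr_ge0.
Qed.

Lemma enorm_ge0 v : 0 <= enorm v.
Proof. exact: eucl_ge0. Qed.

Lemma enormE v : enorm v ^+ 2 = v 0 0 ^+ 2 + v 0 1 ^+ 2 + v 0 2 ^+ 2.
Proof. by rewrite sqr_sqrtr ?sum_ord3 // !addr_ge0 ?sqr_ge0. Qed.

Lemma enorm_gt0 v : (0 < enorm v) = (v != 0).
Proof. exact: eucl_gt0. Qed.

Lemma enormZ a v : enorm (a *: v) = `|a| * enorm v.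
Proof. exact: euclZ. Qed.

Lemma sqr_dot v : \sum_i v 0 i ^+ 2 = (v *m v^T) 0 0.
Proof. by rewrite mxE; apply: eq_bigr => i _; rewrite mxE expr2. Qed.

Lemma frame_tr F : frames F -> F^T *m F = 1%:M.
Proof. exact: mulmx1C. Qed.

Lemma enorm_frame F v : frames F -> enorm (v *m F^T) = enorm v.
Proof.
move=> FF; rewrite /enorm !sqr_dot trmx_mul trmxK mulmxA -(mulmxA v).
by rewrite frame_tr // mulmx1.
Qed.

Lemma heightZ F a v : height F (a *: v) = a * height F v.
Proof. by rewrite /height -scalemxAl mxE. Qed.

Lemma height_denom_gt0 F v : height F v != 0 -> 0 < enorm v + `|height F v|.
Proof. by move=> h0; rewrite ltr_wpDl ?enorm_ge0 // normr_gt0. Qed.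

Lemma stereoZ F a v : a != 0 -> stereo F (a *: v) = stereo F v.
Proof.
move=> a0; rewrite /stereo heightZ enormZ normrM -mulrDr sgrM -scalemxAl !mxE.
have e x : Num.sg a * Num.sg (height F v) / (`|a| * (enorm v + `|height F v|)) * (a * x)
  = Num.sg (height F v) / (enorm v + `|height F v|) * x.
  have aE : a = Num.sg a * `|a| by rewrite -numEsg.
  rewrite invfM {3}aE.
  have s2 : Num.sg a * Num.sg a = 1 by rewrite -expr2 sqr_sg a0.
  transitivity ((Num.sg a * Num.sg a) * (`|a|^-1 * `|a|) *
    (Num.sg (height F v) / (enorm v + `|height F v|) * x)); first by ring.
  by rewrite s2 mulVf ?normr_eq0 // !mul1r.
by rewrite !e.
Qed.

Lemma stereo_sqnorm F v : frames F -> height F v != 0 ->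
  sqnorm (stereo F v) = (enorm v - `|height F v|) / (enorm v + `|height F v|).
Proof.
move=> FF h0; have d0 := height_denom_gt0 h0.
rewrite /sqnorm /stereo /= !exprMn -mulrDr sqr_sg h0 mul1r.
have := enormE (v *m F^T); rewrite enorm_frame // -/(height F v) => e.
have -> : (v *m F^T) 0 0 ^+ 2 + (v *m F^T) 0 1 ^+ 2 =
    (enorm v - `|height F v|) * (enorm v + `|height F v|).
  by rewrite -subr_sqr e real_normK ?num_real // addrK.
by field; rewrite gt_eqF.
Qed.

Lemma stereo_lt1 F v : frames F -> height F v != 0 -> normc (stereo F v) < 1.
Proof.
move=> FF h0; have d0 := height_denom_gt0 h0.
rewrite normc_lt1 stereo_sqnorm // ltr_pdivrMr // mul1r.
by rewrite ltrD2l -subr_gt0 opprK -mulr2n pmulrn_lgt0 // normr_gt0.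
Qed.

(** In the frame F the vector v is proportional to [dir (stereo F v)], whose
    quadratic is [quad_dir]. *)
Lemma quad_stereo F v : frames F -> height F v != 0 ->
  quad (v *m F^T) = (Num.sg (height F v) * (enorm v + `|height F v|))%:C%C *:
    (('X - (stereo F v)%:P) * (1 + conjc (stereo F v) *: 'X)).
Proof.
move=> FF h0; have d0 := height_denom_gt0 h0.
set k := Num.sg _ * _.
have qd := quad_dir (stereo F v).
have -> : v *m F^T = (k / 2) *: dir (stereo F v).
  have s2 : Num.sg (height F v) * Num.sg (height F v) = 1 by rewrite -expr2 sqr_sg h0.
  have dn : enorm v + `|height F v| != 0 by rewrite gt_eqF.
  have kr : k * (Num.sg (height F v) / (enorm v + `|height F v|)) = 1.
    by rewrite /k mulrACA s2 mul1r mulfV.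
  have e x : x = k / 2 * (2 * (Num.sg (height F v) / (enorm v + `|height F v|) * x)).
    transitivity (k * (Num.sg (height F v) / (enorm v + `|height F v|)) * x).
      by rewrite kr mul1r.
    by field.
  apply: row3P; rewrite ![in RHS]mxE /=; [exact: e|exact: e|].
  rewrite stereo_sqnorm // -/(height F v).
  rewrite [LHS]numEsg /k; move: dn; set s := Num.sg _; set h := `|_| => dn.
  by field.
rewrite quadZ qd mul_polyC scalerA; congr (_ *: _).
by apply: complexP => /=; field.
Qed.

Lemma stereo_dir F z : frames F -> normc z < 1 ->
  height F (dir z *m F) != 0 /\ stereo F (dir z *m F) = z.
Proof.
rewrite normc_lt1 => FF z1.
have FT : dir z *m F *m F^T = dir z by rewrite -mulmxA FF mulmx1.
have hE : height F (dir z *m F) = 1 - sqnorm z by rewrite /height FT mxE.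
have h0 : 0 < height F (dir z *m F) by rewrite hE subr_gt0.
split; first by rewrite gt_eqF.
have nE : enorm (dir z *m F) = 1 + sqnorm z.
  rewrite -(enorm_frame _ FF) FT /enorm sum_ord3 !mxE /=.
  have -> : (2 * complex.Re z) ^+ 2 + (2 * complex.Im z) ^+ 2 + (1 - sqnorm z) ^+ 2
    = (1 + sqnorm z) ^+ 2 by rewrite /sqnorm; ring.
  by rewrite sqrtr_sqr ger0_norm // addr_ge0 ?sqnorm_ge0.
rewrite /stereo FT gtr0_sg // gtr0_norm // nE hE !mxE /=.
have -> : 1 + sqnorm z + (1 - sqnorm z) = 2 by ring.
by case: z {FF z1 FT hE h0 nE} => a b; apply: complexP => /=; field.
Qed.

Lemma householder_denom (s : R) : 1 + s ^+ 2 + s ^+ 4 != 0.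
Proof. by rewrite gt_eqF // -addrA ltr_pwDl // addr_ge0 // exprn_even_ge0. Qed.

(** Reflections in the planes orthogonal to (1, s, s^2): a curve of orthogonal
    matrices with rational entries, on which nonvanishing conditions become
    polynomial in s. *)
Definition householder (s : R) : 'M[R]_3 :=
  let w : 'rV[R]_3 := \row_j s ^+ j in
  1%:M - (2 / (1 + s ^+ 2 + s ^+ 4)) *: (w^T *m w).

Lemma householder_sym s : (householder s)^T = householder s.
Proof.
by apply/matrixP => i j; rewrite !mxE !big_ord1 !mxE eq_sym [s ^+ j * _]mulrC.
Qed.

Lemma householder_frame s : frames (householder s).
Proof.
rewrite /frames /= householder_sym /householder; set n := 1 + s ^+ 2 + s ^+ 4; set w := \row_j _.
have n0 : n != 0 := householder_denom s.
have ww : w *m w^T = n%:M.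
  apply/matrixP => i j; rewrite !ord1 !mxE sum_ord3 !mxE /= mulr1n /n.
  by rewrite expr0 expr1; ring.
rewrite mulmxBl mul1mx mulmxBr mulmx1 -scalemxAl -scalemxAr scalerA.
rewrite -mulmxA (mulmxA w) ww mul_scalar_mx -scalemxAr scalerA.
rewrite -scalerBl -addrA -opprD -scalerDl.
by rewrite (_ : 2 / n + _ = 0) ?scale0r ?subr0 //; field.
Qed.

Definition height_poly v : {poly R} :=
  (v 0 2)%:P + (v 0 2 - 2 * v 0 0) *: 'X^2 - (2 * v 0 1) *: 'X^3 - v 0 2 *: 'X^4.

Lemma height_householder s v :
  height (householder s) v = (height_poly v).[s] / (1 + s ^+ 2 + s ^+ 4).
Proof.
have n0 := householder_denom s.
rewrite /height householder_sym /householder.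
rewrite mulmxBr mulmx1 -scalemxAr mulmxA !mxE big_ord1 !mxE sum_ord3 !mxE /=.
rewrite /height_poly !(hornerD, hornerN, hornerZ, hornerXn, hornerC) expr0 expr1.
by field.
Qed.

Lemma height_poly_neq0 v : v != 0 -> height_poly v != 0.
Proof.
apply: contraNneq => p0.
have c k : (height_poly v)`_k = 0 by rewrite p0 coef0.
have := c 0%N; have := c 2; have := c 3.
rewrite /height_poly !(coefD, coefN, coefZ, coefXn, coefC) /=.
rewrite !(mulr0, mulr1, add0r, addr0, subr0, sub0r, oppr0) => c3 c2 c0.
by apply/eqP; apply: row3P; rewrite mxE; lra.
Qed.

(** Finitely many lines avoid the plane of height 0 of some frame, because on
    the curve of Householder matrices the heights are nonzero rational functions
    of s, and so is their product. *)
Lemma frame_avoiding (I : finType) (vs : I -> 'rV[R]_3) : (forall i, vs i != 0) ->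
  exists2 F, frames F & forall i, height F (vs i) != 0.
Proof.
move=> vs0; have P0 : \prod_i height_poly (vs i) != 0.
  by apply/prodf_neq0 => i _; exact: height_poly_neq0.
have [s sP] : exists s, (\prod_i height_poly (vs i)).[s] != 0.
  apply: contrapT => noroot; move/eqP: P0; apply; apply: eq_poly_nonzero => s _.
  by rewrite horner0; apply/eqP/negPn/negP => s0; apply: noroot; exists s.
exists (householder s); first exact: householder_frame.
move=> i; rewrite height_householder mulf_neq0 //.
  by move: sP; rewrite horner_prod => /prodf_neq0/(_ i isT).
by rewrite invr_neq0 // householder_denom.
Qed.

End Stereographic.

(** * Smooth coefficients and the smooth inverse of a product *)

(** What smooth functions on an open set and functions continuous at a point
    have in common. Coefficients of polynomials are studied for both at once. *)
Definition is_subalgebra (R : realType) (T : Type) (S : (T -> R) -> Prop) : Prop :=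
  [/\ forall c, S (fun=> c),
      forall f g, S f -> S g -> S (fun x => f x + g x) &
      forall f g, S f -> S g -> S (fun x => f x * g x)].

Lemma smooth_subalgebra (R : realType) n (U : set 'rV[R]_n) :
  open U -> is_subalgebra (smooth U).
Proof.
by move=> oU; split=> [c|f g|f g]; [exact: smooth_cst|exact: smoothD|exact: smoothM].
Qed.

Lemma continuous_subalgebra (R : realType) (T : topologicalType) (x : T) :
  is_subalgebra (fun f : T -> R => {for x, continuous f}).
Proof.
split=> [c|f g cf cg|f g cf cg]; first exact: cst_continuous.
  exact: continuousD.
exact: continuousM.
Qed.

Section RegularCoefficients.
Variables (R : realType) (T : Type) (S : (T -> R) -> Prop).
Local Notation C := R[i].
Hypothesis subS : is_subalgebra S.

Let S_cst c : S (fun=> c). Proof. by have [] := subS. Qed.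
Let S_add f g : S f -> S g -> S (fun x => f x + g x).
Proof. by have [_ H _] := subS; exact: H. Qed.
Let S_mul f g : S f -> S g -> S (fun x => f x * g x).
Proof. by have [_ _ H] := subS; exact: H. Qed.

Let S_opp f : S f -> S (fun x => - f x).
Proof.
move=> Sf; have := S_mul (S_cst (-1)) Sf.
by congr S; apply: funext => x; rewrite mulN1r.
Qed.

Definition regularC (f : T -> C) : Prop :=
  S (fun x => complex.Re (f x)) /\ S (fun x => complex.Im (f x)).

Definition regularP (F : T -> {poly C}) : Prop := forall k, regularC (fun x => (F x)`_k).

Lemma regularC_cst c : regularC (fun=> c).
Proof. by split; exact: S_cst. Qed.

Lemma regularC_real f : S f -> regularC (fun x => (f x)%:C%C).
Proof. by move=> Sf; split=> //; exact: S_cst. Qed.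

Lemma regularC_pair f g : S f -> S g -> regularC (fun x => Complex (f x) (g x)).
Proof. by []. Qed.

Lemma regularC_add f g : regularC f -> regularC g -> regularC (fun x => f x + g x).
Proof.
move=> [f1 f2] [g1 g2]; split.
  by have := S_add f1 g1; congr S; apply: funext => x; rewrite cReD.
by have := S_add f2 g2; congr S; apply: funext => x; rewrite cImD.
Qed.

Lemma regularC_mul f g : regularC f -> regularC g -> regularC (fun x => f x * g x).
Proof.
move=> [f1 f2] [g1 g2]; split.
  have := S_add (S_mul f1 g1) (S_opp (S_mul f2 g2)).
  by congr S; apply: funext => x; rewrite cReM.
have := S_add (S_mul f1 g2) (S_mul f2 g1).
by congr S; apply: funext => x; rewrite cImM.
Qed.

Lemma regularC_conj f : regularC f -> regularC (fun x => conjc (f x)).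
Proof.
move=> [f1 f2]; split.
  by move: f1; congr S; apply: funext => x; case: (f x).
by have := S_opp f2; congr S; apply: funext => x; case: (f x).
Qed.

Lemma regularC_sum (I : Type) (r : seq I) (f : I -> T -> C) :
  (forall i, regularC (f i)) -> regularC (fun x => \sum_(i <- r) f i x).
Proof.
move=> rf; elim: r => [|i r IH].
  by have := regularC_cst 0; congr regularC; apply: funext => x; rewrite big_nil.
have := regularC_add (rf i) IH.
by congr regularC; apply: funext => x; rewrite big_cons.
Qed.

Lemma regularP_cst p : regularP (fun=> p).
Proof. by move=> k; exact: regularC_cst. Qed.

Lemma regularP_add F G : regularP F -> regularP G -> regularP (fun x => F x + G x).
Proof.
move=> rF rG k; have := regularC_add (rF k) (rG k).
by congr regularC; apply: funext => x; rewrite coefD.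
Qed.

Lemma regularP_scale f F : regularC f -> regularP F -> regularP (fun x => f x *: F x).
Proof.
move=> rf rF k; have := regularC_mul rf (rF k).
by congr regularC; apply: funext => x; rewrite coefZ.
Qed.

Lemma regularP_opp F : regularP F -> regularP (fun x => - F x).
Proof.
move=> rF k; have := regularC_mul (regularC_cst (-1)) (rF k).
by congr regularC; apply: funext => x; rewrite coefN mulN1r.
Qed.

Lemma regularP_mul F G : regularP F -> regularP G -> regularP (fun x => F x * G x).
Proof.
move=> rF rG k.
have := regularC_sum (index_enum 'I_k.+1)
  (fun j : 'I_k.+1 => regularC_mul (rF j) (rG (k - j)%N)).
by congr regularC; apply: funext => x; rewrite coefM.
Qed.

Lemma regularP_sum (I : Type) (r : seq I) (F : I -> T -> {poly C}) :
  (forall i, regularP (F i)) -> regularP (fun x => \sum_(i <- r) F i x).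
Proof.
move=> rF; elim: r => [|i r IH].
  by have := regularP_cst 0; congr regularP; apply: funext => x; rewrite big_nil.
have := regularP_add (rF i) IH.
by congr regularP; apply: funext => x; rewrite big_cons.
Qed.

Lemma regularP_prod (I : Type) (r : seq I) (F : I -> T -> {poly C}) :
  (forall i, regularP (F i)) -> regularP (fun x => \prod_(i <- r) F i x).
Proof.
move=> rF; elim: r => [|i r IH].
  by have := regularP_cst 1; congr regularP; apply: funext => x; rewrite big_nil.
have := regularP_mul (rF i) IH.
by congr regularP; apply: funext => x; rewrite big_cons.
Qed.

Lemma regularP_poly n (f : nat -> T -> C) : (forall k, regularC (f k)) ->
  regularP (fun x => \poly_(k < n) f k x).
Proof.
move=> rf k; have [kn|kn] := boolP (k < n)%N.
  by have := rf k; congr regularC; apply: funext => x; rewrite coef_poly kn.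
have := regularC_cst 0; congr regularC; apply: funext => x.
by rewrite coef_poly (negPf kn).
Qed.

Lemma regularP_star n F : regularP F -> regularP (fun x => star n (F x)).
Proof.
move=> rF; apply: (regularP_poly n.+1) => k.
by apply: regularC_mul; [exact: regularC_cst|exact: regularC_conj].
Qed.

Lemma regular_enc m F j : regularP F -> S (fun x => enc m (F x) 0 j).
Proof.
move=> rF; have [f1 f2] := rF j; have := S_add f1 f2.
by congr S; apply: funext => x; rewrite mxE.
Qed.

Lemma regularP_frame_subst M d F : regularP F ->
  regularP (fun x => frame_subst M d (F x)).
Proof.
move=> rF; apply: regularP_sum => k; apply: regularP_scale; first exact: rF.
exact: regularP_cst.
Qed.

Lemma regularP_quad (f : T -> 'rV[R]_3) :
  (forall i, S (fun x => f x 0 i)) -> regularP (fun x => quad (f x)).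
Proof.
move=> Sf; apply: regularP_add; last first.
  apply: regularP_opp => k; case: k => [|k].
    have := regularC_pair (Sf 0) (Sf 1); congr regularC; apply: funext => x.
    by rewrite coefC.
  have := regularC_cst 0; congr regularC; apply: funext => x; by rewrite coefC.
apply: regularP_add; apply: regularP_scale; try exact: regularP_cst.
  by apply: regularC_conj; exact: regularC_pair.
by apply: regularC_real; apply: S_mul.
Qed.

End RegularCoefficients.

Section ChartInverse.
Variable R : realType.
Local Notation C := R[i].
Import Normc.

Lemma smooth_rVpoly m (U : set 'rV[R]_m) k : open U ->
  smooth U (fun x => (rVpoly x)`_k).
Proof.
move=> oU; have [km|km] := ltnP k m.
  apply: eq_smooth (smooth_coord oU (Ordinal km)) => // x _.
  by rewrite -coef_rVpoly_ord.
apply: eq_smooth (smooth_cst U 0) => // x _.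
by rewrite nth_default // (leq_trans (size_poly _ _)).
Qed.

Lemma continuous_rVpoly m k : continuous (fun x : 'rV[R]_m => (rVpoly x)`_k).
Proof.
by move=> x; apply: (smooth_continuous (U := setT)) => //; exact: smooth_rVpoly openT.
Qed.

Section SmoothCoefficients.
Variables (m : nat) (U : set 'rV[R]_m).
Hypothesis oU : open U.
Let algU := smooth_subalgebra oU.

Definition monic_dir d (x : 'rV[R]_m) : {poly C} :=
  \poly_(k < d) Complex (rVpoly x)`_k (rVpoly x)`_(d + k).

Lemma smooth_monic_dir d : regularP (smooth U) (monic_dir d).
Proof.
apply: regularP_poly => // k.
by apply: regularC_pair; exact: smooth_rVpoly.
Qed.

Lemma smooth_monic_of d : regularP (smooth U) (fun x => monic_of d x).
Proof.
by apply: regularP_add => //; [exact: regularP_cst|exact: smooth_monic_dir].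
Qed.

(** The form s A A' attached to a monic A and a real s, where A' = star d A has
    the antipodes of the roots of A as roots. *)
Definition product_map d (x : 'rV[R]_m) : {poly C} :=
  ((rVpoly x)`_(2 * d))%:C%C *: (monic_of d x * star d (monic_of d x)).

Lemma smooth_dec d : regularP (smooth U) (fun x => dec d x).
Proof.
have sh : regularP (smooth U) (dec_half d (m := m)).
  apply: regularP_poly => // k; apply: regularC_mul => //; first exact: regularC_cst.
  by apply: regularC_real => //; exact: smooth_rVpoly.
apply: regularP_add => //; apply: regularP_scale => //; first exact: regularC_cst.
exact: regularP_star.
Qed.

End SmoothCoefficients.

Lemma starB n (p q : {poly C}) : star n (p - q) = star n p - star n q.
Proof. by rewrite -scaleN1r starD starZ rmorphN1 scaleN1r. Qed.

Lemma star0 n : star n 0 = 0 :> {poly C}.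
Proof. by have := starB n 0 0; rewrite !subrr. Qed.

Section MonicLemmas.
Variables (m d : nat).
Implicit Types (x u v : 'rV[R]_m) (p q : {poly C}) (z : C).

Lemma coef_monic_dir x k : (monic_dir d x)`_k =
  if (k < d)%N then Complex (rVpoly x)`_k (rVpoly x)`_(d + k) else 0.
Proof. by rewrite coef_poly. Qed.

Lemma coef_rVpoly_linear a u v k :
  (rVpoly (a *: u + v))`_k = a * (rVpoly u)`_k + (rVpoly v)`_k.
Proof. by rewrite linearD linearZ coefD coefZ. Qed.

Lemma monic_dir_linear a u v :
  monic_dir d (a *: u + v) = a%:C%C *: monic_dir d u + monic_dir d v.
Proof.
apply/polyP => k; rewrite coefD coefZ !coef_monic_dir.
case: ifP => _; last by rewrite mulr0 addr0.
rewrite !coef_rVpoly_linear.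
by apply: complexP; rewrite ?cReD ?cImD ?cReM ?cImM /= ?mul0r ?subr0 ?addr0.
Qed.

Lemma monic_of_diff u v : monic_of d u - monic_of d v = monic_dir d (u - v).
Proof.
rewrite /monic_of opprD addrACA subrr add0r -/(monic_dir d u) -/(monic_dir d v).
have -> : u - v = (-1) *: v + u by rewrite scaleN1r addrC.
by rewrite monic_dir_linear rmorphN1 scaleN1r addrC.
Qed.

Lemma size_monic_dir x : (size (monic_dir d x) <= d)%N.
Proof. exact: size_poly. Qed.

Lemma size_monic_of x : size (monic_of d x) = d.+1.
Proof.
by rewrite /monic_of size_polyDl ?size_polyXn // ltnS size_poly.
Qed.

Lemma monic_of_monic x : monic_of d x \is monic.
Proof.
rewrite monicE lead_coefE size_monic_of coefD coefXn eqxx /=.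
by rewrite nth_default ?addr0 // size_poly.
Qed.

Lemma monic_dir_eq0 x : m = (2 * d).+1 -> monic_dir d x = 0 -> (rVpoly x)`_(2 * d) = 0 ->
  x = 0.
Proof.
move=> mE x0 s0; apply/rowP => k; rewrite mxE -coef_rVpoly_ord.
have e j : (j < d)%N -> (rVpoly x)`_j = 0 /\ (rVpoly x)`_(d + j) = 0.
  move=> jd; have := congr1 (fun p : {poly C} => p`_j) x0.
  by rewrite coef_monic_dir jd coef0 => -[-> ->].
have kd : (k <= 2 * d)%N by rewrite -ltnS -mE.
have [kd'|dk] := ltnP k d; first by have [] := e k kd'.
have [<-|k2] := eqVneq (2 * d)%N k; first by [].
by have [|_] := e (k - d)%N; rewrite ?subnKC //; lia.
Qed.

Definition in_disk : set 'rV[R]_m :=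
  [set x | forall z, root (monic_of d x) z -> normc z < 1].

(** If A and A' had a common root, the root and its antipode would both be roots
    of A, and one of them is outside of the open unit disk. *)
Lemma coprime_star x : in_disk x -> coprimep (monic_of d x) (star d (monic_of d x)).
Proof.
move=> xd; apply: Pdiv.ClosedField.root_coprimep => z /[dup] rz /xd z1.
(* the antipode of 0 is at infinity, where the monic A does not vanish *)
have [->|z0] := eqVneq z 0.
  rewrite horner_coef0 coef_star expr0 mul1r subn0.
  have /monicP := monic_of_monic x; rewrite lead_coefE size_monic_of => /= ->.
  by rewrite conjc1 oner_neq0.
rewrite horner_star ?size_monic_of // mulf_neq0 ?expf_neq0 ?oppr_eq0 //.
rewrite conjc_eq0; apply/negP => /xd w1.
have := normcM (- (conjc z)^-1) (conjc z).
rewrite mulNr mulVf ?conjc_eq0 // (_ : normc (- 1) = 1); last first.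
  by rewrite normcE2 /sqnorm /= oppr0 expr0n addr0 sqrrN expr1n sqrtr1.
have -> : normc (conjc z) = normc z by case: z {rz z1 z0 w1} => a b /=; rewrite sqrrN.
move=> e; have := ltr_pM (normc_ge0 _) (normc_ge0 _) w1 z1.
by rewrite -e mulr1 ltxx.
Qed.

(** The map [product_map] is trilinear in s, A and A', so its increments are
    linear in u - v, with the coefficients below; for u = v this is its
    differential. *)
Definition tangent_map (u v x : 'rV[R]_m) : {poly C} :=
  ((rVpoly x)`_(2 * d))%:C%C *: (monic_of d u * star d (monic_of d u)) +
  ((rVpoly v)`_(2 * d))%:C%C *: (monic_dir d x * star d (monic_of d u) +
                                 monic_of d v * star d (monic_dir d x)).

Lemma product_map_diff u v :
  product_map d u - product_map d v = tangent_map u v (u - v).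
Proof.
rewrite /tangent_map -monic_of_diff.
have -> : (rVpoly (u - v))`_(2 * d) = (rVpoly u)`_(2 * d) - (rVpoly v)`_(2 * d).
  by rewrite linearB coefB.
rewrite /product_map starB rmorphB /= -!mul_polyC rmorphB /=.
move: (monic_of d u) (monic_of d v) (star d _) (star d _) (_ %:P) (_ %:P) => a b c e s t.
by ring.
Qed.

Lemma tangent_map_linear u v a x y :
  tangent_map u v (a *: x + y) = a%:C%C *: tangent_map u v x + tangent_map u v y.
Proof.
rewrite /tangent_map coef_rVpoly_linear monic_dir_linear.
rewrite [star d (_ *: _ + _)]starD starZ conjc_real.
rewrite rmorphD rmorphM /= -!mul_polyC rmorphD rmorphM /=.
by ring.
Qed.

Lemma selfdual_mul_star p q : (size p <= d.+1)%N -> (size q <= d.+1)%N ->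
  selfdual d (p * star d q + q * star d p).
Proof.
move=> sp sq; have dd : (2 * d = d + d)%N by rewrite mul2n addnn.
have sz p1 q1 : (size p1 <= d.+1)%N -> (size (p1 * star d q1)%R <= (2 * d).+1)%N.
  move=> s1; rewrite (leq_trans (size_polyMleq _ _)) // dd.
  by rewrite -subn1 leq_subLR add1n -addSn -addnS leq_add // size_star.
split; first by rewrite (leq_trans (size_polyD _ _)) // geq_max !sz.
rewrite dd starD !starM ?size_star // !starK // -!scalerAr -scalerDr.
by rewrite addrC; congr (_ *: (_ + _)); exact: mulrC.
Qed.

Lemma selfdual_mul_self p : (size p <= d.+1)%N -> selfdual d (p * star d p).
Proof.
move=> sp; have := selfdualZ 2^-1 (selfdual_mul_star sp sp).
rewrite scalerDr -scalerDl (_ : _ + _ = 1) ?scale1r //.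
by apply: complexP => /=; field.
Qed.

Lemma selfdualD p q : selfdual d p -> selfdual d q -> selfdual d (p + q).
Proof.
move=> pd qd; have := selfdualB pd (selfdualZ (-1) qd).
by rewrite rmorphN1 scaleN1r opprK.
Qed.

Lemma selfdual_tangent u x : selfdual d (tangent_map u u x).
Proof.
apply: selfdualD; apply: selfdualZ.
  by apply: selfdual_mul_self; rewrite size_monic_of.
apply: selfdual_mul_star; first by rewrite (leq_trans (size_monic_dir x)).
by rewrite size_monic_of.
Qed.

(** The differential t A A' + s (a A' + A a') vanishes only for a = 0 and t = 0:
    A divides a A', hence a by coprimality, and a has smaller degree than A. *)
Lemma tangent_map_inj u x : m = (2 * d).+1 -> in_disk u -> (rVpoly u)`_(2 * d) != 0 ->
  tangent_map u u x = 0 -> x = 0.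
Proof.
move=> mE ud s0; rewrite /tangent_map.
set A := monic_of d u; set A' := star d A; set a := monic_dir d x.
set s := (rVpoly u)`_(2 * d); set t := (rVpoly x)`_(2 * d) => e.
have sC : s%:C%C != 0 :> C by rewrite (inj_eq (@complexI _)).
have Aa : A %| a * A'.
  rewrite -(dvdpZr _ _ sC).
  have -> : s%:C%C *: (a * A') = A * - (t%:C%C *: A' + s%:C%C *: star d a).
    apply/eqP; rewrite -subr_eq0 -e; apply/eqP; rewrite -!mul_polyC; ring.
  exact: dvdp_mulr.
have {}Aa : A %| a by rewrite -(Gauss_dvdpl _ (coprime_star ud)).
have a0 : a = 0.
  apply/eqP/negPn/negP => a0; have := dvdp_leq a0 Aa.
  by rewrite size_monic_of leqNgt ltnS size_monic_dir.
apply: monic_dir_eq0 => //.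
move: e; rewrite a0 mul0r add0r.
rewrite star0 mulr0 scaler0 addr0 => /eqP; rewrite scaler_eq0 (inj_eq (@complexI _)).
have A0 : A != 0 by rewrite -size_poly_eq0 size_monic_of.
have A'0 : A' != 0.
  apply: contraNneq A0 => A'0; have := starK (eq_leq (size_monic_of u)).
  rewrite -/A -/A' A'0 => /eqP; rewrite eq_sym.
  by rewrite star0 scaler_eq0 signr_eq0.
by rewrite mulf_eq0 (negPf A0) (negPf A'0) !orbF => /eqP.
Qed.

Lemma disk_gap_gt0 (rs : seq C) : all (fun w => normc w < 1) rs ->
  0 < \prod_(w <- rs) (1 - normc w).
Proof.
elim: rs => [|w rs IH] /=; first by rewrite big_nil.
by move=> /andP[w1 /IH]; rewrite big_cons => /(mulr_gt0 _); apply; rewrite subr_gt0.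
Qed.

Lemma normc_Complex_le (a b : R) : normc (Complex a b) <= `|a| + `|b|.
Proof.
rewrite /= -[leRHS]ger0_norm ?addr_ge0 // -sqrtr_sqr ler_sqrt ?sqr_ge0 //.
rewrite sqrrD !real_normK ?num_real // -addrA [_ *+ 2 + _]addrC addrA lerDl.
by rewrite mulrn_wge0 // mulr_ge0.
Qed.

Lemma normcX z k : normc (z ^+ k) = normc z ^+ k.
Proof. by elim: k => [|k IH]; rewrite ?normc1 // !exprS normcM IH. Qed.

(** Each factor satisfies |z - w| >= |z| - |w| >= (1 - |w|) |z| when |z| >= 1.
    *)
Lemma normc_prod_ge (rs : seq C) z : 1 <= normc z -> all (fun w => normc w < 1) rs ->
  (\prod_(w <- rs) (1 - normc w)) * normc z ^+ size rs <= normc (\prod_(w <- rs) (z - w)).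
Proof.
move=> z1; elim: rs => [|w rs IH] /=; first by rewrite !big_nil normc1 mulr1.
move=> /andP[w1 rs1]; have {}IH := IH rs1; rewrite !big_cons normcM exprS mulrACA.
apply: ler_pM => //.
- by rewrite mulr_ge0 ?normc_ge0 // subr_ge0 ltW.
- by rewrite mulr_ge0 ?exprn_ge0 ?normc_ge0 // ltW // disk_gap_gt0.
- rewrite mulrBl mul1r lerBlDr.
  have := le_normcD (z - w) w; rewrite subrK => /le_trans; apply.
  by rewrite lerD2l ler_peMr // normc_ge0.
Qed.

(** A perturbation of the lower coefficients changes the value at z, for |z| >=
    1, by at most delta |z|^d, which cannot compensate the lower bound of
    [normc_prod_ge]. This gives the only part of the continuity of roots that is
    used. *)
Lemma open_in_disk : open in_disk.
Proof.
rewrite openE => x0 x0d; rewrite /interior.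
have [rs A0E] := closed_field_poly_normal (monic_of d x0).
rewrite (monicP (monic_of_monic x0)) scale1r in A0E.
have szrs : size rs = d.
  by have := size_monic_of x0; rewrite A0E size_prod_XsubC => -[].
have rs1 : all (fun w => normc w < 1) rs.
  by apply/allP => w wrs; apply: x0d; rewrite A0E root_prod_XsubC.
pose c := \prod_(w <- rs) (1 - normc w).
have c0 : 0 < c by exact: disk_gap_gt0.
pose delta (x : 'rV[R]_m) := \sum_(k < d)
  (`|(rVpoly (x - x0))`_k| + `|(rVpoly (x - x0))`_(d + k)|).
have delta_c : \forall x \near x0, delta x < c.
  have cdelta : {for x0, continuous delta}.
    have cc k : {for x0, continuous (fun x => `|(rVpoly (x - x0))`_k|)}.
      apply: (@continuous_comp _ _ _ (fun x => (rVpoly (x - x0))`_k) Num.norm); last first.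
        exact: norm_continuous.
      have -> : (fun x => (rVpoly (x - x0))`_k) = (fun x => (rVpoly x)`_k - (rVpoly x0)`_k).
        by apply: funext => x; rewrite linearB coefB.
      by apply: continuousB; [exact: continuous_rVpoly|exact: cst_continuous].
    by apply: continuous_sum => k _; apply: continuousD; exact: cc.
  apply: (cvgr_lt _ cdelta).
  by rewrite /delta big1 // => k _; rewrite subrr linear0 !coef0 normr0 addr0.
apply: filterS delta_c => x xc z rz; rewrite ltNge; apply/negP => z1.
have dE : (monic_of d x0).[z] = - (monic_dir d (x - x0)).[z].
  by rewrite -monic_of_diff (hornerD (monic_of d x)) hornerN (rootP rz) sub0r opprK.
have le1 : c * normc z ^+ d <= normc (monic_of d x0).[z].
  rewrite A0E horner_prod -{1}szrs (eq_bigr _ (fun w _ => hornerXsubC w z)).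
  exact: normc_prod_ge.
have le2 : normc (monic_of d x0).[z] <= delta x * normc z ^+ d.
  rewrite dE normcN horner_poly /delta mulr_suml.
  elim/big_ind2: _ => [|u1 u2 v1 v2 uv1 uv2|k _]; first by rewrite normc0.
    by rewrite (le_trans (le_normcD _ _)) // lerD.
  rewrite normcM normcX ler_pM ?normc_ge0 ?exprn_ge0 ?normc_ge0 //.
    exact: normc_Complex_le.
  by rewrite ler_weXn2l // ltnW.
have := le_trans le1 le2; rewrite ler_pM2r ?leNgt ?xc //.
by rewrite exprn_gt0 // (lt_le_trans _ z1).
Qed.

End MonicLemmas.

(** Any continuous right inverse of the map (A, s) |-> s A A' is smooth:
    [product_map_diff] and [tangent_map_inj] provide the hypotheses of
    [smooth_inverse]. *)
Lemma smooth_product_inverse d (N := (2 * d + 1)%N) (W : set 'rV[R]_N)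
    (h : 'rV[R]_N -> 'rV[R]_N) :
  open W -> (forall x, W x -> {for x, continuous h}) ->
  (forall x, W x -> [/\ in_disk d (h x), (rVpoly (h x))`_(2 * d) != 0 &
                        enc N (product_map d (h x)) = x]) ->
  forall j, smooth W (fun x => h x 0 j).
Proof.
move=> oW ch hW.
pose T (u v x : 'rV[R]_N) := enc N (tangent_map d u v x).
have Tlin u v : linear (T u v).
  by move=> a x y; rewrite /T tangent_map_linear encD encZ.
pose M u v : 'M[R]_N := lin1_mx (T u v).
have ME u v x : x *m M u v = enc N (tangent_map d u v x).
  pose TM := GRing.isLinear.Build _ _ _ _ _ (Tlin u v).
  pose TL : {linear 'rV[R]_N -> 'rV[R]_N} := HB.pack (T u v) TM.
  by rewrite (mul_rV_lin1 TL).
have smM (f g : 'rV[R]_N -> 'rV[R]_N) i j :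
    (forall k, smooth setT (fun x => (rVpoly (g x))`_k)) ->
    regularP (smooth setT) (fun x => monic_of d (f x)) ->
    regularP (smooth setT) (fun x => monic_of d (g x)) ->
    smooth setT (fun x => M (f x) (g x) i j).
  move=> sg sf sg'; have algT := smooth_subalgebra (@openT 'rV[R]_N).
  have st : regularP (smooth setT) (fun x => star d (monic_of d (f x))).
    exact: regularP_star.
  have sM : regularP (smooth setT) (fun x => tangent_map d (f x) (g x) (delta_mx 0 i)).
    apply: regularP_add => //; apply: regularP_scale => //.
    - exact: regularC_cst.
    - exact: regularP_mul.
    - exact: regularC_real.
    - by apply: regularP_add => //; apply: regularP_mul => //; exact: regularP_cst.
  apply: eq_smooth (regular_enc algT j sM); first exact: openT.
  by move=> x _; rewrite /M [RHS]mxE.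
have smid : regularP (smooth setT) (fun x : 'rV[R]_N => monic_of d x).
  exact: smooth_monic_of openT d.
apply: (@smooth_inverse _ _ W h M) => //.
- move=> x y /hW[_ _ {1}<-] /hW[_ _ {1}<-].
  by rewrite ME -product_map_diff encB.
- move=> i j v u; apply: (@smooth_continuous _ _ setT) => //.
  apply: (smM id (fun=> v)) => //.
    by move=> k; exact: smooth_cst.
  by apply: regularP_cst; exact: smooth_subalgebra openT.
- by move=> i j; apply: (smM id id) => // k; exact: smooth_rVpoly openT.
- move=> x /hW[hd s0 _]; apply/det0P => -[v /eqP v0].
  rewrite ME => e; apply: v0.
  have NE : N = (2 * d).+1 by rewrite /N addn1.
  apply: (tangent_map_inj NE hd s0); apply: (enc_eq0 _ (selfdual_tangent _ _ _) e).
  by rewrite NE.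
Qed.
End ChartInverse.

(** * The form of a family of vectors *)

Section ProductMap.
Variables (R : realType) (d : nat).
Local Notation C := R[i].
Local Notation N1 := (2 * d).+1.
Local Notation vectors := (power (punctured R 3) d).
Implicit Types (v w : vectors) (F : 'M[R]_3).

Lemma punctured_neq0 n (x : punctured R n) : val x != 0.
Proof. exact: set_mem (valP x). Qed.

Definition prodq v : {poly C} := \prod_i quad (val (v i)).

Definition total_norm v : R := \prod_i enorm (val (v i)).

Lemma total_norm_gt0 v : 0 < total_norm v.
Proof. by apply: prodr_gt0 => i _; rewrite enorm_gt0 punctured_neq0. Qed.

Lemma prodq_seq v : prodq v = \prod_(y <- [seq val (v i) | i <- enum 'I_d]) quad y.
Proof. by rewrite big_map /prodq big_enum. Qed.

Lemma selfdual_prodq v : selfdual d (prodq v).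
Proof.
have := selfdual_quad_prod [seq val (v i) | i <- enum 'I_d].
by rewrite size_map size_enum_ord prodq_seq.
Qed.

Lemma prodq_neq0 v : prodq v != 0.
Proof. by apply/prodf_neq0 => i _; rewrite quad_eq0 punctured_neq0. Qed.

Lemma enc_neq0 (p : {poly C}) : selfdual d p -> p != 0 -> enc N1 p != 0.
Proof.
by move=> pd; apply: contraNneq => e; apply/eqP; apply: (enc_eq0 _ pd e).
Qed.

(** The product of the quadratics of the vectors, in real coordinates, rescaled
    so that its norm is the product of the norms of the vectors. The rescaling
    is what makes the map compatible with [multipole_fibre]. In a chart the
    product is a real multiple of A A', where A has the coordinates z_i of the
    lines as roots, and without rescaling the multiple would be the fibre
    coordinate divided by the product of the (1 + |z_i|^2) / 2. The latter is
    not smooth in the coefficients of A: for d = 2 it involves |z_1 - z_2|^2,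
    the modulus of the discriminant. *)
Definition form v : 'rV[R]_N1 :=
  (total_norm v / eucl (enc N1 (prodq v))) *: enc N1 (prodq v).

Lemma enc_prodq_gt0 v : 0 < eucl (enc N1 (prodq v)).
Proof. by rewrite eucl_gt0 enc_neq0 ?prodq_neq0 //; exact: selfdual_prodq. Qed.

Lemma eucl_form v : eucl (form v) = total_norm v.
Proof.
have e0 := enc_prodq_gt0 v; have t0 := total_norm_gt0 v.
by rewrite euclZ ger0_norm ?divr_ge0 ?ltW // divfK // gt_eqF.
Qed.

Lemma form_neq0 v : form v != 0.
Proof. by rewrite -eucl_gt0 eucl_form total_norm_gt0. Qed.

Definition scale_prod (l : 'I_d -> Rstar R) : R := \prod_i val (l i).

Lemma prodq_rescale l v : prodq (rescale l v) = (scale_prod l)%:C%C *: prodq v.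
Proof.
rewrite /prodq /scale_prod rmorph_prod -[RHS]scaler_prod; apply: eq_bigr => i _.
by rewrite scale_val quadZ.
Qed.

Lemma total_norm_rescale l v : total_norm (rescale l v) = `|scale_prod l| * total_norm v.
Proof.
rewrite /total_norm /scale_prod normr_prod -big_split; apply: eq_bigr => i _.
by rewrite scale_val enormZ.
Qed.

Lemma scale_prod_neq0 l : scale_prod l != 0.
Proof. by apply/prodf_neq0 => i _; exact: (valP (l i)). Qed.

Lemma form_rescale l v : form (rescale l v) = scale_prod l *: form v.
Proof.
have l0 := scale_prod_neq0 l; have e0 := enc_prodq_gt0 v.
rewrite /form prodq_rescale encZ euclZ total_norm_rescale !scalerA; congr (_ *: _).
field; rewrite normr_eq0 l0 gt_eqF //.
Qed.

Lemma prodq_permute s v : prodq (permute s v) = prodq v.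
Proof. by rewrite /prodq [RHS](reindex_inj (@perm_inj _ s)). Qed.

Lemma form_permute s v : form (permute s v) = form v.
Proof.
rewrite /form prodq_permute; congr ((_ / _) *: _).
by rewrite /total_norm [RHS](reindex_inj (@perm_inj _ s)).
Qed.

Lemma form_Sigma g : (@Hd R d `|` range (@permute (punctured R 3) d)) g ->
  forall v, form (g v) = form v.
Proof.
move=> [[l l1 <-]|[s _ <-]] v; last exact: form_permute.
by rewrite form_rescale (l1 : scale_prod l = 1) scale1r.
Qed.

Lemma form_lines v w (a : R) : form v = a *: form w ->
  exists s l, v = rescale l (permute s w).
Proof.
move=> e.
have a0 : a != 0 by apply: contraNneq (form_neq0 v) => a0; rewrite e a0 scale0r.
have : perm_eq [seq line (v i) | i <- enum 'I_d] [tuple line (w i) | i < d].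
  change (perm_eq [seq line (v i) | i <- enum 'I_d] [seq line (w i) | i <- enum 'I_d]).
  have mapE (u : vectors) : [seq line (u i) | i <- enum 'I_d] =
      [seq line x | x <- [seq u i | i <- enum 'I_d]] by exact: (map_comp (@line R 2) u).
  rewrite !mapE.
  pose cv := total_norm v / eucl (enc N1 (prodq v)).
  pose cw := total_norm w / eucl (enc N1 (prodq w)).
  have cv0 : cv != 0 by rewrite gt_eqF // divr_gt0 ?total_norm_gt0 ?enc_prodq_gt0.
  have cw0 : cw != 0 by rewrite gt_eqF // divr_gt0 ?total_norm_gt0 ?enc_prodq_gt0.
  have acw0 : a * cw != 0 by rewrite mulf_neq0.
  apply: (quad_prod_lines cv0 acw0); last by rewrite !size_map.
  have prodE (u : vectors) :
      \prod_(x <- [seq u i | i <- enum 'I_d]) quad (val x) = prodq u.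
    by rewrite big_map /prodq big_enum.
  rewrite !prodE.
  apply: (@enc_inj _ d N1) => //; try by apply: selfdualZ; exact: selfdual_prodq.
  by rewrite !encZ -scalerA.
move=> /tuple_permP[s sE].
have vw i : line (v i) = line (w (s i)).
  have := congr1 (fun t => nth (line (v i)) t i) sE.
  rewrite (nth_map i) ?size_enum_ord // nth_ord_enum => ->.
  by rewrite -tnth_nth !tnth_mktuple.
have /choice[l lE] : forall i, exists l : Rstar R, val (v i) = val l *: val (w (s i)).
  by move=> i; apply/line_eq.
by exists s, l; apply: funext => i; apply: val_inj; rewrite scale_val lE.
Qed.

End ProductMap.

(** * Multipoles and nonzero forms *)

Section Continuity.
Variable R : realType.
Local Notation C := R[i].

Fact const_mx1_neq0 n : (const_mx 1 : 'rV[R]_n.+1) \in [set v : 'rV[R]_n.+1 | v != 0].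
Proof.
apply: mem_set => /=; apply/eqP => /rowP/(_ 0); rewrite !mxE => /eqP.
by rewrite oner_eq0.
Qed.

Definition to_punctured n (x : 'rV[R]_n.+1) : punctured R n.+1 :=
  insubd (Sub (const_mx 1) (const_mx1_neq0 n) : punctured R n.+1) x.

Lemma to_puncturedK n (x : 'rV[R]_n.+1) : x != 0 -> val (to_punctured x) = x.
Proof. by move=> x0; rewrite val_insubd mem_set. Qed.

Lemma val_to_punctured n (x : punctured R n.+1) : to_punctured (val x) = x.
Proof. by apply: val_inj; rewrite to_puncturedK // punctured_neq0. Qed.

Lemma continuous_eucl n : continuous (@eucl R n).
Proof.
move=> x; apply: (@continuous_comp _ _ _ (fun x : 'rV[R]_n => \sum_i x 0 i ^+ 2)).
  apply: continuous_sum => i _.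
  apply: (@continuous_comp _ _ _ (fun x : 'rV[R]_n => x 0 i) (fun t => t ^+ 2)).
    exact: coord_continuous.
  exact: exprn_continuous.
exact: sqrt_continuous.
Qed.

Lemma continuous_set_coord n (A : set 'rV[R]_n) j :
  continuous (fun x : set_type A => val x 0 j).
Proof.
move=> x; apply: (@continuous_comp _ _ _ (fun x : set_type A => val x) (fun y : 'rV[R]_n => y 0 j)).
  exact: set_val_continuous.
exact: coord_continuous.
Qed.

Lemma continuous_set_eucl n (A : set 'rV[R]_n) :
  continuous (fun x : set_type A => eucl (val x)).
Proof.
move=> x; apply: (@continuous_comp _ _ _ (fun x : set_type A => val x) (@eucl R n)).
  exact: set_val_continuous.
exact: continuous_eucl.
Qed.

Lemma open_coord_neq0 n (i : 'I_n) : open [set x : 'rV[R]_n | x 0 i != 0].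
Proof.
apply: (@open_comp _ _ (fun x : 'rV[R]_n => x 0 i) [set t | t != 0]); last exact: open_neq.
by move=> x _; exact: coord_continuous.
Qed.

Lemma open_neq0 n : open [set x : 'rV[R]_n | x != 0].
Proof.
rewrite (_ : [set x | _] = @eucl R n @^-1` [set t | t != 0]).
  by apply: open_comp; [move=> x _; exact: continuous_eucl|exact: open_neq].
by apply/seteqP; split=> x /=; rewrite -eucl_gt0 lt_neqAle eucl_ge0 andbT eq_sym.
Qed.

Lemma continuous_to_punctured n (x : 'rV[R]_n.+1) : x != 0 ->
  {for x, continuous (@to_punctured n)}.
Proof.
move=> x0; apply: continuous_set_type.
move=> U; rewrite /= to_puncturedK // => Ux.
have : \forall t \near x, t != 0 by exact: open_nbhs_nbhs (conj (@open_neq0 n.+1) x0).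
by apply: filterS2 Ux => t Ut t0; rewrite /= to_puncturedK.
Qed.

Lemma compact_annulus n (a b : R) : 0 < a ->
  compact [set u : punctured R n.+1 | a <= eucl (val u) <= b].
Proof.
move=> a0; pose A := [set x : 'rV[R]_n.+1 | a <= eucl x <= b].
have cA : compact A.
  apply: bounded_closed_compact.
    exists b; split; first exact: num_real.
    move=> M bM x /andP[_ xb]; rewrite /Num.Def.normr /= mx_normrE.
    apply: bigmax_le => [|[i j] _ /=].
      by rewrite (le_trans _ (ltW bM)) // (le_trans _ xb) // eucl_ge0.
    by rewrite ord1 (le_trans (coord_le_eucl x j)) // (le_trans xb) // ltW.
  rewrite (_ : A = @eucl R n.+1 @^-1` `[a, b]%classic); last first.
    by apply/seteqP; split=> x; rewrite /A /= in_itv.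
  apply: closed_comp; last exact: interval_closed.
  by move=> x _; exact: continuous_eucl.
rewrite (_ : [set u | _] = @to_punctured n @` A).
  apply: continuous_compact cA.
  apply: continuous_in_subspaceT => x; rewrite inE => /andP[ax _].
  by apply: continuous_to_punctured; rewrite -eucl_gt0 (lt_le_trans a0).
apply/seteqP; split=> [u /= au|_ [x xA <-]].
  by exists (val u); rewrite ?val_to_punctured.
rewrite /= to_puncturedK //; case/andP: xA => ax _.
by rewrite -eucl_gt0 (lt_le_trans a0).
Qed.

Lemma open_continuous_preimage (X Y : topologicalType) (E : set X) (V : set Y) (f : X -> Y) :
  open E -> (forall x, E x -> {for x, continuous f}) -> open V -> open (E `&` f @^-1` V).
Proof.
move=> oE cf oV; rewrite openE => x [Ex Vx]; rewrite /interior; apply: filterI.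
  exact: open_nbhs_nbhs.
by apply: (cf x Ex); exact: open_nbhs_nbhs.
Qed.

Lemma orbit_continuous_on (T Z : topologicalType) (S : set (T -> T))
    (bijS : S `<=` bijections) (A : set (orbit_space bijS)) (f : orbit_space bijS -> Z) :
  open A ->
  (forall v, A (\pi_(orbit_space bijS) v) ->
     {for v, continuous (f \o \pi_(orbit_space bijS))}) ->
  forall m, A m -> {for m, continuous f}.
Proof.
move=> oA cf m Am U; rewrite nbhsE; case=> V [oV Vfm] VU.
have : nbhs m (A `&` f @^-1` V).
  apply: open_nbhs_nbhs; split=> //; apply: orbit_open.
  apply: (@open_continuous_preimage _ _ (\pi_(orbit_space bijS) @^-1` A) V
    (f \o \pi_(orbit_space bijS))) => //.
by apply: filterS => x [_ /VU].
Qed.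

Lemma continuous_prod_pair (X Y Z : topologicalType) (f : X -> Y) (g : X -> Z) x :
  {for x, continuous f} -> {for x, continuous g} -> {for x, continuous (fun t => (f t, g t))}.
Proof. by move=> cf cg; exact: cvg_pair. Qed.

End Continuity.

Section ProductMapTopology.
Variables (R : realType) (d : nat).
Hypothesis hd : (0 < d)%N.
Local Notation C := R[i].
Local Notation N1 := (2 * d).+1.
Local Notation vectors := (power (punctured R 3) d).
Implicit Types (v w : vectors) (F : 'M[R]_3).

Lemma vector_continuous i j : continuous (fun v : vectors => val (v i) 0 j).
Proof.
move=> v; apply: (@continuous_comp _ _ _ (fun v : vectors => v i)
  (fun x : punctured R 3 => val x 0 j)); first exact: power_coord_continuous.
exact: continuous_set_coord.
Qed.

Lemma enorm_vector_continuous i : continuous (fun v : vectors => enorm (val (v i))).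
Proof.
move=> v; apply: (@continuous_comp _ _ _ (fun v : vectors => v i)
  (fun x : punctured R 3 => eucl (val x))); first exact: power_coord_continuous.
exact: continuous_set_eucl.
Qed.

Lemma form_continuous : continuous (@form R d).
Proof.
move=> v.
have rq : regularP (fun f : vectors -> R => {for v, continuous f}) (@prodq R d).
  apply: regularP_prod; first exact: continuous_subalgebra.
  move=> i; apply: regularP_quad => [|j]; first exact: continuous_subalgebra.
  exact: vector_continuous.
have ce : {for v, continuous (fun v => enc N1 (prodq v))}.
  by apply: continuous_mx => i j; rewrite ord1; apply: regular_enc => //;
     exact: continuous_subalgebra.
apply: continuous_mx => i j; rewrite ord1.
have -> : (fun w => form w 0 j) = (fun w => (total_norm w * (eucl (enc N1 (prodq w)))^-1) *
    enc N1 (prodq w) 0 j) by apply: funext => w; rewrite /form mxE.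
apply: continuousM; last first.
  by apply: regular_enc => //; exact: continuous_subalgebra.
apply: continuousM.
  by apply: continuous_prod => k _; exact: enorm_vector_continuous.
apply: continuousV; first by rewrite gt_eqF // enc_prodq_gt0.
apply: (@continuous_comp _ _ _ (fun w => enc N1 (prodq w)) (@eucl R N1)) => //.
exact: continuous_eucl.
Qed.

Definition punctured_form v : punctured R N1 := Sub (form v) (mem_set (form_neq0 v)).

Lemma punctured_form_continuous : continuous punctured_form.
Proof. by move=> v; apply: continuous_set_type; exact: form_continuous. Qed.

Lemma scale_prod_at (j : 'I_d) (a : Rstar R) :
  scale_prod (fun i : 'I_d => if i == j :> nat then a else rstar1 R) = val a.
Proof.
rewrite /scale_prod (bigD1 j) //= eqxx big1 ?mulr1 // => i ij.
by rewrite val_eqE (negPf ij).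
Qed.

Lemma form_scale_at (j : 'I_d) (a : Rstar R) v : form (scale_at j a v) = val a *: form v.
Proof. by rewrite /scale_at form_rescale scale_prod_at. Qed.

Let i0 : 'I_d := Ordinal hd.

Lemma unit_dir_neq0 (z : C) : (enorm (dir z))^-1 *: dir z \in [set x : 'rV[R]_3 | x != 0].
Proof.
have d0 := dir_neq0 z; apply: mem_set.
by rewrite /= scaler_eq0 invr_eq0 negb_or d0 andbT gt_eqF // enorm_gt0.
Qed.

Definition unit_dir (z : C) : punctured R 3 :=
  Sub ((enorm (dir z))^-1 *: dir z) (unit_dir_neq0 z).

Lemma enorm_unit_dir z : enorm (val (unit_dir z)) = 1.
Proof.
have n0 : 0 < enorm (dir z) by rewrite enorm_gt0 dir_neq0.
by rewrite /= enormZ ger0_norm ?invr_ge0 ?ltW // mulVf // gt_eqF.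
Qed.

(** Surjectivity by Sylvester's theorem. The vectors are chosen of norm 1, so
    that they range over a compact set; a negative factor is absorbed by one of
    them. *)
Lemma unit_surj (p : 'rV[R]_N1) : p != 0 ->
  exists2 v, (forall i, enorm (val (v i)) = 1) & p = eucl p *: form v.
Proof.
move=> p0.
have P0 : dec d p != 0 by rewrite dec_eq0.
have [s [zs [s0 szs PE]]] := sylvester (selfdual_dec d p) P0.
pose v : vectors := fun i => unit_dir (nth 0 zs i).
have v1 i : enorm (val (v i)) = 1 by exact: enorm_unit_dir.
have total1 : total_norm v = 1 by rewrite /total_norm big1.
pose c := \prod_(i < d) (enorm (dir (nth 0 zs i)))^-1.
have c0 : c != 0.
  by apply/prodf_neq0 => i _; rewrite invr_eq0 gt_eqF // enorm_gt0 dir_neq0.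
have vE : prodq v = c%:C%C *: \prod_(z <- zs) quad (dir z).
  rewrite (big_nth 0) szs big_mkord /c rmorph_prod -[RHS]scaler_prod.
  by apply: eq_bigr => i _; rewrite -quadZ.
have e0 := enc_prodq_gt0 v.
pose a := s / c * eucl (enc N1 (prodq v)).
have pE : p = a *: form v.
  rewrite /form total1 scalerA -[LHS](encK p (erefl N1)) PE /a.
  have -> : \prod_(z <- zs) quad (dir z) = (c^-1)%:C%C *: prodq v.
    by rewrite vE scalerA -rmorphM mulVf // scale1r.
  rewrite scalerA -rmorphM encZ; congr (_ *: _).
  by rewrite div1r mulfK // gt_eqF.
have aE : eucl p = `|a| by rewrite pE euclZ eucl_form total1 mulr1.
have [a0|a0] := leP 0 a; first by exists v => //; rewrite aE ger0_norm.
have N10 : -1 != 0 :> R by rewrite oppr_eq0 oner_eq0.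
pose m1 : Rstar R := Sub (-1) N10.
exists (scale_at i0 m1 v).
  move=> i; rewrite /scale_at /rescale scale_val enormZ v1 mulr1.
  by case: ifP => _ /=; rewrite ?normrN normr1.
by rewrite form_scale_at /= scalerA aE ltr0_norm // mulrN1 opprK.
Qed.

(** The norm of the form is carried by one vector, which bounds the norms of all
    of the vectors in terms of that of p. *)
Lemma form_lift (p : 'rV[R]_N1) : p != 0 ->
  exists2 v, form v = p & forall i, enorm (val (v i)) = 1 \/ enorm (val (v i)) = eucl p.
Proof.
move=> p0; have [v v1 pE] := unit_surj p0.
have ep0 : eucl p != 0 by rewrite gt_eqF // eucl_gt0.
exists (scale_at i0 (Sub (eucl p) ep0 : Rstar R) v); first by rewrite form_scale_at.
move=> i; rewrite /scale_at /rescale scale_val enormZ v1 mulr1.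
by case: ifP => _ /=; [right; rewrite ger0_norm ?eucl_ge0|left; rewrite normr1].
Qed.

Definition form_of (m : multipole R d) : punctured R N1 := punctured_form (repr m).

Lemma form_ofE v : form_of (\pi_(multipole R d) v) = punctured_form v.
Proof.
apply: val_inj => /=.
exact: (@invariant_repr _ _ (@Sigma_bij R d) _ (@form R d) (@form_Sigma R d)).
Qed.

Lemma form_of_continuous : continuous form_of.
Proof.
apply: orbit_continuous; rewrite (_ : _ \o _ = punctured_form); first exact: punctured_form_continuous.
by apply: funext => v /=; exact: form_ofE.
Qed.

Lemma punctured_form_surj (p : punctured R N1) : exists v, punctured_form v = p.
Proof.
have [v vE _] := form_lift (punctured_neq0 p).
by exists v; apply: val_inj.
Qed.

(** Inverse of [form_of]. The representative is chosen without any continuity,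
    which is recovered on the quotient by [continuous_of_compact_lifts]. *)
Definition multipole_of (p : punctured R N1) : multipole R d :=
  \pi_(multipole R d) (projT1 (cid (punctured_form_surj p))).

Lemma pi_rescale1 l v : scale_prod l = 1 ->
  \pi_(multipole R d) (rescale l v) = \pi_(multipole R d) v.
Proof. by move=> l1; apply: orbit_pi_gen; left; exists l. Qed.

Lemma pi_permute s v : \pi_(multipole R d) (permute s v) = \pi_(multipole R d) v.
Proof. by apply: orbit_pi_gen; right; exists s. Qed.

Lemma form_inj v w : form v = form w -> \pi_(multipole R d) v = \pi_(multipole R d) w.
Proof.
move=> e; have [|s [l vE]] := @form_lines _ _ v w 1; first by rewrite scale1r.
have l1 : scale_prod l = 1.
  have : (scale_prod l - 1) *: form w = 0.
    by rewrite scalerBl scale1r -{2}e vE form_rescale form_permute subrr.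
  by move=> /eqP; rewrite scaler_eq0 (negPf (form_neq0 w)) orbF subr_eq0 => /eqP.
by rewrite vE pi_rescale1 // pi_permute.
Qed.

Lemma multipole_ofE v : multipole_of (punctured_form v) = \pi_(multipole R d) v.
Proof.
by rewrite /multipole_of; case: cid => w /= /(congr1 val) /= /form_inj.
Qed.

Lemma multipole_ofK : cancel multipole_of form_of.
Proof. by move=> p; rewrite /multipole_of; case: cid => v /= <-; rewrite form_ofE. Qed.

Lemma form_ofK : cancel form_of multipole_of.
Proof. by move=> m; rewrite /form_of multipole_ofE reprK. Qed.

Lemma punctured_hausdorff n : hausdorff_space (punctured R n).
Proof. exact/set_type_hausdorff/norm_hausdorff. Qed.

(** Forms close to y lift to vectors in a fixed annulus, by [form_lift]. *)
Lemma multipole_of_continuous : continuous multipole_of.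
Proof.
apply: (@continuous_of_compact_lifts vectors _ _ punctured_form (\pi_(multipole R d))).
- exact: punctured_hausdorff.
- exact: punctured_form_continuous.
- exact: orbit_pi_continuous.
- exact: multipole_ofE.
move=> y; pose r := eucl (val y).
have r0 : 0 < r by rewrite eucl_gt0 punctured_neq0.
(* 1 is the norm of all vectors of [form_lift] but one, whose norm is close to r *)
pose a := Num.min 1 (r / 2); pose b := Num.max 1 (2 * r).
have a0 : 0 < a by rewrite lt_min ltr01 divr_gt0.
exists [set v : vectors | forall i, [set u : punctured R 3 | a <= eucl (val u) <= b] (v i)].
  by apply: compact_power; exact: compact_annulus.
have cr : {for y, continuous (fun y' : punctured R N1 => eucl (val y'))}.
  exact: continuous_set_eucl.
have r1 : \forall y' \near y, r / 2 < eucl (val y').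
  by apply: (cvgr_gt _ cr); rewrite ltr_pdivrMr // mulr_natr mulr2n ltrDr.
have r2 : \forall y' \near y, eucl (val y') < 2 * r.
  by apply: (cvgr_lt _ cr); rewrite mulr_natl mulr2n ltrDr.
apply: filterS2 r1 r2 => y' y1 y2.
have [v vE vn] := form_lift (punctured_neq0 y').
exists v; last exact: val_inj.
move=> i; change (a <= enorm (val (v i)) <= b).
have [->|->] := vn i; rewrite ge_min le_max ?lexx //.
by rewrite (ltW y1) (ltW y2) !orbT.
Qed.

End ProductMapTopology.

(** * The collapsed line bundle *)

Section CollapsedBundle.
Variables (R : realType) (d : nat).
Hypothesis hd : (0 < d)%N.
Local Notation N1 := (2 * d).+1.
Local Notation vectors := (power (punctured R 3) d).
Local Notation multipole := (multipole R d).
Local Notation line_bundle := (line_bundle R d).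
Local Notation multipole_bar := (multipole_bar R d).
Let i0 : 'I_d := Ordinal hd.

Lemma form_of_act l (m : multipole) : val (form_of (act l m)) = val l *: val (form_of m).
Proof. by rewrite /act form_ofE /= (form_scale_at i0). Qed.

(** The bijection between multipoles and nonzero forms is equivariant, hence
    extends to the line bundle, where it sends the whole zero section to 0. *)
Definition bundle_map (x : multipole * R) : 'rV[R]_N1 := x.2 *: val (form_of x.1).

Lemma bundle_map_twist l x : bundle_map (twist l x) = bundle_map x.
Proof.
rewrite /bundle_map (_ : val (form_of (twist l x).1) = val l *: val (form_of x.1)); last first.
  exact: form_of_act.
rewrite scalerA (_ : (twist l x).2 * val l = x.2) //=.
by rewrite mulrAC mulVf ?mul1r // (valP l).
Qed.

Lemma bundle_map_repr x : bundle_map (repr (\pi_line_bundle x)) = bundle_map x.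
Proof.
apply: (@invariant_repr _ _ (@twist_bij R d) _ bundle_map) => _ [l _ <-] y.
exact: bundle_map_twist.
Qed.

Definition bar_map (x : multipole_bar) : 'rV[R]_N1 := bundle_map (repr (repr x)).

Lemma bar_mapE x : bar_map (\pi_multipole_bar (\pi_line_bundle x)) = bundle_map x.
Proof.
rewrite -bundle_map_repr /bar_map.
have /eqmodP/asboolP := reprK (\pi_multipole_bar (\pi_line_bundle x)).
case=> [->//|[[m _ mE] [m' _ m'E]]].
have zero (n : multipole) : bundle_map (repr (\pi_line_bundle (n, 0))) = 0.
  by rewrite bundle_map_repr /bundle_map scale0r.
by rewrite -mE -m'E !zero.
Qed.

Lemma bundle_map_continuous : continuous bundle_map.
Proof.
move=> x; apply: continuous_mx => i j; rewrite ord1.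
have -> : (fun t => bundle_map t 0 j) = (fun t => t.2 * val (form_of t.1) 0 j).
  by apply: funext => t; rewrite mxE.
apply: continuousM; first exact: cvg_snd.
apply: (@continuous_comp _ _ _ (fun t : multipole * R => form_of t.1)
  (fun y : punctured R N1 => val y 0 j)); last exact: continuous_set_coord.
apply: (@continuous_comp _ _ _ (fun t : multipole * R => t.1) (@form_of R d)).
  exact: cvg_fst.
exact: form_of_continuous.
Qed.

Lemma bar_map_continuous : continuous bar_map.
Proof.
apply/quotient_continuous; apply: orbit_continuous.
rewrite (_ : (bar_map \o _) \o _ = bundle_map); first exact: bundle_map_continuous.
by apply: funext => x /=; exact: bar_mapE.
Qed.

Definition bar_inv (p : 'rV[R]_N1) : multipole_bar :=
  \pi_multipole_bar (\pi_line_bundle (multipole_of hd (to_punctured p), (p != 0)%:R)).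

Definition bar_pi (x : vectors * R) : multipole_bar :=
  \pi_multipole_bar (\pi_line_bundle (\pi_multipole x.1, x.2)).

Lemma zero_section_eq (m m' : multipole) :
  \pi_multipole_bar (\pi_line_bundle (m, 0)) = \pi_multipole_bar (\pi_line_bundle (m', 0)).
Proof. by apply/eqmodP/asboolP; right; split; [exists m|exists m']. Qed.

Lemma bar_invE v t : bar_inv (t *: form v) = bar_pi (v, t).
Proof.
rewrite /bar_inv /bar_pi scaler_eq0 (negPf (form_neq0 v)) orbF /=.
have [->|t0] := eqVneq t 0; first exact: zero_section_eq.
congr (\pi _); pose l : Rstar R := Sub t t0.
have -> : to_punctured (t *: form v) = punctured_form (scale_at i0 l v).
  apply: val_inj; rewrite to_puncturedK; last by rewrite scaler_eq0 negb_or t0 form_neq0.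
  by rewrite /= (form_scale_at i0).
rewrite multipole_ofE -(act_pi i0 l v).
rewrite (_ : (act l _, _) = twist l (\pi_multipole v, t)); last first.
  by rewrite /twist /= mulVf.
by apply: orbit_pi_gen; exists l.
Qed.

Lemma bar_pi_surj x : exists y, x = bar_pi y.
Proof.
pose y := repr (repr x); exists (repr y.1, y.2).
by rewrite /bar_pi /= reprK -surjective_pairing !reprK.
Qed.

Lemma pair_pi_continuous :
  continuous (fun x : vectors * R => (\pi_multipole x.1, x.2)).
Proof.
move=> x; apply: (@continuous_prod_pair _ _ _ (fun x : vectors * R => \pi_multipole x.1)
  (fun x : vectors * R => x.2)); last exact: cvg_snd.
apply: (@continuous_comp _ _ _ (fun x : vectors * R => x.1) (\pi_multipole)).
  exact: cvg_fst.
exact: orbit_pi_continuous.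
Qed.

Lemma bar_pi_continuous : continuous bar_pi.
Proof.
move=> x.
apply: (@continuous_comp _ _ _ (fun x : vectors * R => \pi_line_bundle (\pi_multipole x.1, x.2))
  (\pi_multipole_bar)); last exact: pi_continuous.
apply: (@continuous_comp _ _ _ (fun x : vectors * R => (\pi_multipole x.1, x.2))
  (\pi_line_bundle)); last exact: orbit_pi_continuous.
exact: pair_pi_continuous.
Qed.

(** Continuity also at the vertex 0: every form, zero included, lifts to unit
    vectors and a scalar bounded by its norm. *)
Lemma bar_inv_continuous : continuous bar_inv.
Proof.
pose f (x : vectors * R) : 'rV[R]_N1 := x.2 *: form x.1.
apply: (@continuous_of_compact_lifts _ _ _ f bar_pi).
- exact: norm_hausdorff.
- rewrite (_ : f = (fun x => bundle_map (\pi_multipole x.1, x.2))); last first.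
    by apply: funext => x; rewrite /f /bundle_map form_ofE.
  move=> x; apply: (@continuous_comp _ _ _ (fun x : vectors * R => (\pi_multipole x.1, x.2))
    bundle_map); last exact: bundle_map_continuous.
  exact: pair_pi_continuous.
- exact: bar_pi_continuous.
- by case=> v t; exact: bar_invE.
move=> y; pose b := eucl y + 1.
exists ([set v : vectors | forall i, [set u : punctured R 3 | 1 <= eucl (val u) <= 1] (v i)]
         `*` `[- b, b]%classic).
  apply: compact_setX; last exact: segment_compact.
  by apply: compact_power; exact: compact_annulus.
have yb : \forall y' \near y, eucl y' < b.
  by apply: (cvgr_lt _ (@continuous_eucl R N1 y)); rewrite ltrDl.
have lift (p : 'rV[R]_N1) : exists2 v : vectors,
    (forall i, enorm (val (v i)) = 1) & p = eucl p *: form v.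
  have [->|p0] := eqVneq p 0; last exact: unit_surj.
  exists (fun=> unit_dir 0) => [i|]; first exact: enorm_unit_dir.
  have -> : eucl (0 : 'rV[R]_N1) = 0.
    by apply/eqP; rewrite eq_le eucl_ge0 andbT leNgt eucl_gt0 eqxx.
  by rewrite scale0r.
apply: filterS yb => y' y'b; have [v v1 yE] := lift y'.
exists (v, eucl y') => //; split=> /=.
  by move=> i; change (1 <= enorm (val (v i)) <= 1); rewrite v1 lexx.
by rewrite in_itv /= (ltW y'b) andbT (le_trans _ (eucl_ge0 _)) // oppr_le0 addr_ge0 ?eucl_ge0.
Qed.

Lemma multipole_bar_homeomorphic : homeomorphic multipole_bar 'rV[R]_N1.
Proof.
exists bar_map, bar_inv; split.
- move=> x; have [[v t] ->] := bar_pi_surj x.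
  by rewrite /bar_pi bar_mapE /bundle_map form_ofE bar_invE.
- move=> p; rewrite /bar_inv bar_mapE /bundle_map [(_, _).1]/= [(_, _).2]/= multipole_ofK.
  have [->|p0] := eqVneq p 0; first by rewrite scale0r.
  by rewrite scale1r to_puncturedK.
- exact: bar_map_continuous.
- exact: bar_inv_continuous.
Qed.

End CollapsedBundle.

(** * Charts on representatives *)

Section ChartFormulas.
Variables (R : realType) (d : nat).
Local Notation C := R[i].
Local Notation vectors := (power (punctured R 3) d).
Local Notation lines := (power (RP R 2) d).
Implicit Types (v : vectors) (F : 'M[R]_3) (l : RP R 2) (w : lines).

Definition line_dom F : set (RP R 2) := [set l | height F (val (repr l)) != 0].

Definition line_stereo F l : C := stereo F (val (repr l)).

Lemma line_domE F x : line_dom F (line x) <-> height F (val x) != 0.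
Proof.
have [a a0 aE] := line_repr x.
by rewrite /line_dom /= aE heightZ mulf_eq0 (negPf a0).
Qed.

Lemma line_stereoE F x : line_stereo F (line x) = stereo F (val x).
Proof. by have [a a0 aE] := line_repr x; rewrite /line_stereo aE stereoZ. Qed.

Lemma sym_coord_perm (s : 'S_d) (z : 'I_d -> C) : sym_coord (fun i => z (s i)) = sym_coord z.
Proof.
rewrite /sym_coord.
by rewrite [in RHS](reindex_inj (@perm_inj _ s)).
Qed.

Lemma sym_domE F w : dom (SymRP_chart d F) (\pi_(SymRP R d) w) <-> forall i, line_dom F (w i).
Proof.
have inv : forall g, range (@permute (RP R 2) d) g -> forall x,
    (forall i, line_dom F (g x i)) = (forall i, line_dom F (x i)).
  move=> _ [s _ <-] x; apply: propext; split=> h i; last exact: h.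
  by have := h (s^-1%g i); rewrite /permute permKV.
by have <- := @invariant_repr _ _ (@permute_bij (RP R 2) d) _ _ inv w.
Qed.

Lemma sym_coordE F w : coord (SymRP_chart d F) (\pi_(SymRP R d) w) =
  sym_coord (fun i => line_stereo F (w i)).
Proof.
apply: (@invariant_repr _ _ (@permute_bij (RP R 2) d) _
  (fun w => sym_coord (fun i => line_stereo F (w i)))).
by move=> _ [s _ <-] x; exact: sym_coord_perm.
Qed.

Definition divisor v : SymRP R d := \pi_(SymRP R d) (fun i => line (v i) : RP R 2).

Lemma projE v : multipole_proj (\pi_(multipole R d) v) = divisor v.
Proof.
apply: (@invariant_repr _ _ (@Sigma_bij R d) _ divisor) => g [[l _ <-]|[s _ <-]] u.
  congr (\pi _); apply: funext => i; apply/line_eq; by exists (l i).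
apply: (@orbit_pi_gen _ _ (@permute_bij (RP R 2) d) (permute s) (fun i => line (u i))).
by exists s.
Qed.

Definition fibre F v : R := \prod_i (Num.sg (height F (val (v i))) * enorm (val (v i))).

Lemma fibre_rescale F (l : 'I_d -> Rstar R) v : fibre F (rescale l v) = scale_prod l * fibre F v.
Proof.
rewrite /fibre /scale_prod -big_split; apply: eq_bigr => i _.
rewrite scale_val heightZ enormZ sgrM /= mulrACA; congr (_ * _).
by rewrite [RHS]numEsg.
Qed.

Lemma fibre_permute F s v : fibre F (permute s v) = fibre F v.
Proof. by rewrite /fibre [RHS](reindex_inj (@perm_inj _ s)). Qed.

Lemma multipole_fibreE F v : multipole_fibre F (\pi_(multipole R d) v) = fibre F v.
Proof.
apply: (@invariant_repr _ _ (@Sigma_bij R d) _ (fibre F)) => g [[l l1 <-]|[s _ <-]] u.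
  by rewrite fibre_rescale (l1 : scale_prod l = 1) mul1r.
exact: fibre_permute.
Qed.

Lemma multipole_domE F v :
  dom (multipole_chart d F) (\pi_(multipole R d) v) <-> forall i, height F (val (v i)) != 0.
Proof.
change (dom (SymRP_chart d F) (multipole_proj (\pi_(multipole R d) v)) <->
  forall i, height F (val (v i)) != 0).
rewrite projE; apply: iff_trans (sym_domE F _) _.
by split=> h i; apply/line_domE; exact: h.
Qed.

Lemma multipole_coordE F v : coord (multipole_chart d F) (\pi_(multipole R d) v) =
  row_mx (sym_coord (fun i => stereo F (val (v i)))) (const_mx (fibre F v)).
Proof.
change (row_mx (coord (SymRP_chart d F) (multipole_proj (\pi_(multipole R d) v)))
  (const_mx (multipole_fibre F (\pi_(multipole R d) v)) : 'rV[R]_1) =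
  row_mx (sym_coord (fun i => stereo F (val (v i)))) (const_mx (fibre F v))).
rewrite projE multipole_fibreE sym_coordE.
by rewrite (funext (fun i => line_stereoE F (v i))).
Qed.

End ChartFormulas.

(** * Continuity of the charts *)

Section ChartContinuity.
Variables (R : realType) (d : nat).
Local Notation C := R[i].
Local Notation vectors := (power (punctured R 3) d).
Local Notation lines := (power (RP R 2) d).
Implicit Types (v : vectors) (F : 'M[R]_3) (l : RP R 2) (w : lines).

Lemma sgrE (x : R) : Num.sg x = x / `|x|.
Proof.
have [->|x0] := eqVneq x 0; first by rewrite sgr0 mul0r.
by rewrite {2}[x]numEsg mulfK // normr_eq0.
Qed.

Lemma continuous_sg (T : topologicalType) (f : T -> R) x :
  {for x, continuous f} -> f x != 0 -> {for x, continuous (fun t => Num.sg (f t))}.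
Proof.
move=> cf f0; rewrite (_ : (fun t => _) = (fun t => f t / `|f t|)); last first.
  by apply: funext => t; rewrite sgrE.
apply: continuousM => //; apply: continuousV; first by rewrite normr_eq0.
apply: (@continuous_comp _ _ _ f Num.norm) => //; exact: norm_continuous.
Qed.

Lemma frame_coord_continuous F j (x : punctured R 3) :
  {for x, continuous (fun x : punctured R 3 => (val x *m F^T) 0 j)}.
Proof.
rewrite (_ : (fun _ => _) = (fun x : punctured R 3 => \sum_k val x 0 k * F^T k j)); last first.
  by apply: funext => y; rewrite mxE.
apply: continuous_sum => k _; apply: continuousM; last exact: cst_continuous.
exact: continuous_set_coord.
Qed.

Lemma height_continuous F (x : punctured R 3) :
  {for x, continuous (fun x : punctured R 3 => height F (val x))}.
Proof. exact: frame_coord_continuous. Qed.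

Lemma line_dom_open F : open (line_dom F).
Proof.
apply: orbit_open.
rewrite (_ : _ @^-1` _ = (fun x : punctured R 3 => height F (val x)) @^-1` [set t | t != 0]).
  by apply: open_comp; [move=> x _; exact: height_continuous|exact: open_neq].
by apply/seteqP; split=> x /line_domE.
Qed.

Lemma stereo_continuous F (x : punctured R 3) : height F (val x) != 0 ->
  regularC (fun f : punctured R 3 -> R => {for x, continuous f}) (fun x => stereo F (val x)).
Proof.
move=> h0.
have cr : {for x, continuous (fun x : punctured R 3 =>
    Num.sg (height F (val x)) / (enorm (val x) + `|height F (val x)|))}.
  apply: continuousM; first by apply: continuous_sg => //; exact: height_continuous.
  apply: continuousV; first by rewrite gt_eqF // height_denom_gt0.
  apply: continuousD; first exact: continuous_set_eucl.
  apply: (@continuous_comp _ _ _ (fun x : punctured R 3 => height F (val x)) Num.norm).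
    exact: height_continuous.
  exact: norm_continuous.
by split; apply: continuousM => //; exact: frame_coord_continuous.
Qed.

Lemma line_stereo_continuous F l : line_dom F l ->
  regularC (fun f : RP R 2 -> R => {for l, continuous f}) (line_stereo F).
Proof.
move=> ld; split; apply: (orbit_continuous_on (@line_dom_open F)) ld => x /line_domE h0.
  rewrite (_ : _ \o _ = (fun x : punctured R 3 => complex.Re (stereo F (val x)))).
    by have [] := stereo_continuous h0.
  by apply: funext => y; congr (complex.Re _); exact: line_stereoE.
rewrite (_ : _ \o _ = (fun x : punctured R 3 => complex.Im (stereo F (val x)))).
  by have [] := stereo_continuous h0.
by apply: funext => y; congr (complex.Im _); exact: line_stereoE.
Qed.

Lemma SymRP_dom_open F : open (dom (SymRP_chart d F)).
Proof.
apply: orbit_open.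
rewrite (_ : _ @^-1` _ = [set w : lines | forall i, line_dom F (w i)]); last first.
  by apply/seteqP; split=> w /sym_domE.
rewrite openE => w wd; rewrite /interior /=.
suff : \forall u \near w, forall i, line_dom F (u i) by [].
apply: (@filter_forall _ 'I_d (fun i (u : lines) => line_dom F (u i)) (nbhs w)) => i.
apply: (@power_coord_continuous _ _ i w).
exact: open_nbhs_nbhs (conj (@line_dom_open F) (wd i)).
Qed.

Lemma sym_coord_continuous F w : (forall i, line_dom F (w i)) ->
  {for w, continuous (fun w : lines => sym_coord (fun i => line_stereo F (w i)))}.
Proof.
move=> wd; pose S (f : lines -> R) := {for w, continuous f}.
have subS : is_subalgebra S by exact: continuous_subalgebra.
have rp : regularP S (fun w : lines => \prod_i ('X - (line_stereo F (w i))%:P)).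
  apply: regularP_prod => // i; apply: regularP_add => //; first exact: regularP_cst.
  apply: regularP_opp => // -[|k].
    have [cr ci] := line_stereo_continuous (wd i).
    split.
      rewrite (_ : (fun _ => _) = (fun w : lines => complex.Re (line_stereo F (w i)))).
        exact: (@continuous_comp _ _ _ (fun w : lines => w i)
          (fun l => complex.Re (line_stereo F l)) w (@power_coord_continuous _ _ i w) cr).
      by apply: funext => u; rewrite coefC.
    rewrite (_ : (fun _ => _) = (fun w : lines => complex.Im (line_stereo F (w i)))).
      exact: (@continuous_comp _ _ _ (fun w : lines => w i)
        (fun l => complex.Im (line_stereo F l)) w (@power_coord_continuous _ _ i w) ci).
    by apply: funext => u; rewrite coefC.
  have := regularC_cst subS 0; congr regularC; apply: funext => u; by rewrite coefC.
apply: continuous_mx => i j; rewrite ord1.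
rewrite (_ : (fun _ => _) = (fun w : lines =>
    let p := \prod_i ('X - (line_stereo F (w i))%:P) in
    if (j < d)%N then complex.Re p`_j else complex.Im p`_(j - d))); last first.
  by apply: funext => u; rewrite mxE.
by case: (j < d)%N; [have [] := rp j|have [] := rp (j - d)%N].
Qed.

Lemma SymRP_coord_continuous F D : dom (SymRP_chart d F) D ->
  {for D, continuous (coord (SymRP_chart d F))}.
Proof.
apply: (orbit_continuous_on (@SymRP_dom_open F)) => w /sym_domE wd.
rewrite (_ : _ \o _ = (fun w : lines => sym_coord (fun i => line_stereo F (w i)))).
  exact: sym_coord_continuous.
by apply: funext => u; exact: sym_coordE.
Qed.

Lemma divisor_continuous : continuous (@divisor R d).
Proof.
move=> v; apply: (@continuous_comp _ _ _ (fun v : vectors => (fun i => line (v i)) : lines)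
  (\pi_(SymRP R d))); last exact: orbit_pi_continuous.
apply: continuous_power => i.
apply: (@continuous_comp _ _ _ (fun v : vectors => v i) (@line R 2)).
  exact: power_coord_continuous.
exact: orbit_pi_continuous.
Qed.

Lemma proj_continuous : continuous (@multipole_proj R d).
Proof.
apply: orbit_continuous; rewrite (_ : _ \o _ = @divisor R d).
  exact: divisor_continuous.
by apply: funext => v; exact: projE.
Qed.

Lemma multipole_dom_open F : open (dom (multipole_chart d F)).
Proof. by apply: open_comp (@SymRP_dom_open F) => m _; exact: proj_continuous. Qed.

Lemma fibre_continuous F m : dom (multipole_chart d F) m ->
  {for m, continuous (multipole_fibre F (d := d))}.
Proof.
apply: (orbit_continuous_on (@multipole_dom_open F)) => v /multipole_domE vd.
rewrite (_ : _ \o _ = fibre F); last by apply: funext => u; exact: multipole_fibreE.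
apply: continuous_prod => i _; apply: continuousM; last exact: enorm_vector_continuous.
apply: continuous_sg; last exact: vd.
apply: (@continuous_comp _ _ _ (fun v : vectors => v i) (fun x : punctured R 3 => height F (val x))).
  exact: power_coord_continuous.
exact: height_continuous.
Qed.

Lemma continuous_row_mx (T : topologicalType) n1 n2 (f : T -> 'rV[R]_n1) (g : T -> 'rV[R]_n2) x :
  {for x, continuous f} -> {for x, continuous g} ->
  {for x, continuous (fun t => row_mx (f t) (g t))}.
Proof.
move=> cf cg; apply: continuous_mx => i j; rewrite ord1.
case: (split_ordP j) => k ->.
  rewrite (_ : (fun _ => _) = (fun t => f t 0 k)); last by apply: funext => t; rewrite row_mxEl.
  by apply: (@continuous_comp _ _ _ f (fun y : 'rV[R]_n1 => y 0 k)) => //; exact: coord_continuous.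
rewrite (_ : (fun _ => _) = (fun t => g t 0 k)); last by apply: funext => t; rewrite row_mxEr.
by apply: (@continuous_comp _ _ _ g (fun y : 'rV[R]_n2 => y 0 k)) => //; exact: coord_continuous.
Qed.

Lemma continuous_const_mx (T : topologicalType) n1 n2 (f : T -> R) x :
  {for x, continuous f} -> {for x, continuous (fun t => const_mx (f t) : 'M[R]_(n1, n2))}.
Proof.
move=> cf; apply: continuous_mx => i j.
by rewrite (_ : (fun _ => _) = f) //; apply: funext => t; rewrite mxE.
Qed.

Lemma multipole_coord_continuous F m : dom (multipole_chart d F) m ->
  {for m, continuous (coord (multipole_chart d F))}.
Proof.
move=> md; apply: continuous_row_mx.
  apply: (@continuous_comp _ _ _ (@multipole_proj R d) (coord (SymRP_chart d F))).
    exact: proj_continuous.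
  exact: SymRP_coord_continuous.
by apply: continuous_const_mx; exact: fibre_continuous.
Qed.

End ChartContinuity.

(** * Forms in the coordinates of a chart *)

Section ChartTransitions.
Variables (R : realType) (d : nat).
Hypothesis hd : (0 < d)%N.
Local Notation C := R[i].
Local Notation N := (2 * d + 1)%N.
Local Notation N1 := (2 * d).+1.
Local Notation vectors := (power (punctured R 3) d).
Local Notation mchart := (multipole_chart d).
Import Normc.
Implicit Types (v : vectors) (F : 'M[R]_3).

Lemma frames_tr F : frames F -> frames F^T.
Proof. by move=> FF; rewrite /frames /= trmxK frame_tr. Qed.

Lemma rVpoly_row_mxl m1 m2 (a : 'rV[R]_m1) (b : 'rV[R]_m2) k : (k < m1)%N ->
  (rVpoly (row_mx a b))`_k = (rVpoly a)`_k.
Proof.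
move=> km; have -> : k = lshift m2 (Ordinal km) by [].
by rewrite coef_rVpoly_ord row_mxEl -coef_rVpoly_ord.
Qed.

Lemma rVpoly_row_mxr m1 m2 (a : 'rV[R]_m1) (b : 'rV[R]_m2) (k : 'I_m2) :
  (rVpoly (row_mx a b))`_(m1 + k) = b 0 k.
Proof.
have -> : (m1 + k)%N = rshift m1 k by [].
by rewrite coef_rVpoly_ord row_mxEr.
Qed.

Lemma eq_monic_of m1 m2 (x : 'rV[R]_m1) (y : 'rV[R]_m2) :
  (forall k, (k < 2 * d)%N -> (rVpoly x)`_k = (rVpoly y)`_k) ->
  monic_of d x = monic_of d y.
Proof.
move=> xy; congr (_ + _); apply/polyP => k; rewrite !coef_monic_dir.
by case: ltnP => // kd; rewrite !xy //; lia.
Qed.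

Lemma monic_of_row_mx m (a : 'rV[R]_(2 * d)) (b : 'rV[R]_m) :
  monic_of d (row_mx a b) = monic_of d a.
Proof. by apply: eq_monic_of => k kd; exact: rVpoly_row_mxl. Qed.

Lemma last_row_mx (a : 'rV[R]_(2 * d)) (s : R) :
  (rVpoly (row_mx a (const_mx s : 'rV[R]_1)))`_(2 * d) = s.
Proof. by rewrite -[X in _`_X]addn0 (rVpoly_row_mxr _ _ (0 : 'I_1)) mxE. Qed.

Lemma frame_substZ F (a : C) (p : {poly C}) : frame_subst F d (a *: p) = a *: frame_subst F d p.
Proof.
rewrite /frame_subst scaler_sumr; apply: eq_bigr => k _.
by rewrite coefZ scalerA.
Qed.

(** The form A A' read in the standard frame, whence the transpose. *)
Definition frame_vec F m (x : 'rV[R]_m) : 'rV[R]_N1 :=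
  enc N1 (frame_subst F^T d (monic_of d x * star d (monic_of d x))).

(** Local expression of the map [form_of] in the chart of F, as shown by
    [chart_formE]. *)
Definition chart_form F m (x : 'rV[R]_m) : 'rV[R]_N1 :=
  ((rVpoly x)`_(2 * d) / eucl (frame_vec F x)) *: frame_vec F x.

(** By [quad_stereo], in the frame F the product of the quadratics is a real
    multiple of A A', whose factors of norm are removed by the rescaling in
    [form], so that only the signs and norms collected in [fibre] remain. *)
Lemma chart_formE F v : frames F -> (forall i, height F (val (v i)) != 0) ->
  form v = chart_form F (coord (mchart F) (\pi_(multipole R d) v)).
Proof.
move=> FF h0; rewrite multipole_coordE /chart_form last_row_mx /frame_vec.
rewrite monic_of_row_mx monic_of_sym_coord.
set A := \prod_i ('X - _).
pose sg := \prod_i Num.sg (height F (val (v i))).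
pose P := \prod_i (enorm (val (v i)) + `|height F (val (v i))|).
have P0 : 0 < P by apply: prodr_gt0 => i _; exact: height_denom_gt0.
have sg1 : `|sg| = 1 by rewrite normr_prod big1 // => i _; rewrite normr_sg h0.
have AE : star d A = \prod_i (1 + conjc (stereo F (val (v i))) *: 'X).
  have := star_prod_XsubC (index_enum 'I_d) (fun i => stereo F (val (v i))).
  by rewrite {1}/index_enum -enumT size_enum_ord.
have qE : \prod_i quad (val (v i) *m F^T) = (sg * P)%:C%C *: (A * star d A).
  have -> : sg * P = \prod_i (Num.sg (height F (val (v i))) *
      (enorm (val (v i)) + `|height F (val (v i))|)) by rewrite /sg /P -big_split.
  rewrite AE -big_split rmorph_prod -scaler_prod.
  by apply: eq_bigr => i _; exact: quad_stereo.
have prodE : prodq v = (sg * P)%:C%C *: frame_subst F^T d (A * star d A).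
  rewrite -frame_substZ -qE.
  have := frame_subst_prod [seq val (v i) *m F^T | i <- enum 'I_d] (frames_tr FF).
  have prodE (G : 'rV[R]_3 -> {poly C}) :
      \prod_(y <- [seq val (v i) *m F^T | i <- enum 'I_d]) G y =
      \prod_i G (val (v i) *m F^T) by rewrite big_map big_enum.
  rewrite size_map size_enum_ord !prodE => ->; apply: eq_bigr => i _.
  by rewrite trmxK -mulmxA frame_tr // mulmx1.
rewrite /form prodE encZ euclZ normrM sg1 mul1r (gtr0_norm P0).
have q0 : eucl (enc N1 (frame_subst F^T d (A * star d A))) != 0.
  have := enc_prodq_gt0 v; rewrite prodE encZ euclZ => /lt0r_neq0.
  by rewrite mulf_eq0 negb_or => /andP[].
have -> : fibre F v = sg * total_norm v by rewrite /fibre big_split.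
rewrite scalerA; congr (_ *: _); field.
by rewrite q0 gt_eqF.
Qed.

(** Image of the chart of any frame: the roots of A lie in the open disk and the
    fibre coordinate is nonzero. *)
Definition chart_image : set 'rV[R]_N :=
  [set x | in_disk d x /\ (rVpoly x)`_(2 * d) != 0].

Lemma chart_image_open : open chart_image.
Proof.
apply: openI; first exact: open_in_disk.
apply: (@open_comp _ _ (fun x : 'rV[R]_N => (rVpoly x)`_(2 * d)) [set t | t != 0]).
  by move=> x _; exact: continuous_rVpoly.
exact: open_neq.
Qed.

Lemma fibre_neq0 F v : (forall i, height F (val (v i)) != 0) -> fibre F v != 0.
Proof.
move=> h0; apply/prodf_neq0 => i _; rewrite mulf_neq0 ?sgr_eq0 //.
by rewrite gt_eqF // enorm_gt0 punctured_neq0.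
Qed.

Lemma coord_in_image F v : frames F -> (forall i, height F (val (v i)) != 0) ->
  chart_image (coord (mchart F) (\pi_(multipole R d) v)).
Proof.
move=> FF h0; rewrite multipole_coordE; split.
  move=> z; rewrite monic_of_row_mx monic_of_sym_coord.
  rewrite -(big_map (fun i => stereo F (val (v i))) xpredT (fun w => 'X - w%:P)).
  rewrite root_prod_XsubC => /mapP[i _ ->].
  exact: stereo_lt1.
by rewrite last_row_mx fibre_neq0.
Qed.

Lemma chart_vec_inj m (x y : 'rV[R]_m) : m = N1 -> monic_of d x = monic_of d y ->
  (rVpoly x)`_(2 * d) = (rVpoly y)`_(2 * d) -> x = y.
Proof.
move=> mE exy sxy; apply/eqP; rewrite -subr_eq0; apply/eqP.
apply: (monic_dir_eq0 mE); first by rewrite -monic_of_diff exy subrr.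
by rewrite linearB coefB sxy subrr.
Qed.

(** The roots of A provide the lines, and the first vector is scaled to reach
    the prescribed fibre coordinate. *)
Lemma coord_surj F x : frames F -> chart_image x -> exists2 v,
  forall i, height F (val (v i)) != 0 & coord (mchart F) (\pi_(multipole R d) v) = x.
Proof.
move=> FF [xd s0]; have [zs AE] := closed_field_poly_normal (monic_of d x).
rewrite (monicP (monic_of_monic d x)) scale1r in AE.
have szs : size zs = d by have := size_monic_of d x; rewrite AE size_prod_XsubC => -[].
have zs1 (i : 'I_d) : normc zs`_i < 1.
  by apply: xd; rewrite AE root_prod_XsubC mem_nth // szs.
pose v0 : vectors := fun i => to_punctured (dir zs`_i *m F).
have v0E i : val (v0 i) = dir zs`_i *m F.
  rewrite to_puncturedK //; have [h0 _] := stereo_dir FF (zs1 i).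
  by apply: contraNneq h0 => e; rewrite e /height mul0mx mxE.
have hv0 i : height F (val (v0 i)) != 0 by rewrite v0E; have [] := stereo_dir FF (zs1 i).
have f0 : fibre F v0 != 0 by exact: fibre_neq0.
have c0 : (rVpoly x)`_(2 * d) / fibre F v0 != 0 by rewrite mulf_neq0 ?invr_eq0.
pose l : Rstar R := Sub ((rVpoly x)`_(2 * d) / fibre F v0) c0.
pose i0 : 'I_d := Ordinal hd.
pose v := scale_at i0 l v0.
have lv i : exists2 a : R, a != 0 & val (v i) = a *: val (v0 i).
  rewrite /v /scale_at /rescale scale_val.
  exists (val (if i == i0 then l else rstar1 R)) => //.
  exact: (valP (if i == i0 then l else rstar1 R)).
have hv i : height F (val (v i)) != 0.
  by have [a a0 ->] := lv i; rewrite heightZ mulf_neq0.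
exists v => //; rewrite multipole_coordE.
apply: chart_vec_inj; first by rewrite addn1.
  rewrite monic_of_row_mx monic_of_sym_coord AE (big_nth 0) szs big_mkord.
  apply: eq_bigr => i _; have [a a0 ->] := lv i; rewrite stereoZ // v0E.
  by have [_ ->] := stereo_dir FF (zs1 i).
by rewrite last_row_mx fibre_rescale (scale_prod_at i0) divfK.
Qed.

Lemma chart_form_neq0 F x : frames F -> chart_image x -> chart_form F x != 0.
Proof.
move=> FF /(coord_surj FF)[v hv <-].
by have := form_neq0 v; rewrite (chart_formE FF hv).
Qed.

Lemma frame_vec_neq0 F x : frames F -> chart_image x -> frame_vec F x != 0.
Proof.
move=> FF /(chart_form_neq0 FF); apply: contraNneq => e.
by rewrite /chart_form e scaler0.
Qed.

Lemma smooth_frame_vec F m (U : set 'rV[R]_m) j : open U ->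
  smooth U (fun x => frame_vec F x 0 j).
Proof.
move=> oU; have algU := smooth_subalgebra oU.
apply: regular_enc => //; apply: regularP_frame_subst => //.
have sm : regularP (smooth U) (fun x => monic_of d x) by exact: smooth_monic_of oU d.
by apply: regularP_mul => //; exact: regularP_star.
Qed.

Lemma smooth_eucl m n (U : set 'rV[R]_m) (f : 'rV[R]_m -> 'rV[R]_n) : open U ->
  (forall j, smooth U (fun x => f x 0 j)) -> (forall x, U x -> f x != 0) ->
  smooth U (fun x => eucl (f x)).
Proof.
move=> oU sf f0; apply: smooth_sqrt => //.
  by move=> x Ux; rewrite eucl_sqr_gt0 f0.
apply: smooth_sum => // i _.
by apply: eq_smooth (smoothM oU (sf i) (sf i)) => // x Ux; rewrite expr2.
Qed.

Lemma smooth_chart_form F j : frames F -> smooth chart_image (fun x => chart_form F x 0 j).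
Proof.
move=> FF; have oE := chart_image_open.
apply: (@eq_smooth _ _ _ oE (fun x => (rVpoly x)`_(2 * d) * (eucl (frame_vec F x))^-1 *
    frame_vec F x 0 j)).
  by move=> x xE; rewrite [RHS]mxE.
apply: smoothM => //; last exact: smooth_frame_vec.
apply: smoothM => //; first exact: smooth_rVpoly.
apply: smoothV => // [x xE|].
  by rewrite gt_eqF // eucl_gt0 frame_vec_neq0.
apply: smooth_eucl => // [i|x]; first exact: smooth_frame_vec.
exact: frame_vec_neq0.
Qed.

Lemma chart_form_continuous F x : frames F -> chart_image x -> {for x, continuous (@chart_form F N)}.
Proof.
by move=> FF xE; apply: smooth_row_continuous xE => j; exact: smooth_chart_form.
Qed.

Definition chart_inv F (x : 'rV[R]_N) : multipole R d := multipole_of hd (to_punctured (chart_form F x)).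

Lemma chart_invE F v : frames F -> (forall i, height F (val (v i)) != 0) ->
  chart_inv F (coord (mchart F) (\pi_(multipole R d) v)) = \pi_(multipole R d) v.
Proof.
move=> FF hv; rewrite /chart_inv -chart_formE //.
by rewrite -[form v]/(val (punctured_form v)) val_to_punctured multipole_ofE.
Qed.

Lemma chart_inv_continuous F x : frames F -> chart_image x -> {for x, continuous (chart_inv F)}.
Proof.
move=> FF xE; apply: (@continuous_comp _ _ _ (fun x => to_punctured (chart_form F x)) (multipole_of hd)).
  apply: (@continuous_comp _ _ _ (@chart_form F N) (@to_punctured R (2 * d))).
    exact: chart_form_continuous.
  by apply: continuous_to_punctured; exact: chart_form_neq0.
exact: multipole_of_continuous.
Qed.

Lemma chart_invK F x : frames F -> chart_image x ->
  dom (mchart F) (chart_inv F x) /\ coord (mchart F) (chart_inv F x) = x.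
Proof.
move=> FF /(coord_surj FF)[v hv <-]; rewrite chart_invE //.
by split=> //; apply/multipole_domE.
Qed.

Lemma multipole_pi_surj (m : multipole R d) : exists v, m = \pi_(multipole R d) v.
Proof. by exists (repr m); rewrite reprK. Qed.

Lemma chart_coordK F m : frames F -> dom (mchart F) m ->
  chart_image (coord (mchart F) m) /\ chart_inv F (coord (mchart F) m) = m.
Proof.
move=> FF; have [v ->] := multipole_pi_surj m => /multipole_domE hv.
by split; [exact: coord_in_image|exact: chart_invE].
Qed.

Lemma multipole_is_chart F : frames F -> is_chart (mchart F).
Proof.
move=> FF; apply: (@chart_of_inverse _ _ _ _ chart_image (chart_inv F)).
- exact: multipole_dom_open.
- by move=> m; exact: multipole_coord_continuous.
- exact: chart_image_open.
- by move=> x; exact: chart_inv_continuous.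
- by move=> x; exact: chart_invK.
- by move=> m; exact: chart_coordK.
Qed.

End ChartTransitions.

(** * Coordinates of a form *)

Section Transfer.
Variables (R : realType) (d : nat).
Hypothesis hd : (0 < d)%N.
Local Notation C := R[i].
Local Notation N := (2 * d + 1)%N.
Local Notation N1 := (2 * d).+1.
Local Notation vectors := (power (punctured R 3) d).
Local Notation mchart := (multipole_chart d).
Implicit Types (F : 'M[R]_3).

(** On products of quadratics the substitutions by F and by its transpose are
    inverse to each other by [frame_subst_prod], and Sylvester's theorem makes
    all self-dual polynomials of this kind. *)
Lemma frame_subst_selfdual F (p : {poly C}) : frames F -> selfdual d p ->
  selfdual d (frame_subst F d p) /\ frame_subst F^T d (frame_subst F d p) = p.
Proof.
move=> FF pd; have [->|p0] := eqVneq p 0.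
  have e0 G : frame_subst G d (0 : {poly C}) = 0.
    by have := frame_substZ d G 0 0; rewrite !scale0r.
  rewrite !e0; split=> //; have := selfdualZ 0 (selfdual_dec d (0 : 'rV[R]_1)).
  by rewrite scale0r.
have [s [zs [s0 szs ->]]] := sylvester pd p0.
pose vs := [seq dir z | z <- zs].
have svs : size vs = d by rewrite size_map.
have -> : \prod_(z <- zs) quad (dir z) = \prod_(v <- vs) quad v by rewrite big_map.
pose ws := [seq v *m F^T | v <- vs].
have sws : size ws = d by rewrite size_map.
have E : frame_subst F d (\prod_(v <- vs) quad v) = \prod_(w <- ws) quad w.
  by have := frame_subst_prod vs FF; rewrite svs => ->; rewrite [RHS]big_map.
rewrite frame_substZ E; split.
  by apply: selfdualZ; have := selfdual_quad_prod ws; rewrite sws.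
rewrite frame_substZ; congr (_ *: _).
have := frame_subst_prod ws (frames_tr FF); rewrite sws => ->.
rewrite [in LHS]big_map; apply: eq_bigr => v _.
by rewrite trmxK -mulmxA frame_tr // mulmx1.
Qed.

(** Change of frame on the real coordinates of self-dual polynomials. The
    lengths m and m' are left free because rows of lengths 2d+1 and (2d).+1 have
    different types. *)
Definition transfer F m m' (x : 'rV[R]_m) : 'rV[R]_m' :=
  enc m' (frame_subst F d (dec d x)).

Lemma transferK F m m' (x : 'rV[R]_m) : m = N1 -> m' = N1 -> frames F ->
  transfer F m (transfer F^T m' x) = x.
Proof.
move=> mE m'E FF; have [sd e] := frame_subst_selfdual (frames_tr FF) (selfdual_dec d x).
by rewrite /transfer decK // -{1}[F]trmxK e encK.
Qed.

(** Local expression of [multipole_of] in the chart of F. *)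
Definition form_coord F (p : 'rV[R]_N1) : 'rV[R]_N := coord (mchart F) (multipole_of hd (to_punctured p)).

Definition form_dom F : set 'rV[R]_N1 :=
  [set p | p != 0 /\ dom (mchart F) (multipole_of hd (to_punctured p))].

Lemma multipole_of_to_punctured_continuous (p : 'rV[R]_N1) : p != 0 ->
  {for p, continuous (fun p : 'rV[R]_N1 => multipole_of hd (to_punctured p))}.
Proof.
move=> p0; apply: (@continuous_comp _ _ _ (@to_punctured R (2 * d)) (multipole_of hd)).
  exact: continuous_to_punctured.
exact: multipole_of_continuous.
Qed.

Lemma form_dom_open F : open (form_dom F).
Proof.
apply: (open_continuous_preimage (@open_neq0 R N1)) (@multipole_dom_open R d F) => p.
exact: multipole_of_to_punctured_continuous.
Qed.

Lemma form_coord_continuous F p : form_dom F p -> {for p, continuous (form_coord F)}.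
Proof.
move=> [p0 pd]; apply: (@continuous_comp _ _ _ (fun p : 'rV[R]_N1 => multipole_of hd (to_punctured p))
  (coord (mchart F))).
  exact: multipole_of_to_punctured_continuous.
exact: multipole_coord_continuous.
Qed.

Lemma form_coordP F p : frames F -> form_dom F p ->
  chart_image (form_coord F p) /\ chart_form d F (form_coord F p) = p.
Proof.
move=> FF [p0 pd]; have [v vE] := punctured_form_surj hd (to_punctured p).
have pE : form v = p by rewrite -[form v]/(val (punctured_form v)) vE to_puncturedK.
move: pd; rewrite /form_coord -vE multipole_ofE => /multipole_domE pd.
by split; [exact: coord_in_image|rewrite -chart_formE].
Qed.

(** Passage from the coordinate s of a chart to the factor of A A'. Since the
    norm of A A' is a smooth function of A, this is harmless for smoothness. *)
Definition unscale F (x : 'rV[R]_N) : 'rV[R]_N :=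
  \row_k (if (k < 2 * d)%N then x 0 k else x 0 k / eucl (frame_vec d F x)).

Lemma coef_unscale F x k : (k < 2 * d)%N -> (rVpoly (unscale F x))`_k = (rVpoly x)`_k.
Proof.
move=> kd; have kN : (k < N)%N by rewrite addn1 ltnS ltnW.
have -> : k = Ordinal kN by [].
by rewrite !coef_rVpoly_ord mxE kd.
Qed.

Lemma last_unscale F x :
  (rVpoly (unscale F x))`_(2 * d) = (rVpoly x)`_(2 * d) / eucl (frame_vec d F x).
Proof.
have kN : (2 * d < N)%N by rewrite addn1.
have := coef_rVpoly_ord (unscale F x) (Ordinal kN); rewrite mxE /= ltnn => ->.
by rewrite -(coef_rVpoly_ord x (Ordinal kN)).
Qed.

Lemma monic_of_unscale F x : monic_of d (unscale F x) = monic_of d x.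
Proof. by apply: (eq_monic_of hd) => k; exact: coef_unscale. Qed.

Lemma frame_vec_unscale F x : frame_vec d F (unscale F x) = frame_vec d F x.
Proof. by rewrite /frame_vec monic_of_unscale. Qed.

Lemma smooth_unscale F j : frames F -> smooth (@chart_image R d) (fun x => unscale F x 0 j).
Proof.
move=> FF; have oE := @chart_image_open R d.
have [jd|jd] := boolP (j < 2 * d)%N.
  apply: (@eq_smooth _ _ _ oE (fun x => x 0 j)); last exact: smooth_coord.
  by move=> x xE; rewrite [RHS]mxE jd.
apply: (@eq_smooth _ _ _ oE (fun x => x 0 j * (eucl (frame_vec d F x))^-1)).
  by move=> x xE; rewrite [RHS]mxE (negPf jd).
apply: smoothM => //; first exact: smooth_coord.
apply: smoothV => // [x xE|].
  by rewrite gt_eqF // eucl_gt0 (frame_vec_neq0 hd).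
apply: smooth_eucl => // [i|x]; first exact: smooth_frame_vec.
exact: (frame_vec_neq0 hd).
Qed.

Lemma transfer_chart_form F x : frames F ->
  transfer F N (chart_form d F x) = enc N (product_map d (unscale F x)).
Proof.
move=> FF; rewrite /product_map last_unscale monic_of_unscale /chart_form.
set r := _ / _; set A := monic_of d x.
have sA : selfdual d (A * star d A) by apply: selfdual_mul_self; rewrite size_monic_of.
have [sd e] := frame_subst_selfdual (frames_tr FF) sA.
by rewrite /transfer /frame_vec -encZ decK //; [rewrite frame_substZ -{1}[F]trmxK e|exact: selfdualZ].
Qed.

Lemma transfer_smooth F m m' (U : set 'rV[R]_m) j : open U -> smooth U (fun x => transfer F m' x 0 j).
Proof.
move=> oU; have algU := smooth_subalgebra oU.
apply: regular_enc => //; apply: regularP_frame_subst => //.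
exact: smooth_dec oU d.
Qed.

(** In the frame F the form is r A A' with r the last coordinate of [unscale],
    so that the unscaled coordinates are a continuous right inverse of
    [product_map]. *)
Lemma smooth_form_coord F j : frames F -> smooth (form_dom F) (fun p => form_coord F p 0 j).
Proof.
move=> FF; have oP := @form_dom_open F.
pose T := @transfer F N1 N; pose T' := @transfer F^T N N1.
have sT : forall j, smooth setT (fun p => T p 0 j) by move=> k; apply: transfer_smooth; exact: openT.
have sT' : forall j, smooth setT (fun p => T' p 0 j) by move=> k; apply: transfer_smooth; exact: openT.
have TT' u : T (T' u) = u by apply: transferK; rewrite // addn1.
have T'T p : T' (T p) = p.
  rewrite /T /T' -{2}[F]trmxK; apply: transferK; rewrite ?addn1 //; exact: frames_tr.
have cT' u : {for u, continuous T'}.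
  exact: smooth_row_continuous sT' I.
pose W := [set u | form_dom F (T' u)].
have oW : open W by apply: open_comp oP => u _; exact: cT'.
pose h u := unscale F (form_coord F (T' u)).
have hE u : W u -> [/\ in_disk d (h u), (rVpoly (h u))`_(2 * d) != 0 &
                        enc N (product_map d (h u)) = u].
  move=> Wu; have [[xd s0] xE] := form_coordP FF Wu; split.
  - by move=> z; rewrite monic_of_unscale; exact: xd.
  - rewrite last_unscale mulf_neq0 // invr_eq0 gt_eqF // eucl_gt0.
    by apply: (frame_vec_neq0 hd) => //; exact: (conj xd s0).
  - by rewrite -transfer_chart_form // xE; exact: TT'.
have skap : forall u, W u -> {for u, continuous (fun u => form_coord F (T' u))}.
  move=> u Wu; apply: (@continuous_comp _ _ _ T' (form_coord F)); first exact: cT'.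
  exact: form_coord_continuous.
have ch u : W u -> {for u, continuous h}.
  move=> Wu; have [xE _] := form_coordP FF Wu.
  apply: (@continuous_comp _ _ _ (fun u => form_coord F (T' u)) (unscale F)); first exact: skap.
  by apply: smooth_row_continuous xE => k; exact: smooth_unscale.
have sh := smooth_product_inverse oW ch hE.
have WT p : form_dom F p -> W (T p) by rewrite /W /= T'T.
have hT p : h (T p) = unscale F (form_coord F p) by rewrite /h T'T.
have shT k : smooth (form_dom F) (fun p => h (T p) 0 k).
  apply: (smooth_comp oP WT _ (sh k)) => i.
  exact: smoothS (sT i).
have [jd|jd] := boolP (j < 2 * d)%N.
  apply: (@eq_smooth _ _ _ oP (fun p => h (T p) 0 j)) (shT j).
  by move=> p pE; rewrite hT mxE jd.
have fv0 p : form_dom F p -> frame_vec d F (form_coord F p) != 0.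
  by move=> /(form_coordP FF)[xE _]; exact: (frame_vec_neq0 hd).
apply: (@eq_smooth _ _ _ oP (fun p => h (T p) 0 j * eucl (frame_vec d F (h (T p))))).
  move=> p /set_mem pE; rewrite hT frame_vec_unscale mxE (negPf jd) divfK //.
  by rewrite gt_eqF // eucl_gt0 fv0.
apply: smoothM => //; apply: smooth_eucl => // [i|p pE]; last by rewrite hT frame_vec_unscale fv0.
apply: (@smooth_comp _ _ _ _ setT (fun p => h (T p)) oP _ (fun x => frame_vec d F x 0 i)) => //.
by apply: smooth_frame_vec; exact: openT.
Qed.

End Transfer.

(** * The multipole space and the punctured space *)

Section MultipoleDiffeomorphism.
Variables (R : realType) (d : nat).
Hypothesis hd : (0 < d)%N.
Local Notation N := (2 * d + 1)%N.
Local Notation N1 := (2 * d).+1.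
Local Notation vectors := (power (punctured R 3) d).
Local Notation mchart := (multipole_chart d).
Implicit Types (F : 'M[R]_3).

(** Transitions between charts factor through the forms: coordinates to form in
    the first frame, form to coordinates in the second. *)
Definition transition_dom F F' : set 'rV[R]_N :=
  @chart_image R d `&` @chart_form R d F N @^-1` form_dom hd F'.

Lemma transition_dom_open F F' : frames F -> open (transition_dom F F').
Proof.
move=> FF; apply: open_continuous_preimage; first exact: chart_image_open.
  by move=> x; exact: chart_form_continuous.
exact: form_dom_open.
Qed.

Lemma smooth_transition F F' j : frames F -> frames F' ->
  smooth (transition_dom F F') (fun x => form_coord hd F' (chart_form d F x) 0 j).
Proof.
move=> FF FF'; have oE := @transition_dom_open F F' FF.
apply: (@smooth_comp _ _ _ _ (form_dom hd F') (@chart_form R d F N) oE _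
  (fun p => form_coord hd F' p 0 j)).
- by move=> x [].
- move=> i; apply: (@smoothS _ _ _ (@chart_image R d)); first by move=> x [].
  exact: smooth_chart_form.
- exact: smooth_form_coord.
Qed.

Lemma chart_form_form_of F m : frames F -> dom (mchart F) m ->
  chart_form d F (coord (mchart F) m) = val (form_of m).
Proof.
move=> FF; have [v ->] := multipole_pi_surj m => /multipole_domE hv.
by rewrite form_ofE -(chart_formE hd FF hv).
Qed.

Lemma form_dom_form_of F m : dom (mchart F) m ->
  form_dom hd F (val (form_of m)) /\ form_coord hd F (val (form_of m)) = coord (mchart F) m.
Proof.
have e : multipole_of hd (to_punctured (val (form_of m))) = m by rewrite val_to_punctured form_ofK.
by move=> md; rewrite /form_coord e; split=> //; split; [exact: punctured_neq0|rewrite e].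
Qed.

Lemma multipole_smooth_atlas : smooth_atlas (@multipole_atlas R d).
Proof.
split.
- by move=> _ [F FF <-]; exact: multipole_is_chart.
- move=> m; have [v ->] := multipole_pi_surj m.
  have [F FF hF] := @frame_avoiding R 'I_d (fun i => val (v i)) (fun i => punctured_neq0 (v i)).
  by exists (mchart F); [exists F|apply/multipole_domE].
move=> _ _ [F FF <-] [F' FF' <-].
apply: (@smooth_in_chartsP _ _ _ _ _ _ _ _ (transition_dom F F')
  (fun x => form_coord hd F' (chart_form d F x))).
- exact: transition_dom_open.
- move=> m md md'; have [kd kE] := form_dom_form_of md'.
  have [xE _] := chart_coordK hd FF md.
  by rewrite /transition_dom /= chart_form_form_of.
- by move=> j; exact: smooth_transition.
Qed.

Lemma punctured_smooth_atlas n : smooth_atlas (@punctured_atlas R n.+1).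
Proof.
split.
- move=> _ ->; apply: (@chart_of_inverse _ _ _ _ [set x | x != 0] (@to_punctured R n)).
  + exact: openT.
  + by move=> x _; exact: set_val_continuous.
  + exact: open_neq0.
  + by move=> x; exact: continuous_to_punctured.
  + by move=> x x0; split=> //; exact: to_puncturedK.
  + by move=> x _; split; [exact: punctured_neq0|exact: val_to_punctured].
- by move=> x; eexists; first exact: erefl.
- move=> _ _ -> ->; apply: (@smooth_in_chartsP _ _ _ _ _ _ _ _ setT id) => //.
    exact: openT.
  by move=> j; apply: smooth_coord; exact: openT.
Qed.

Lemma multipole_diffeomorphic :
  diffeomorphic (@multipole_atlas R d) (@punctured_atlas R N1).
Proof.
split; [exact: multipole_smooth_atlas|exact: punctured_smooth_atlas|].
exists (@form_of R d), (multipole_of hd); split; [exact: form_ofK|exact: multipole_ofK| |].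
  split; first exact: form_of_continuous.
  move=> _ _ [F FF <-] ->.
  apply: (@smooth_in_chartsP _ _ _ _ _ _ _ _ (@chart_image R d) (@chart_form R d F N)).
  - exact: chart_image_open.
  - move=> m md _; have [xE _] := chart_coordK hd FF md.
    by rewrite chart_form_form_of.
  - by move=> j; exact: smooth_chart_form.
split; first exact: multipole_of_continuous.
move=> _ _ -> [F FF <-].
apply: (@smooth_in_chartsP _ _ _ _ _ _ _ _ (form_dom hd F) (form_coord hd F)).
- exact: form_dom_open.
- move=> x _ xd; have [] := form_dom_form_of xd; by rewrite multipole_ofK.
- by move=> j; exact: smooth_form_coord.
Qed.

End MultipoleDiffeomorphism.

(** * Projective space *)

Section ProjectiveSpace.
Variables (R : realType) (n : nat).
Implicit Types (i : 'I_n.+1) (y : 'rV[R]_n).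

Definition RP_chart i : chart (RP R n) n :=
  Chart [set x : RP R n | val (repr x) 0 i != 0]
        (fun x => \row_(j < n) (val (repr x) 0 (lift i j) / val (repr x) 0 i)).

(** Affine coordinates of the line of x, with [insert i 1] as inverse. *)
Definition affine i (x : 'rV[R]_n.+1) : 'rV[R]_n := \row_j (x 0 (lift i j) / x 0 i).

Definition insert i (t : R) y : 'rV[R]_n.+1 :=
  \row_k (if unlift i k is Some j then y 0 j else t).

Lemma insertE i t y : insert i t y 0 i = t.
Proof. by rewrite mxE unlift_none. Qed.

Lemma insert_lift i t y j : insert i t y 0 (lift i j) = y 0 j.
Proof. by rewrite mxE liftK. Qed.

Lemma insert1_neq0 i y : insert i 1 y != 0.
Proof.
apply/eqP => /rowP/(_ i); rewrite insertE mxE => /eqP.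
by rewrite oner_eq0.
Qed.

Lemma affineK i y : affine i (insert i 1 y) = y.
Proof. by apply/rowP => j; rewrite mxE insert_lift insertE divr1. Qed.

Lemma insert_affine i (x : 'rV[R]_n.+1) : x 0 i != 0 -> x = x 0 i *: insert i 1 (affine i x).
Proof.
move=> x0; apply/rowP => k; rewrite mxE.
case: (unliftP i k) => [j ->|->]; last by rewrite insertE mulr1.
by rewrite insert_lift mxE mulrC divfK.
Qed.

Lemma smooth_insert i j (U : set 'rV[R]_n) (t : 'rV[R]_n -> R) : open U -> smooth U t ->
  smooth U (fun y => insert i (t y) y 0 j).
Proof.
move=> oU st; case: (unliftP i j) => [k ->|->].
  apply: (@eq_smooth _ _ _ oU (fun y => y 0 k)); last exact: smooth_coord.
  by move=> y _; rewrite insert_lift.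
by apply: (@eq_smooth _ _ _ oU t) => // y _; rewrite insertE.
Qed.

Lemma smooth_affine i j (U : set 'rV[R]_n.+1) : open U -> (forall x, U x -> x 0 i != 0) ->
  smooth U (fun x => affine i x 0 j).
Proof.
move=> oU U0; apply: (@eq_smooth _ _ _ oU (fun x => x 0 (lift i j) * (x 0 i)^-1)).
  by move=> x _; rewrite [RHS]mxE.
apply: smoothM => //; first exact: smooth_coord.
by apply: smoothV => //; exact: smooth_coord.
Qed.

Lemma line_scale (p q : punctured R n.+1) (a : R) : val p = a *: val q -> line p = line q.
Proof.
move=> e; have a0 : a != 0.
  by apply: contraNneq (punctured_neq0 p) => a0; rewrite e a0 scale0r.
by apply/line_eq; exists (Sub a a0).
Qed.

Lemma RP_domE i (p : punctured R n.+1) : dom (RP_chart i) (line p) <-> val p 0 i != 0.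
Proof.
have [a a0 aE] := line_repr p.
by rewrite /= aE mxE mulf_eq0 (negPf a0).
Qed.

Lemma RP_coordE i (p : punctured R n.+1) : coord (RP_chart i) (line p) = affine i (val p).
Proof.
have [a a0 aE] := line_repr p; apply/rowP => j.
by rewrite [LHS]mxE aE !mxE -mulf_div divff // mul1r.
Qed.

Lemma RP_surj (x : RP R n) : exists p, x = line p.
Proof. by exists (repr x); rewrite /line reprK. Qed.

Definition RP_inv i y : RP R n := line (to_punctured (insert i 1 y)).

Lemma RP_invK i y : dom (RP_chart i) (RP_inv i y) /\ coord (RP_chart i) (RP_inv i y) = y.
Proof.
have i0 := insert1_neq0 i y; split.
  by apply/RP_domE; rewrite to_puncturedK // insertE oner_neq0.
by rewrite RP_coordE to_puncturedK // affineK.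
Qed.

Lemma RP_coordK i x : dom (RP_chart i) x -> RP_inv i (coord (RP_chart i) x) = x.
Proof.
have [p ->] := RP_surj x => /RP_domE p0; rewrite RP_coordE.
apply/esym/(@line_scale _ _ (val p 0 i)).
by rewrite to_puncturedK ?insert1_neq0 // -insert_affine.
Qed.

Lemma line_continuous : continuous (@line R n).
Proof. exact: orbit_pi_continuous. Qed.

Lemma RP_dom_open i : open (dom (RP_chart i)).
Proof.
apply: orbit_open.
rewrite (_ : _ @^-1` _ = (fun p : punctured R n.+1 => val p 0 i) @^-1` [set t | t != 0]).
  apply: open_comp; last exact: open_neq.
  by move=> p _; exact: continuous_set_coord.
by apply/seteqP; split=> p /RP_domE.
Qed.

Lemma insert1_continuous i : continuous (insert i 1).
Proof.
move=> y; apply: (@smooth_row_continuous _ _ _ setT) => // j.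
by apply: smooth_insert; [exact: openT|apply: smooth_cst; exact: openT].
Qed.

Lemma RP_is_chart i : is_chart (RP_chart i).
Proof.
apply: (@chart_of_inverse _ _ _ _ setT (RP_inv i)).
- exact: RP_dom_open.
- apply: (orbit_continuous_on (@RP_dom_open i)) => p /RP_domE p0.
  rewrite (_ : _ \o _ = (fun p : punctured R n.+1 => affine i (val p))); last first.
    by apply: funext => q; exact: RP_coordE.
  apply: continuous_mx => k j.
  rewrite (_ : (fun _ => _) = (fun p : punctured R n.+1 => val p 0 (lift i j) / val p 0 i)).
    apply: continuousM; first exact: continuous_set_coord.
    by apply: continuousV => //; exact: continuous_set_coord.
  by apply: funext => q; rewrite mxE.
- exact: openT.
- move=> y _; apply: (@continuous_comp _ _ _ (fun y => to_punctured (insert i 1 y)) (@line R n)).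
    apply: (@continuous_comp _ _ _ (insert i 1) (@to_punctured R n)).
      exact: insert1_continuous.
    by apply: continuous_to_punctured; exact: insert1_neq0.
  exact: line_continuous.
- by move=> y _; exact: RP_invK.
- by move=> x xd; split=> //; exact: RP_coordK.
Qed.

Lemma RP_smooth_atlas : smooth_atlas (@RP_atlas R n).
Proof.
split.
- by move=> _ [i ->]; exact: RP_is_chart.
- move=> x; have [p ->] := RP_surj x.
  have [i pi0] : exists i, val p 0 i != 0.
    apply: contrapT => np; have /eqP := punctured_neq0 p; apply.
    apply/rowP => i; rewrite mxE; apply/eqP.
    by have [//|pi0] := boolP (val p 0 i == 0); case: np; exists i.
  by exists (RP_chart i); [exists i|apply/RP_domE].
move=> _ _ [i ->] [i' ->].
pose E := [set y | insert i 1 y 0 i' != 0].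
have oE : open E.
  by apply: open_comp (@open_coord_neq0 R n.+1 i') => y _; exact: insert1_continuous.
apply: (@smooth_in_chartsP _ _ _ _ _ (RP_chart i) (RP_chart i') _ E
  (fun y => affine i' (insert i 1 y))) => //.
- move=> x xd xd'; have xE := RP_coordK xd; rewrite -xE in xd'.
  have i0 := insert1_neq0 i (coord (RP_chart i) x).
  split; first by move: xd' => /RP_domE; rewrite to_puncturedK.
  by rewrite -[in RHS]xE RP_coordE to_puncturedK.
- move=> j; apply: (@smooth_comp _ _ _ _ [set x | x 0 i' != 0] (insert i 1) oE _
    (fun x => affine i' x 0 j)) => // [k|].
    by apply: smooth_insert => //; exact: smooth_cst.
  by apply: smooth_affine => //; exact: open_coord_neq0.
Qed.

End ProjectiveSpace.

(** * The symmetric power of the projective plane *)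

Section SymmetricPower.
Variables (R : realType) (d : nat).
Hypothesis hd : (0 < d)%N.
Local Notation N := (2 * d + 1)%N.
Local Notation N1 := (2 * d).+1.
Local Notation vectors := (power (punctured R 3) d).
Local Notation lines := (power (RP R 2) d).
Local Notation mchart := (multipole_chart d).
Local Notation schart := (SymRP_chart d).
Implicit Types (F : 'M[R]_3) (v : vectors) (a : 'rV[R]_(2 * d)).

(** Coordinates of the multipole with fibre coordinate 1 over a divisor: the
    section of the principal bundle that defines its trivialisation over the
    chart. *)
Definition unit_fibre a : 'rV[R]_N := row_mx a (const_mx 1).

Lemma divisor_surj (D : SymRP R d) : exists v, D = divisor v.
Proof.
exists (fun i => repr (repr D i)); rewrite /divisor -[LHS]reprK.
by congr (\pi _); apply: funext => i; rewrite /line reprK.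
Qed.

Lemma divisor_rescale l v : divisor (rescale l v) = divisor v.
Proof.
by congr (\pi _); apply: funext => i; apply/line_eq; exists (l i); exact: scale_val.
Qed.

Lemma proj_act l (m : multipole R d) : multipole_proj (act l m) = multipole_proj m.
Proof.
have [v ->] := multipole_pi_surj m.
by rewrite (act_pi (Ordinal hd)) !projE divisor_rescale.
Qed.

Lemma unit_fibre_lift F (D : SymRP R d) : frames F -> dom (schart F) D ->
  exists m, [/\ multipole_proj m = D, dom (mchart F) m &
                coord (mchart F) m = unit_fibre (coord (schart F) D)].
Proof.
move=> FF; have [v DE] := divisor_surj D; rewrite DE => Dd.
have hv : forall i, height F (val (v i)) != 0.
  by apply/(@multipole_domE R d F); rewrite /= projE.
have f0 := fibre_neq0 hv.
have c0 : (fibre F v)^-1 != 0 by rewrite invr_eq0.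
pose l : Rstar R := Sub (fibre F v)^-1 c0.
pose w := scale_at (Ordinal hd) l v.
have pw : multipole_proj (\pi_(multipole R d) w) = divisor v by rewrite projE divisor_rescale.
exists (\pi_(multipole R d) w); split=> //.
  by change (dom (schart F) (multipole_proj (\pi_(multipole R d) w))); rewrite pw.
change (row_mx (coord (schart F) (multipole_proj (\pi_(multipole R d) w)))
  (const_mx (multipole_fibre F (\pi_(multipole R d) w))) = unit_fibre (coord (schart F) (divisor v))).
by rewrite pw multipole_fibreE fibre_rescale (scale_prod_at (Ordinal hd)) /= mulVf.
Qed.

Lemma coord_proj F m : coord (schart F) (multipole_proj m) = lsubmx (coord (mchart F) m).
Proof. by rewrite row_mxKl. Qed.

Lemma unit_fibre_image a : chart_image (unit_fibre a) <-> in_disk d a.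
Proof.
rewrite /chart_image /in_disk /unit_fibre /= monic_of_row_mx // last_row_mx.
by split=> [[]//|H]; split=> //; exact: oner_neq0.
Qed.

(** Charts of the symmetric power are studied through that section, so that no
    further smoothness statement on divisors is needed. *)
Definition sym_inv F a : SymRP R d := multipole_proj (chart_inv hd F (unit_fibre a)).

Lemma sym_invK F a : frames F -> in_disk d a ->
  dom (schart F) (sym_inv F a) /\ coord (schart F) (sym_inv F a) = a.
Proof.
move=> FF /unit_fibre_image aE; have [xd xE] := chart_invK hd FF aE.
by split=> //; rewrite coord_proj xE row_mxKl.
Qed.

Lemma sym_coordK F D : frames F -> dom (schart F) D ->
  in_disk d (coord (schart F) D) /\ sym_inv F (coord (schart F) D) = D.
Proof.
move=> FF /(unit_fibre_lift FF)[m [mD md mE]].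
have [xE xK] := chart_coordK hd FF md; rewrite mE in xE xK.
by split; [exact/unit_fibre_image|rewrite /sym_inv xK].
Qed.

Lemma smooth_unit_fibre (U : set 'rV[R]_(2 * d)) j : open U ->
  smooth U (fun a => unit_fibre a 0 j).
Proof.
move=> oU; case: (split_ordP j) => k ->.
  apply: (@eq_smooth _ _ _ oU (fun a => a 0 k)); last exact: smooth_coord.
  by move=> a _; rewrite row_mxEl.
apply: (@eq_smooth _ _ _ oU (fun=> 1)); last exact: smooth_cst.
by move=> a _; rewrite row_mxEr mxE.
Qed.

Lemma unit_fibre_continuous : continuous unit_fibre.
Proof.
move=> a; apply: (@smooth_row_continuous _ _ _ setT) => // j.
by apply: smooth_unit_fibre; exact: openT.
Qed.

Lemma SymRP_is_chart F : frames F -> is_chart (schart F).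
Proof.
move=> FF; apply: (@chart_of_inverse _ _ _ _ (@in_disk R (2 * d) d) (sym_inv F)).
- exact: SymRP_dom_open.
- by move=> D; exact: SymRP_coord_continuous.
- exact: open_in_disk.
- move=> a /unit_fibre_image aE.
  apply: (@continuous_comp _ _ _ (fun a => chart_inv hd F (unit_fibre a)) (@multipole_proj R d)).
    apply: (@continuous_comp _ _ _ unit_fibre (chart_inv hd F)).
      exact: unit_fibre_continuous.
    exact: chart_inv_continuous.
  exact: proj_continuous.
- by move=> a; exact: sym_invK.
- by move=> D; exact: sym_coordK.
Qed.

(** Form of the multipole with fibre coordinate 1. Its class in projective space
    is the local expression of [sym_to_RP]. *)
Definition unit_form F a : 'rV[R]_N1 := chart_form d F (unit_fibre a).

Lemma smooth_unit_form F j : frames F -> smooth (@in_disk R (2 * d) d) (fun a => unit_form F a 0 j).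
Proof.
move=> FF; have oE := @open_in_disk R (2 * d) d.
apply: (@smooth_comp _ _ _ _ (@chart_image R d) unit_fibre oE _ (fun x => chart_form d F x 0 j)).
- by move=> a /unit_fibre_image.
- by move=> k; exact: smooth_unit_fibre.
- exact: smooth_chart_form.
Qed.

Lemma unit_form_continuous F a : frames F -> in_disk d a -> {for a, continuous (unit_form F)}.
Proof.
by move=> FF aE; apply: smooth_row_continuous aE => j; exact: smooth_unit_form.
Qed.

Lemma unit_form_neq0 F a : frames F -> in_disk d a -> unit_form F a != 0.
Proof. by move=> FF /unit_fibre_image; exact: chart_form_neq0. Qed.

Lemma unit_form_lift F D : frames F -> dom (schart F) D ->
  exists m, multipole_proj m = D /\ unit_form F (coord (schart F) D) = val (form_of m).
Proof.
move=> FF /(unit_fibre_lift FF)[m [mD md mE]]; exists m; split=> //.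
by rewrite /unit_form -mE chart_form_form_of.
Qed.

Lemma SymRP_smooth_atlas : smooth_atlas (@SymRP_atlas R d).
Proof.
split.
- by move=> _ [F FF <-]; exact: SymRP_is_chart.
- move=> D; have [v ->] := divisor_surj D.
  have [F FF hF] := @frame_avoiding R 'I_d (fun i => val (v i)) (fun i => punctured_neq0 (v i)).
  exists (schart F); first by exists F.
  by have /(@multipole_domE R d F) := hF; rewrite /= projE.
move=> _ _ [F FF <-] [F' FF' <-].
pose E := @in_disk R (2 * d) d `&` unit_form F @^-1` form_dom hd F'.
have oE : open E.
  apply: open_continuous_preimage; first exact: open_in_disk.
    by move=> a; exact: unit_form_continuous.
  exact: form_dom_open.
apply: (@smooth_in_chartsP _ _ _ _ _ (schart F) (schart F') _ E
  (fun a => lsubmx (form_coord hd F' (unit_form F a)))) => //.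
- move=> D Dd Dd'; have [aE _] := sym_coordK FF Dd.
  have [m [mD uE]] := unit_form_lift FF Dd.
  have md' : dom (mchart F') m by rewrite /= mD.
  have [kd kE] := form_dom_form_of hd md'.
  by rewrite /E /setI /= uE; split=> //; rewrite kE -coord_proj mD.
- move=> j; apply: (@eq_smooth _ _ _ oE (fun a => form_coord hd F' (unit_form F a) 0 (lshift 1 j))).
    by move=> a _; rewrite [RHS]mxE.
  apply: (@smooth_comp _ _ _ _ (form_dom hd F') (unit_form F) oE _
    (fun p => form_coord hd F' p 0 (lshift 1 j))).
  + by move=> a [].
  + by move=> k; apply: smoothS (smooth_unit_form k FF) => a [].
  + exact: smooth_form_coord.
Qed.

Definition sym_to_RP (D : SymRP R d) : RP R (2 * d) := line (punctured_form (fun i => repr (repr D i))).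

Lemma sym_to_RPE v : sym_to_RP (divisor v) = line (punctured_form v).
Proof.
pose f (w : lines) : RP R (2 * d) := line (punctured_form (fun i => repr (w i))).
have -> : sym_to_RP (divisor v) = f (fun i => line (v i)).
  apply: (@invariant_repr _ _ (@permute_bij (RP R 2) d) _ f) => g [s _ <-] w.
  by congr line; apply: val_inj; exact: form_permute.
have ex i : {l : Rstar R | val (repr (line (v i))) = val l *: val (v i)}.
  by apply: cid; apply/line_eq; rewrite /line reprK.
pose l i := projT1 (ex i).
have -> : f (fun i => line (v i)) = line (punctured_form (rescale l v)).
  congr (line (punctured_form _)); apply: funext => i; apply: val_inj.
  by rewrite [LHS](projT2 (ex i)).
by apply: (@line_scale _ _ _ _ (scale_prod l)); exact: form_rescale.
Qed.

Lemma sym_to_RP_proj m : sym_to_RP (multipole_proj m) = line (form_of m).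
Proof. by have [v ->] := multipole_pi_surj m; rewrite projE sym_to_RPE form_ofE. Qed.

Definition RP_to_sym (x : RP R (2 * d)) : SymRP R d := multipole_proj (multipole_of hd (repr x)).

Lemma RP_to_symE p : RP_to_sym (line p) = multipole_proj (multipole_of hd p).
Proof.
have /line_eq[l lE] : line (repr (line p)) = line p by rewrite /line reprK.
rewrite /RP_to_sym (_ : multipole_of hd _ = act l (multipole_of hd p)); first exact: proj_act.
apply: (can_inj (form_ofK hd)); rewrite multipole_ofK; apply: val_inj.
by rewrite lE form_of_act // multipole_ofK.
Qed.

Lemma sym_to_RPK : cancel sym_to_RP RP_to_sym.
Proof.
by move=> D; have [v ->] := divisor_surj D; rewrite sym_to_RPE RP_to_symE multipole_ofE projE.
Qed.

Lemma RP_to_symK : cancel RP_to_sym sym_to_RP.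
Proof. by move=> x; have [p ->] := RP_surj x; rewrite RP_to_symE sym_to_RP_proj multipole_ofK. Qed.

Lemma RP_to_sym_continuous : continuous RP_to_sym.
Proof.
apply: orbit_continuous; rewrite (_ : _ \o _ = @multipole_proj R d \o multipole_of hd); last first.
  by apply: funext => p; exact: RP_to_symE.
move=> p; apply: (@continuous_comp _ _ _ (multipole_of hd) (@multipole_proj R d)).
  exact: multipole_of_continuous.
exact: proj_continuous.
Qed.

Lemma sym_to_RP_chart F D : frames F -> dom (schart F) D ->
  sym_to_RP D = line (to_punctured (unit_form F (coord (schart F) D))).
Proof.
move=> FF Dd; have [m [<- ->]] := unit_form_lift FF Dd.
by rewrite sym_to_RP_proj val_to_punctured.
Qed.

(** Proved in charts, as powers of quotient maps need not be quotient maps. *)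
Lemma sym_to_RP_continuous : continuous sym_to_RP.
Proof.
move=> D; have [_ cover _] := SymRP_smooth_atlas; have [_ [F FF <-] Dd] := cover D.
have [aE _] := sym_coordK FF Dd.
have c : {for D, continuous (fun D => line (to_punctured (unit_form F (coord (schart F) D))))}.
  apply: (@continuous_comp _ _ _ (fun D => to_punctured (unit_form F (coord (schart F) D)))
    (@line R (2 * d))); last exact: line_continuous.
  apply: (@continuous_comp _ _ _ (fun D => unit_form F (coord (schart F) D))
    (@to_punctured R (2 * d))).
    apply: (@continuous_comp _ _ _ (coord (schart F)) (unit_form F)).
      exact: SymRP_coord_continuous.
    exact: unit_form_continuous.
  by apply: continuous_to_punctured; exact: unit_form_neq0.
have near_dom : \forall E \near D, dom (schart F) E.
  by apply: open_nbhs_nbhs; split=> //; exact: SymRP_dom_open.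
move=> U; rewrite (sym_to_RP_chart FF Dd) => /c cU.
change (nbhs D (sym_to_RP @^-1` U)).
apply: filterS (filterI near_dom cU) => E [Ed].
by rewrite /= (sym_to_RP_chart FF Ed).
Qed.

Lemma sym_diffeomorphic : diffeomorphic (@SymRP_atlas R d) (@RP_atlas R (2 * d)).
Proof.
split; [exact: SymRP_smooth_atlas|exact: RP_smooth_atlas|].
exists sym_to_RP, RP_to_sym; split; [exact: sym_to_RPK|exact: RP_to_symK| |].
  split; first exact: sym_to_RP_continuous.
  move=> _ _ [F FF <-] [i ->].
  pose V := [set x : 'rV[R]_N1 | x 0 i != 0].
  have oV : open V by exact: open_coord_neq0.
  pose E := @in_disk R (2 * d) d `&` unit_form F @^-1` V.
  have oE : open E.
    apply: open_continuous_preimage oV; first exact: open_in_disk.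
    by move=> a; exact: unit_form_continuous.
  change (smooth_in_charts (schart F) (RP_chart R i) sym_to_RP).
  apply: (@smooth_in_chartsP _ _ _ _ _ (schart F) (RP_chart R i) sym_to_RP E
    (fun a => affine i (unit_form F a))) => //.
  - move=> D Dd; have [aE _] := sym_coordK FF Dd.
    have n0 := unit_form_neq0 FF aE.
    rewrite (sym_to_RP_chart FF Dd) => /RP_domE; rewrite RP_coordE to_puncturedK //.
  - move=> j; apply: (@smooth_comp _ _ _ _ V (unit_form F) oE _ (fun x => affine i x 0 j)).
    + by move=> a [].
    + by move=> k; apply: smoothS (smooth_unit_form k FF) => a [].
    + exact: smooth_affine.
split; first exact: RP_to_sym_continuous.
move=> _ _ [i ->] [F FF <-].
pose E := insert i 1 @^-1` form_dom hd F.
have oE : open E.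
  apply: open_comp (@form_dom_open R d hd F) => y _; exact: insert1_continuous.
change (smooth_in_charts (RP_chart R i) (schart F) RP_to_sym).
apply: (@smooth_in_chartsP _ _ _ _ _ (RP_chart R i) (schart F) RP_to_sym E
  (fun y => lsubmx (form_coord hd F (insert i 1 y)))) => //.
- move=> x xd; pose p := to_punctured (insert i 1 (coord (RP_chart R i) x)).
  have -> : RP_to_sym x = multipole_proj (multipole_of hd p).
    by rewrite -[in LHS](RP_coordK xd) RP_to_symE.
  move=> Dd; split; last by rewrite coord_proj.
  split; [exact: insert1_neq0|exact: Dd].
- move=> j; apply: (@eq_smooth _ _ _ oE (fun y => form_coord hd F (insert i 1 y) 0 (lshift 1 j))).
    by move=> a _; rewrite [RHS]mxE.
  apply: (@smooth_comp _ _ _ _ (form_dom hd F) (insert i 1) oE _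
    (fun p => form_coord hd F p 0 (lshift 1 j))) => // [k|].
    by apply: smooth_insert => //; exact: smooth_cst.
  exact: smooth_form_coord.
Qed.

End SymmetricPower.

(** * Polar coordinates *)

Section SphereLine.
Variables (R : realType) (n : nat).
Implicit Types (i : 'I_n.+1) (b : bool) (t : R) (p : punctured R n.+1) (y : 'rV[R]_(n + 1)).

(** Inverse of the increasing bijection r |-> r - 1/r from the positive numbers
    to the line. It is used in place of the exponential because it is algebraic.
    *)
Definition radius t : R := (t + Num.sqrt (t ^+ 2 + 4)) / 2.

Lemma radius_spec t : 0 < radius t /\ radius t - (radius t)^-1 = t.
Proof.
pose s := Num.sqrt (t ^+ 2 + 4).
have sE : s ^+ 2 = t ^+ 2 + 4 by rewrite sqr_sqrtr // addr_ge0 ?sqr_ge0.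
have s0 : 0 <= s by exact: sqrtr_ge0.
have r0 : 0 < radius t by rewrite /radius -/s; nra.
split=> //; have e : radius t * ((s - t) / 2) = 1 by rewrite /radius -/s; field: sE.
have -> : (radius t)^-1 = (s - t) / 2.
  by apply: (mulfI (lt0r_neq0 r0)); rewrite e mulfV // gt_eqF.
by rewrite /radius -/s; field.
Qed.

Lemma radius_gt0 t : 0 < radius t. Proof. by have [] := radius_spec t. Qed.

Lemma radiusK (r : R) : 0 < r -> radius (r - r^-1) = r.
Proof.
move=> r0; rewrite /radius; have -> : (r - r^-1) ^+ 2 + 4 = (r + r^-1) ^+ 2.
  by field; rewrite gt_eqF.
rewrite sqrtr_sqr ger0_norm; last by rewrite ltW // addr_gt0 ?invr_gt0.
by field; rewrite gt_eqF.
Qed.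

Lemma smooth_radius m (U : set 'rV[R]_m) (f : 'rV[R]_m -> R) : open U -> smooth U f ->
  smooth U (fun x => radius (f x)).
Proof.
move=> oU sf; apply: smoothM => //; last exact: smooth_cst.
apply: smoothD => //; apply: smooth_sqrt => //.
  by move=> x _; rewrite ltr_wpDl ?sqr_ge0.
apply: smoothD => //; last exact: smooth_cst.
by apply: eq_smooth (smoothM oU sf sf) => // x _; rewrite expr2.
Qed.

Lemma sphere_eucl (x : sphere R n) : eucl (val x) = 1.
Proof. by have := set_mem (valP x); rewrite /eucl /= => ->; rewrite sqrtr1. Qed.

Lemma unit_in_sphere (x : 'rV[R]_n.+1) : x != 0 ->
  (eucl x)^-1 *: x \in [set x : 'rV[R]_n.+1 | \sum_i x 0 i ^+ 2 = 1].
Proof.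
rewrite -eucl_gt0 => x0; apply: mem_set => /=.
have e : eucl ((eucl x)^-1 *: x) = 1.
  by rewrite euclZ ger0_norm ?invr_ge0 ?ltW // mulVf // gt_eqF.
have := congr1 (fun t => t ^+ 2) e; rewrite /eucl sqr_sqrtr ?expr1n //.
by apply: sumr_ge0 => i _; exact: sqr_ge0.
Qed.

Definition polar p : sphere R n * R :=
  (Sub ((eucl (val p))^-1 *: val p) (unit_in_sphere (punctured_neq0 p)),
   eucl (val p) - (eucl (val p))^-1).

Definition unpolar (x : sphere R n * R) : punctured R n.+1 :=
  to_punctured (radius x.2 *: val x.1).

Lemma val_unpolar x : val (unpolar x) = radius x.2 *: val x.1.
Proof.
rewrite to_puncturedK // -eucl_gt0 euclZ sphere_eucl mulr1 normr_gt0.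
by rewrite gt_eqF // radius_gt0.
Qed.

Lemma eucl_unpolar x : eucl (val (unpolar x)) = radius x.2.
Proof. by rewrite val_unpolar euclZ sphere_eucl mulr1 gtr0_norm // radius_gt0. Qed.

Lemma polarK : cancel polar unpolar.
Proof.
move=> p; apply: val_inj; have p0 : 0 < eucl (val p) by rewrite eucl_gt0 punctured_neq0.
by rewrite val_unpolar radiusK //= scalerA divff ?scale1r // gt_eqF.
Qed.

Lemma unpolarK : cancel unpolar polar.
Proof.
move=> [x t]; have [r0 rE] := radius_spec t; congr pair; last by rewrite eucl_unpolar.
by apply: val_inj; rewrite /= eucl_unpolar val_unpolar scalerA mulVf ?scale1r // gt_eqF.
Qed.

Lemma polar_continuous : continuous polar.
Proof.
move=> p; have p0 : eucl (val p) != 0 by rewrite gt_eqF // eucl_gt0 punctured_neq0.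
have cV : {for p, continuous (fun p : punctured R n.+1 => (eucl (val p))^-1)}.
  by apply: continuousV => //; exact: continuous_set_eucl.
apply: (@continuous_prod_pair _ _ _ (fun p => (polar p).1) (fun p => (polar p).2)); last by apply: continuousB => //; exact: continuous_set_eucl.
apply: continuous_set_type; apply: continuous_mx => k j; rewrite ord1.
rewrite (_ : (fun _ => _) = (fun p : punctured R n.+1 => (eucl (val p))^-1 * val p 0 j)).
  by apply: continuousM => //; exact: continuous_set_coord.
by apply: funext => q; rewrite mxE.
Qed.

Lemma continuous_radius : continuous radius.
Proof.
move=> t.
apply: (@continuousM _ _ (fun t : R => t + Num.sqrt (t ^+ 2 + 4)) (fun=> 2^-1));
  last exact: cst_continuous.
apply: (@continuousD _ _ _ id (fun t => Num.sqrt (t ^+ 2 + 4))) => //.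
apply: (@continuous_comp _ _ _ (fun t => t ^+ 2 + 4) Num.sqrt); last exact: sqrt_continuous.
apply: continuousD; last exact: cst_continuous.
exact: exprn_continuous.
Qed.

Lemma continuous_sphere_coord j (x : sphere R n * R) :
  {for x, continuous (fun x : sphere R n * R => val x.1 0 j)}.
Proof.
apply: (@continuous_comp _ _ _ fst (fun x : sphere R n => val x 0 j)); first exact: cvg_fst.
exact: continuous_set_coord.
Qed.

Lemma unpolar_continuous : continuous unpolar.
Proof.
move=> x; apply: continuous_set_type.
rewrite (_ : (fun _ => _) = (fun x => radius x.2 *: val x.1)); last first.
  by apply: funext => z; exact: val_unpolar.
apply: continuous_mx => k j; rewrite ord1.
rewrite (_ : (fun _ => _) = (fun x : sphere R n * R => radius x.2 * val x.1 0 j)); last first.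
  by apply: funext => z; rewrite mxE.
apply: continuousM.
  apply: (@continuous_comp _ _ _ snd radius); last exact: continuous_radius.
  exact: cvg_snd.
exact: continuous_sphere_coord.
Qed.

Definition hemi_chart i b : chart (sphere R n * R)%type (n + 1) :=
  Chart ([set x : sphere R n | 0 < (-1) ^+ b * val x 0 i] `*` setT)
        (fun x => row_mx (\row_(j < n) val x.1 0 (lift i j)) (const_mx x.2)).

Definition half_space i b : set 'rV[R]_n.+1 := [set x | 0 < (-1) ^+ b * x 0 i].

Lemma half_space_neq0 i b x : half_space i b x -> x != 0.
Proof. by rewrite /half_space /=; apply: contraTneq => ->; rewrite mxE mulr0 ltxx. Qed.

Lemma half_space_open i b : open (half_space i b).
Proof.
apply: (@open_comp _ _ (fun x : 'rV[R]_n.+1 => (-1) ^+ b * x 0 i) [set t | 0 < t]).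
  by move=> x _; apply: (@continuousM _ _ (fun=> (-1) ^+ b) (fun x : 'rV[R]_n.+1 => x 0 i));
    [exact: cst_continuous|exact: coord_continuous].
exact: open_gt.
Qed.

(** Local expression of [polar]; it does not depend on the sign that selects one
    of the two hemispheres. *)
Definition hemi_coord i (x : 'rV[R]_n.+1) : 'rV[R]_(n + 1) :=
  row_mx (\row_(j < n) (x 0 (lift i j) / eucl x)) (const_mx (eucl x - (eucl x)^-1)).

Definition disk : set 'rV[R]_(n + 1) := [set y | \sum_j y 0 (lshift 1 j) ^+ 2 < 1].

Lemma disk_open : open disk.
Proof.
apply: (@open_comp _ _ (fun y : 'rV[R]_(n + 1) => \sum_j y 0 (lshift 1 j) ^+ 2) [set t | t < 1]).
  move=> y _; apply: continuous_sum => j _.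
  apply: (@continuous_comp _ _ _ (fun y : 'rV[R]_(n + 1) => y 0 (lshift 1 j)) (fun t => t ^+ 2)).
    exact: coord_continuous.
  exact: exprn_continuous.
exact: open_lt.
Qed.

Definition hemi_lift i b y : 'rV[R]_n.+1 :=
  insert i ((-1) ^+ b * Num.sqrt (1 - \sum_j y 0 (lshift 1 j) ^+ 2)) (lsubmx y).

(** Local expression of [unpolar]: the missing coordinate of a point of the
    hemisphere is a signed square root. *)
Definition hemi_param i b y : 'rV[R]_n.+1 := radius (y 0 (rshift n 0)) *: hemi_lift i b y.

Lemma eucl_hemi_lift i b y : disk y -> eucl (hemi_lift i b y) = 1.
Proof.
move=> yd; rewrite /eucl (bigD1_ord i) //= insertE exprMn sqrr_sign mul1r sqr_sqrtr; last first.
  by rewrite subr_ge0 ltW.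
under [X in _ - _ + X]eq_bigr => j _ do rewrite insert_lift mxE.
by rewrite subrK sqrtr1.
Qed.

Lemma half_space_param i b y : disk y -> half_space i b (hemi_param i b y).
Proof.
move=> yd; rewrite /half_space /= mxE insertE mulrCA mulr_gt0 ?radius_gt0 //.
by rewrite mulrA -expr2 sqrr_sign mul1r sqrtr_gt0 subr_gt0.
Qed.

Lemma hemi_coordK i b y : disk y -> hemi_coord i (hemi_param i b y) = y.
Proof.
move=> yd; have [r0 rE] := radius_spec (y 0 (rshift n 0)).
have e : eucl (hemi_param i b y) = radius (y 0 (rshift n 0)).
  by rewrite euclZ eucl_hemi_lift // mulr1 gtr0_norm.
rewrite /hemi_coord e -[RHS]hsubmxK; congr row_mx; apply/rowP => j; last first.
  by rewrite ord1 [LHS]mxE rE mxE.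
by rewrite [LHS]mxE [X in X / _]mxE insert_lift mulrC mulKf // gt_eqF.
Qed.

Lemma polar_dom i b p : dom (hemi_chart i b) (polar p) <-> half_space i b (val p).
Proof.
have p0 : 0 < eucl (val p) by rewrite eucl_gt0 punctured_neq0.
have E : ((-1) ^+ b * ((eucl (val p))^-1 *: val p) 0 i > 0) = ((-1) ^+ b * val p 0 i > 0).
  by rewrite mxE mulrCA pmulr_rgt0 // invr_gt0.
by split=> [[/= + _]|H]; [rewrite E|split=> //=; rewrite E].
Qed.

Lemma polar_coord i b p : coord (hemi_chart i b) (polar p) = hemi_coord i (val p).
Proof.
congr row_mx; apply/rowP => j; rewrite !mxE // mulrC.
by [].
Qed.

Lemma hemi_param_row i b (w : 'rV[R]_n.+1) t : \sum_i w 0 i ^+ 2 = 1 -> half_space i b w ->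
  let y := row_mx (\row_(j < n) w 0 (lift i j)) (const_mx t) in
  disk y /\ hemi_param i b y = radius t *: w.
Proof.
rewrite (bigD1_ord i) //= => sq wi.
set y := row_mx _ _.
have sE : \sum_j y 0 (lshift 1 j) ^+ 2 = 1 - w 0 i ^+ 2.
  rewrite -sq addrAC subrr add0r; apply: eq_bigr => j _; by rewrite row_mxEl mxE.
have w0 : w 0 i != 0 by apply: contraTneq wi; rewrite /half_space /= => ->; rewrite mulr0 ltxx.
split; first by rewrite /disk /= sE ltrBlDr ltrDl exprn_even_gt0.
rewrite /hemi_param /hemi_lift sE row_mxEr mxE; congr (_ *: _).
rewrite opprB addrC subrK sqrtr_sqr row_mxKl.
apply/rowP => k; case: (unliftP i k) => [j ->|->]; first by rewrite insert_lift mxE.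
rewrite insertE; move: wi; rewrite /half_space /=; case: b => /=.
  by rewrite expr1 !mulN1r oppr_gt0 => wi; rewrite ltr0_norm // opprK.
by rewrite expr0 !mul1r => wi; rewrite gtr0_norm.
Qed.

Lemma hemi_paramK i b x : dom (hemi_chart i b) x ->
  disk (coord (hemi_chart i b) x) /\ hemi_param i b (coord (hemi_chart i b) x) = val (unpolar x).
Proof.
by move=> [xi _]; rewrite val_unpolar; apply: hemi_param_row xi; exact: set_mem (valP x.1).
Qed.

Lemma smooth_hemi_param i b j : smooth disk (fun y => hemi_param i b y 0 j).
Proof.
have oD := disk_open.
apply: (@eq_smooth _ _ _ oD (fun y => radius (y 0 (rshift n 0)) * hemi_lift i b y 0 j)).
  by move=> y _; rewrite [RHS]mxE.
apply: smoothM => //; first by apply: smooth_radius => //; exact: smooth_coord.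
case: (unliftP i j) => [k ->|->].
  apply: (@eq_smooth _ _ _ oD (fun y => y 0 (lshift 1 k))); last exact: smooth_coord.
  by move=> y _; rewrite insert_lift mxE.
apply: (@eq_smooth _ _ _ oD (fun y =>
    (-1) ^+ b * Num.sqrt (1 - \sum_j y 0 (lshift 1 j) ^+ 2))).
  by move=> y _; rewrite insertE.
apply: smoothM => //; first exact: smooth_cst.
apply: smooth_sqrt => //; first by move=> y yd; rewrite subr_gt0.
apply: smoothB => //; first exact: smooth_cst.
apply: smooth_sum => // k _.
have sk := smooth_coord oD (lshift 1 k).
by apply: eq_smooth (smoothM oD sk sk) => // x _; rewrite expr2.
Qed.

Lemma smooth_hemi_coord i j : smooth [set x : 'rV[R]_n.+1 | x != 0] (fun x => hemi_coord i x 0 j).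
Proof.
pose U := [set x : 'rV[R]_n.+1 | x != 0]; have oU : open U by exact: open_neq0.
have se : smooth U (fun x => eucl x).
  by apply: smooth_eucl => // k; exact: smooth_coord.
have sV : smooth U (fun x => (eucl x)^-1).
  by apply: smoothV => // x x0; rewrite gt_eqF // eucl_gt0.
case: (split_ordP j) => k ->.
  apply: (@eq_smooth _ _ _ oU (fun x => x 0 (lift i k) * (eucl x)^-1)).
    by move=> x _; rewrite row_mxEl mxE.
  by apply: smoothM => //; exact: smooth_coord.
apply: (@eq_smooth _ _ _ oU (fun x => eucl x - (eucl x)^-1)).
  by move=> x _; rewrite row_mxEr mxE.
exact: smoothB.
Qed.

Lemma hemi_param_continuous i b y : disk y -> {for y, continuous (hemi_param i b)}.
Proof.
by move=> yd; apply: smooth_row_continuous yd => j; exact: smooth_hemi_param.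
Qed.

Lemma hemi_atlasE c : prod_atlas (@sphere_atlas R n) (@line_atlas R) c <->
  exists i b, c = hemi_chart i b.
Proof.
split; first by move=> [_ [_ [[i [b ->]] -> ->]]]; exists i, b.
by move=> [i [b ->]]; eexists; eexists; split; [exists i, b; reflexivity|reflexivity|].
Qed.

Lemma hemi_is_chart i b : is_chart (hemi_chart i b).
Proof.
apply: (@chart_of_inverse _ _ _ _ disk (fun y => polar (to_punctured (hemi_param i b y)))).
- rewrite (_ : dom _ = unpolar @^-1` ((fun p => val p) @^-1` half_space i b)).
    apply: open_comp; first by move=> x _; exact: unpolar_continuous.
    apply: open_comp (@half_space_open i b) => x _; exact: set_val_continuous.
  apply/seteqP; split=> x; first by rewrite -{1}(unpolarK x) => /polar_dom.
  by rewrite -[in X in _ -> X](unpolarK x) => xh; apply/polar_dom.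
- move=> x _; apply: continuous_row_mx.
    apply: continuous_mx => k j.
    rewrite (_ : (fun _ => _) = (fun x : sphere R n * R => val x.1 0 (lift i j))).
      exact: continuous_sphere_coord.
    by apply: funext => z; rewrite mxE.
  by apply: continuous_const_mx; exact: cvg_snd.
- exact: disk_open.
- move=> y yd; apply: (@continuous_comp _ _ _ (fun y => to_punctured (hemi_param i b y)) polar).
    apply: (@continuous_comp _ _ _ (hemi_param i b) (@to_punctured R n)).
      exact: hemi_param_continuous.
    apply: continuous_to_punctured; exact: half_space_neq0 (half_space_param i b yd).
  exact: polar_continuous.
- move=> y yd; have h := half_space_param i b yd.
  have e := to_puncturedK (half_space_neq0 h).
  split; first by apply/polar_dom; rewrite e.
  by rewrite polar_coord e hemi_coordK.
- move=> x /hemi_paramK[xd xE]; split=> //.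
  by rewrite xE val_to_punctured unpolarK.
Qed.

Lemma hemi_smooth_atlas : smooth_atlas (prod_atlas (@sphere_atlas R n) (@line_atlas R)).
Proof.
split.
- by move=> _ /hemi_atlasE[i [b ->]]; exact: hemi_is_chart.
- move=> x; have [i xi] : exists i, val x.1 0 i != 0.
    apply: contrapT => nx; have /eqP := sphere_eucl x.1.
    rewrite (_ : val x.1 = 0) ; last first.
      apply/rowP => i; rewrite mxE; apply/eqP.
      by have [//|xi] := boolP (val x.1 0 i == 0); case: nx; exists i.
    by rewrite -[X in eucl X](scale0r 0) euclZ normr0 mul0r eq_sym oner_eq0.
  exists (hemi_chart i (val x.1 0 i < 0)); first by apply/hemi_atlasE; exists i, (val x.1 0 i < 0).
  by split=> //=; rewrite -normrEsign normr_gt0.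
move=> _ _ /hemi_atlasE[i [b ->]] /hemi_atlasE[i' [b' ->]].
pose E := disk `&` hemi_param i b @^-1` half_space i' b'.
have oE : open E.
  apply: open_continuous_preimage (@half_space_open i' b'); first exact: disk_open.
  by move=> y; exact: hemi_param_continuous.
apply: (@smooth_in_chartsP _ _ _ _ _ (hemi_chart i b) (hemi_chart i' b') id E
  (fun y => hemi_coord i' (hemi_param i b y))) => //.
- move=> x xd xd'; have [yd yE] := hemi_paramK xd.
  have h : half_space i' b' (val (unpolar x)) by apply/polar_dom; rewrite unpolarK.
  by rewrite /E /setI /= yE; split=> //; rewrite -(polar_coord i' b') unpolarK.
- move=> j; apply: (@smooth_comp _ _ _ _ [set x | x != 0] (hemi_param i b) oE _
    (fun x => hemi_coord i' x 0 j)).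
  + by move=> y [_ /half_space_neq0].
  + by move=> k; apply: smoothS (smooth_hemi_param i b k) => y [].
  + exact: smooth_hemi_coord.
Qed.

Lemma polar_diffeomorphic :
  diffeomorphic (@punctured_atlas R n.+1) (prod_atlas (@sphere_atlas R n) (@line_atlas R)).
Proof.
split; [exact: punctured_smooth_atlas|exact: hemi_smooth_atlas|].
exists polar, unpolar; split; [exact: polarK|exact: unpolarK| |].
  split; first exact: polar_continuous.
  move=> _ _ -> /hemi_atlasE[i [b ->]].
  apply: (@smooth_in_chartsP _ _ _ _ _ _ (hemi_chart i b) polar [set x | x != 0] (hemi_coord i)).
  - exact: open_neq0.
  - by move=> p _ _; split; [exact: punctured_neq0|rewrite polar_coord].
  - by move=> j; exact: smooth_hemi_coord.
split; first exact: unpolar_continuous.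
move=> _ _ /hemi_atlasE[i [b ->]] ->.
apply: (@smooth_in_chartsP _ _ _ _ _ (hemi_chart i b) _ unpolar disk (hemi_param i b)).
- exact: disk_open.
- by move=> x xd _; exact: hemi_paramK.
- by move=> j; exact: smooth_hemi_param.
Qed.

End SphereLine.

(** * Models of the multipole spaces *)

Theorem corollary15 (R : realType) (d : nat) (hd : (0 < d)%N) :
  (diffeomorphic (@multipole_atlas R d) (@punctured_atlas R (2 * d).+1) /\
   diffeomorphic (@punctured_atlas R (2 * d).+1)
                 (prod_atlas (@sphere_atlas R (2 * d)) (@line_atlas R))) /\
  homeomorphic (multipole_bar R d) 'rV[R]_(2 * d).+1 /\
  diffeomorphic (@SymRP_atlas R d) (@RP_atlas R (2 * d)).
Proof.
split; last by split; [exact: multipole_bar_homeomorphic|exact: sym_diffeomorphic].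
by split; [exact: multipole_diffeomorphic|exact: polar_diffeomorphic].
Qed.
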